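(* Let $d\ge1$, $0<\sigma<\infty$ and $\omega>0$. Then the constrained minimization problem $$J[\mathbf u]\to\min,\qquad \|\mathbf u\|_{l^{2\sigma+2}}^{2\sigma+2}=\sum_{n\in\mathbb Z^d}|u_n|^{2\sigma+2}=1$$ has a solution $\mathbf u=\mathbf u_\omega\in l^2(\mathbb Z^d)$. The solution has non-negative entries only, which in addition obey the following: for every $j_0\in\{1,\dots,d\}$ and fixed integers $k_1,\dots,k_{j_0-1},k_{j_0+1},\dots,k_d$, writing $w_l:=u_{k_1,\dots,k_{j_0-1},\,l,\,k_{j_0+1},\dots,k_d}$, there exist integers $l_0$ and $i_0\ge0$, depending on $(k_1,\dots,k_{j_0-1},k_{j_0+1},\dots,k_d)$, so that $$w_{l_0}=\dots=w_{l_0+i_0}>w_{l_0+i_0+1}\ge w_{l_0+i_0+2}\ge\dots,\qquad w_{l_0}>w_{l_0-1}\ge w_{l_0-2}\ge\dots .$$ The minimizer $\mathbf u_\omega$ satisfies the Euler–Lagrange equation $$-(\Delta_{disc}\mathbf u)_n+\omega u_n-j(\omega)u_n^{2\sigma+1}=0,\qquad n\in\mathbb Z^d,$$ where $j(\omega)=\inf_{\|\mathbf u\|_{l^{2\sigma+2}}=1}J[\mathbf u]>0$. Moreover, every minimizing sequence for the problem has a subsequence that converges, in the $l^2$ norm, to a constrained minimizer of the problem. The linearized Schrödinger operator $$(\mathcal L_+f)_n=-(\Delta_{disc}f)_n+\omega f_n-(2\sigma+1)j(\omega)u_n^{2\sigma}f_n$$ has the property $n(\mathcal L_+)=1$.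
   Context: The discrete Laplacian on $\mathbb Z^d$ is $(\Delta_{disc}\mathbf u)_n=\sum_{j\in\mathbb Z^d:|j-n|=1}u_j-2d\,u_n$. For $\omega>0$ and $\mathbf u\in l^2(\mathbb Z^d)$, $$J[\mathbf u]=\sum_{|j-n|=1}|u_j-u_n|^2+\omega\sum_{n\in\mathbb Z^d}|u_n|^2,$$ where the first sum runs over unordered nearest-neighbour pairs (each edge counted once), so that it equals $\langle-\Delta_{disc}\mathbf u,\mathbf u\rangle$. A minimizing sequence is a sequence $\mathbf u^k\in l^2(\mathbb Z^d)$ with $\|\mathbf u^k\|_{l^{2\sigma+2}}=1$ and $J[\mathbf u^k]\to j(\omega)$. $n(\mathcal L_+)$ is the Morse index: the number of negative eigenvalues of the self-adjoint operator $\mathcal L_+$ on $l^2(\mathbb Z^d)$, counted with multiplicity.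
   Formalization: The claim that every minimizing sequence has an l^2-convergent subsequence fails for translates u(·−k e_1) of a minimizer; it is proved instead that a subsequence, after suitable lattice translations, converges in l^2 to a constrained minimizer. *)

(* Defs.v *)
From HB Require Import structures.
From mathcomp Require Import all_boot all_order all_algebra.
From mathcomp Require Import all_classical all_reals all_analysis.
From mathcomp Require Import complex.

Set Implicit Arguments.
Unset Strict Implicit.
Unset Printing Implicit Defensive.
Import Order.TTheory GRing.Theory Num.Theory numFieldNormedType.Exports.
Local Open Scope classical_set_scope.
Local Open Scope ring_scope.
Local Open Scope complex_scope.

Notation lattice d := 'rV[int]_d.

(* [|j - n| = 1], through the square of the Euclidean norm. *)
Definition nearest_neighbour (d : nat) (n j : lattice d) : Prop :=
  \sum_(i < d) (j 0 i - n 0 i) ^+ 2 = 1.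

(* [\sum_(j \in A) F j] is 0 when [F] has infinite support in [A]; here
   [A] is the set of the 2d neighbours of [n]. *)
Definition disc_laplacian (d : nat) (V : zmodType) (u : lattice d -> V)
    (n : lattice d) : V :=
  \sum_(j \in [set j | nearest_neighbour n j]) u j - u n *+ (2 * d).

Section sequence_spaces.
Variables (R : realType) (d : nat).

(* [`|z|] lives in [R[i]]; its real part is the modulus as an element of [R]. *)
Definition modulus (z : R[i]) : R := complex.Re `|z|.

Definition lp_sum (p : R) (u : lattice d -> R[i]) : \bar R :=
  \esum_(n in [set: lattice d]) (modulus (u n) `^ p)%:E.

Definition lp_norm (p : R) (u : lattice d -> R[i]) : \bar R :=
  poweR (lp_sum p u) p^-1.

Definition ell2 (u : lattice d -> R[i]) : Prop := (lp_norm 2 u < +oo)%E.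

End sequence_spaces.

Section minimization.
Variables (R : realType) (d : nat) (sigma omega : R).

(* The sum over ordered pairs counts every edge twice, hence the factor 1/2. *)
Definition kinetic (u : lattice d -> R[i]) : \bar R :=
  ((2^-1)%:E *
   \esum_(e in [set e : lattice d * lattice d | nearest_neighbour e.1 e.2])
      (modulus (u e.2 - u e.1) ^+ 2)%:E)%E.

(* Both terms are finite on [ell2], the only place where [energy] is used. *)
Definition energy (u : lattice d -> R[i]) : R :=
  fine (kinetic u) + omega * fine (lp_sum 2 u).

Definition admissible (u : lattice d -> R[i]) : Prop :=
  ell2 u /\ lp_sum (2 * sigma + 2) u = 1%E.

Definition min_energy : R := inf [set energy u | u in admissible].

Definition is_minimizer (u : lattice d -> R[i]) : Prop :=
  admissible u /\ forall v, admissible v -> energy u <= energy v.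

Definition minimizing_sequence (u : nat -> lattice d -> R[i]) : Prop :=
  (forall k, ell2 (u k) /\ lp_norm (2 * sigma + 2) (u k) = 1%E) /\
  energy (u k) @[k --> \oo] --> min_energy.

Definition euler_lagrange (u : lattice d -> R) : Prop :=
  forall n, - disc_laplacian u n + omega * u n
            - min_energy * u n `^ (2 * sigma + 1) = 0.

Definition Lplus (u : lattice d -> R) (f : lattice d -> R[i])
    (n : lattice d) : R[i] :=
  - disc_laplacian f n + omega%:C * f n
  - ((2 * sigma + 1) * min_energy * u n `^ (2 * sigma))%:C * f n.

End minimization.

Section bell_shape.
Variables (R : realType) (d : nat).

(* The sequence [w_l] obtained by letting the coordinate of index [j0] of [k]
   run over the integers; the entry [k 0 j0] itself plays no role. *)
Definition line (u : lattice d -> R) (j0 : 'I_d) (k : lattice d) (l : int) : R :=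
  u (\row_i (if i == j0 then l else k 0 i)).

Definition bell_shaped (w : int -> R) : Prop :=
  exists (l0 : int) (i0 : nat),
    [/\ forall i : nat, (i <= i0)%N -> w (l0 + i%:Z) = w l0,
        w (l0 + i0.+1%:Z) < w (l0 + i0%:Z),
        forall i : nat, (i0 < i)%N -> w (l0 + i.+1%:Z) <= w (l0 + i%:Z),
        w (l0 - 1) < w l0
      & forall i : nat, (0 < i)%N -> w (l0 - i.+1%:Z) <= w (l0 - i%:Z)].

End bell_shape.

Section morse_index.
Variables (R : realType) (d : nat).
Variable L : (lattice d -> R[i]) -> lattice d -> R[i].

Definition eigenvectors (lambda : R) : set (lattice d -> R[i]) :=
  [set f | ell2 f /\ forall n, L f n = lambda%:C * f n].

Definition linearly_independent (m : nat) (f : 'I_m -> lattice d -> R[i]) : Prop :=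
  forall c : 'I_m -> R[i],
    (forall n, \sum_(i < m) c i * f i n = 0) -> forall i, c i = 0.

(* Dimension of the eigenspace, possibly infinite, and 0 if [lambda] is not an
   eigenvalue. *)
Definition multiplicity (lambda : R) : \bar R :=
  ereal_sup [set (m%:R)%:E | m in [set m : nat |
    exists f : 'I_m -> lattice d -> R[i],
      linearly_independent f /\ forall i, eigenvectors lambda (f i)]].

Definition morse_index : \bar R :=
  \esum_(lambda in [set lambda : R | lambda < 0]) multiplicity lambda.

End morse_index.

Definition translate (d : nat) (T : Type) (y : lattice d) (u : lattice d -> T)
    (n : lattice d) : T := u (n + y).

(* Main.v *)
Require Import Defs.
From HB Require Import structures.
From mathcomp Require Import all_boot all_order all_algebra finmap.
From mathcomp Require Import all_classical all_reals all_analysis.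
From mathcomp Require Import complex.
From mathcomp Require Import ring lra zify.

Set Implicit Arguments.
Unset Strict Implicit.
Unset Printing Implicit Defensive.
Import Order.TTheory GRing.Theory Num.Theory numFieldNormedType.Exports.
Local Open Scope classical_set_scope.
Local Open Scope ring_scope.
Local Open Scope complex_scope.

(** Write [p = 2 sigma + 2] and [j] for the minimal energy.  On square-summable
    functions the energy is the quadratic form of [-Delta + omega], applied to
    the real and to the imaginary part.  The energy is quadratic and the
    constraint homogeneous, so minimality amounts to the inequality
    [j (sum |u|^p)^(2/p) <= J u] for every square-summable [u]
    ([min_energy_homogeneous]); and [j >= omega], because the entries of an
    admissible [u] are at most 1, hence [sum |u|^2 >= sum |u|^p = 1].

    Compactness ([minimizing_limit], [minimizing_converges]).  Since [p > 2] and
    the l^2 norms are bounded, [sum |u_k|^p = 1] forces some entry of [u_k] to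
    be bounded below; translating that entry to the origin, the pointwise limit
    [v] is not zero.  All limits are taken along an ultrafilter, which replaces
    the extraction of diagonal subsequences.  With [w_k = u_k - v] the energy
    splits as [J u_k = J v + J w_k + o(1)], because [w_k] tends weakly to 0, and
    [sum |u_k|^p <= sum |v|^p + sum |w_k|^p + o(1)], which is the half of the
    Brezis-Lieb lemma that is needed.  Let [a = sum |v|^p], so that [0 < a].
    From [J v <= j] one gets [a <= 1], and then
    [j >= j a^(2/p) + j (1 - a)^(2/p)]; as [2/p < 1], this forces [a = 1], so no
    energy is left for [w_k] and the convergence is strong.

    Bell shape ([bell_shaped_ground_state_exists]).  The modulus of a minimizer
    is a minimizer.  Order the integers as 0, 1, -1, 2, -2, ... and, among the
    nonnegative minimizers, take one that maximizes [sum weight u^2], where the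
    weight decreases strictly along this order in each coordinate and tends to 0
    at infinity; the maximum is attained by the same compactness argument.
    Polarization with respect to a reflection [l -> -l] or [l -> 1 - l] of one
    coordinate, i.e. putting the larger of the two values at mirror points on the
    side that comes first in the order, keeps the constraint, does not increase
    the energy, and strictly increases the weighted sum unless it changes
    nothing.  So along each coordinate line
    [w 0 >= w 1 >= w (-1) >= w 2 >= w (-2) >= ...], which is unimodality.

    Variations.  Inserting [u + t h] in the homogeneous inequality and bounding
    [|u + t h|^p] below by its tangent gives the Euler-Lagrange equation, hence
    [u > 0] by connectedness of the lattice.  Keeping the second-order term on a
    finite set gives [<L_+ h, h> >= 0] whenever [sum u^(p-1) h = 0]
    ([second_variation]).  On the other hand [<L_+ u, u> = - 2 sigma j < 0], and
    the potential vanishes at infinity, so the Rayleigh quotient of [L_+] attains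
    a negative minimum ([lowest_eigenfunction]).  A second, independent
    eigenfunction with negative eigenvalue could be combined with the first into
    a function with [sum u^(p-1) h = 0] and [<L_+ h, h> < 0]; hence there is none
    ([negative_eigenfunction_unique]) and the Morse index is 1. *)

(** * Absolutely summable families *)

Section Tsum.
Context {R : realType} {T : choiceType}.
Implicit Types (f g h : T -> R) (X : {fset T}) (M e : R).

Definition absum f : Prop := (\esum_(n in [set: T]) `|f n|%:E < +oo)%E.

(** The lock keeps unification from unfolding a sum into its positive and
    negative parts. *)
Definition tsum f : R := locked
  (fine (\esum_(n in [set: T]) (Num.max (f n) 0)%:E)
   - fine (\esum_(n in [set: T]) (Num.max (- f n) 0)%:E)).

Lemma absumP f : absum f -> (\esum_(n in [set: T]) `|f n|%:E \is a fin_num)%E.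
Proof.
by move=> af; rewrite ge0_fin_numE // esum_ge0 // => n _; rewrite lee_fin.
Qed.

Lemma absum_le f g : absum g -> (forall n, `|f n| <= g n) -> absum f.
Proof.
move=> ag fg; apply: le_lt_trans ag; apply: le_esum => n _.
by rewrite lee_fin (le_trans (fg n)) // ler_norm.
Qed.

Lemma absum0 : absum (fun=> 0).
Proof. by rewrite /absum esum1 // => n _; rewrite normr0. Qed.

Lemma absumN f : absum f -> absum (fun n => - f n).
Proof.
by rewrite /absum => af; under eq_esum do rewrite normrN.
Qed.

Lemma absum_norm f : absum f -> absum (fun n => `|f n|).
Proof.
by rewrite /absum => af; under eq_esum do rewrite normr_id.
Qed.

Lemma absumD f g : absum f -> absum g -> absum (fun n => f n + g n).
Proof.
move=> af ag; apply: (@le_lt_trans _ _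
  (\esum_(n in [set: T]) (`|f n|%:E + `|g n|%:E))%E).
  by apply: le_esum => n _; rewrite -EFinD lee_fin ler_normD.
rewrite esumD; first by rewrite lte_add_pinfty.
  by move=> n _; rewrite lee_fin.
by move=> n _; rewrite lee_fin.
Qed.

Lemma absumB f g : absum f -> absum g -> absum (fun n => f n - g n).
Proof. by move=> af /absumN; exact: absumD. Qed.

Lemma tsum_nneg f : (forall n, 0 <= f n) ->
  tsum f = fine (\esum_(n in [set: T]) (f n)%:E).
Proof.
move=> f0; rewrite /tsum -lock [X in _ - fine X]esum1 ?subr0; last first.
  by move=> n _; rewrite max_r // oppr_le0.
by congr fine; apply: eq_esum => n _; rewrite max_l.
Qed.

Lemma esum_tsum f : (forall n, 0 <= f n) -> absum f ->
  (\esum_(n in [set: T]) (f n)%:E = (tsum f)%:E)%E.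
Proof.
move=> f0 /absumP af; rewrite tsum_nneg // fineK //.
by under eq_esum do rewrite -[f _](ger0_norm (f0 _)).
Qed.

Lemma tsum_ge0 f : (forall n, 0 <= f n) -> 0 <= tsum f.
Proof.
by move=> f0; rewrite tsum_nneg // fine_ge0 // esum_ge0 // => n _; rewrite lee_fin.
Qed.

Let tsumD_nneg f g : (forall n, 0 <= f n) -> (forall n, 0 <= g n) ->
  absum f -> absum g -> tsum (fun n => f n + g n) = tsum f + tsum g.
Proof.
move=> f0 g0 af ag; apply: EFin_inj.
rewrite EFinD -!esum_tsum //; last 2 first.
  by move=> n; rewrite addr_ge0.
  exact: absumD.
by rewrite -esumD // => n _; rewrite lee_fin.
Qed.

Let tsum_diff f g h : (forall n, 0 <= g n) -> (forall n, 0 <= h n) ->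
  absum g -> absum h -> (forall n, f n = g n - h n) ->
  tsum f = tsum g - tsum h.
Proof.
move=> g0 h0 ag ah fgh.
have af : absum (fun n => g n + h n) by exact: absumD.
have ap : absum (fun n => Num.max (f n) 0).
  apply: (absum_le af) => n; rewrite ger0_norm ?le_max ?lexx ?orbT //.
  by rewrite ge_max fgh lerD ?addr_ge0 //= -subr_ge0 opprK addr_ge0.
have an : absum (fun n => Num.max (- f n) 0).
  apply: (absum_le af) => n; rewrite ger0_norm ?le_max ?lexx ?orbT //.
  by rewrite ge_max fgh opprB addrC lerD ?addr_ge0 //= -subr_ge0 opprK addr_ge0.
have p0 n : 0 <= Num.max (f n) 0 by rewrite le_max lexx orbT.
have n0 n : 0 <= Num.max (- f n) 0 by rewrite le_max lexx orbT.
rewrite {1}/tsum -lock -tsum_nneg // -tsum_nneg //.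
have := tsumD_nneg p0 h0 ap ah; rewrite (_ : (fun n => _ + _) =
    fun n => g n + Num.max (- f n) 0).
  rewrite tsumD_nneg // => /eqP; rewrite addrC => /eqP E.
  by apply/eqP; rewrite subr_eq addrAC -subr_eq opprK addrC; apply/eqP; rewrite -E addrC.
apply/funext => n; have := fgh n; rewrite !maxEle.
by case: ifP => //; case: ifP => //; lra.
Qed.

Let posP f : absum f ->
  [/\ forall n, 0 <= Num.max (f n) 0, forall n, 0 <= Num.max (- f n) 0,
   absum (fun n => Num.max (f n) 0), absum (fun n => Num.max (- f n) 0)
   & forall n, f n = Num.max (f n) 0 - Num.max (- f n) 0].
Proof.
move=> af; have p g : absum g -> absum (fun n => Num.max (g n) 0).
  move/absum_norm => ag; apply: (absum_le ag) => n; rewrite maxEle.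
  by case: ifP; rewrite ?normr0.
split; [by move=> n; rewrite le_max lexx orbT|by move=> n; rewrite le_max lexx orbT
  |exact: p| by apply: p; exact: absumN|].
by move=> n; rewrite !maxEle; case: ifP; case: ifP; lra.
Qed.

Lemma tsumD f g : absum f -> absum g ->
  tsum (fun n => f n + g n) = tsum f + tsum g.
Proof.
move=> af ag; have [f1 f2 f3 f4 f5] := posP af; have [g1 g2 g3 g4 g5] := posP ag.
rewrite (tsum_diff f1 f2 f3 f4 f5) (tsum_diff g1 g2 g3 g4 g5).
rewrite (@tsum_diff _ (fun n => Num.max (f n) 0 + Num.max (g n) 0)
  (fun n => Num.max (- f n) 0 + Num.max (- g n) 0)).
- by rewrite !tsumD_nneg // opprD addrACA.
- by move=> n; rewrite addr_ge0.
- by move=> n; rewrite addr_ge0.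
- exact: absumD.
- exact: absumD.
- by move=> n; rewrite {1}f5 {1}g5 opprD addrACA.
Qed.

Lemma tsumN f : tsum (fun n => - f n) = - tsum f.
Proof. by rewrite /tsum -!lock opprB; under [in X in _ - X]eq_esum do rewrite opprK. Qed.

Lemma tsumB f g : absum f -> absum g ->
  tsum (fun n => f n - g n) = tsum f - tsum g.
Proof. by move=> af ag; rewrite tsumD ?tsumN //; exact: absumN. Qed.

Lemma tsum_le f g : absum f -> absum g -> (forall n, f n <= g n) ->
  tsum f <= tsum g.
Proof.
move=> af ag fg; rewrite -subr_ge0 -tsumB // tsum_ge0 // => n.
by rewrite subr_ge0.
Qed.

Lemma tsum0 : tsum (fun=> 0) = 0.
Proof. by rewrite tsum_nneg // esum1. Qed.

Lemma tsum_ge_fset f X : (forall n, 0 <= f n) -> absum f ->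
  \sum_(x <- X) f x <= tsum f.
Proof.
move=> f0 af; rewrite -lee_fin -esum_tsum // esum_ge //.
exists [set` X]; first by split => //; exact: finite_fset.
by rewrite fsbig_finite ?finite_fset //= set_fsetK sumEFin.
Qed.

(** The way in which absolute summability is obtained throughout: a bound on
    finite partial sums passes to the whole sum. *)
Lemma absum_bound f M : (forall n, 0 <= f n) ->
  (forall X, \sum_(x <- X) f x <= M) -> absum f /\ tsum f <= M.
Proof.
move=> f0 fM.
have le : (\esum_(n in [set: T]) (f n)%:E <= M%:E)%E.
  apply: ge_ereal_sup => _ [X [fX _]] <-.
  by rewrite fsbig_finite //= sumEFin lee_fin.
have af : absum f.
  rewrite /absum; under eq_esum do rewrite ger0_norm //.
  by apply: le_lt_trans le _; rewrite ltry.
by split => //; rewrite -lee_fin -esum_tsum.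
Qed.

Lemma tsum_approx f e : (forall n, 0 <= f n) -> absum f -> 0 < e ->
  exists X, tsum f - e < \sum_(x <- X) f x.
Proof.
move=> f0 af e0; apply: contrapT => /forallNP nX.
have [X|_] := @absum_bound f (tsum f - e) f0; last lra.
by rewrite leNgt; apply/negP/nX.
Qed.

Lemma absumZ c f : absum f -> absum (fun n => c * f n).
Proof.
move=> /absum_norm af; have [] := @absum_bound (fun n => `|c * f n|) (`|c| * tsum (fun n => `|f n|)).
- by move=> n.
- move=> X; under eq_bigr do rewrite normrM.
  by rewrite -mulr_sumr ler_wpM2l // tsum_ge_fset.
- by move=> a _; exact: (absum_le a).
Qed.

Lemma tsum_ge1 f n : (forall n, 0 <= f n) -> absum f -> f n <= tsum f.
Proof.
move=> f0 af; apply: le_trans (tsum_ge_fset [fset n]%fset f0 af).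
by rewrite big_seq_fset1.
Qed.

Lemma tsum_eq0 f : (forall n, 0 <= f n) -> absum f -> tsum f <= 0 ->
  forall n, f n = 0.
Proof.
move=> f0 af f1 n; apply/eqP; rewrite eq_le f0 andbT.
exact: le_trans (tsum_ge1 n f0 af) f1.
Qed.

Let tsumZ_nneg c f : 0 <= c -> (forall n, 0 <= f n) -> absum f ->
  tsum (fun n => c * f n) = c * tsum f.
Proof.
move=> c0 f0 af; have cf0 n : 0 <= c * f n by rewrite mulr_ge0.
apply/eqP; rewrite eq_le; apply/andP; split.
  have [X|//] := @absum_bound (fun n => c * f n) (c * tsum f) cf0.
  by rewrite -mulr_sumr ler_wpM2l // tsum_ge_fset.
have [->|cn0] := eqVneq c 0; first by rewrite mul0r tsum_ge0 // => n; rewrite mul0r.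
have cp : 0 < c by rewrite lt_def cn0.
rewrite mulrC -ler_pdivlMr //.
have [X|//] := @absum_bound f (tsum (fun n => c * f n) / c) f0.
by rewrite ler_pdivlMr // mulrC mulr_sumr; apply: tsum_ge_fset => //; exact: absumZ.
Qed.

Lemma tsumZ c f : absum f -> tsum (fun n => c * f n) = c * tsum f.
Proof.
wlog c0 : c / 0 <= c => [H|af].
  have [/H//|/ltW c0 af] := leP 0 c.
  have : 0 <= - c by rewrite oppr_ge0.
  move=> /H -/(_ af); rewrite mulNr; under [in X in X = _ -> _]eq_fun do rewrite mulNr.
  by rewrite tsumN => /oppr_inj.
have [f1 f2 f3 f4 f5] := posP af.
rewrite [in RHS](tsum_diff f1 f2 f3 f4 f5) mulrBr -!tsumZ_nneg //.
apply: tsum_diff; do ?[exact: absumZ | by move=> n; rewrite mulr_ge0].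
by move=> n; rewrite -mulrBr -f5.
Qed.

Lemma absum_sum (I : finType) (f : I -> T -> R) :
  (forall i, absum (f i)) -> absum (fun n => \sum_i f i n).
Proof.
move=> af; elim: (index_enum I) => [|i s ih].
  by under eq_fun do rewrite big_nil; exact: absum0.
by under eq_fun do rewrite big_cons; exact: absumD.
Qed.

Lemma tsum_sum (I : finType) (f : I -> T -> R) :
  (forall i, absum (f i)) -> tsum (fun n => \sum_i f i n) = \sum_i tsum (f i).
Proof.
move=> af.
suff H s : absum (fun n => \sum_(i <- s) f i n) /\
   tsum (fun n => \sum_(i <- s) f i n) = \sum_(i <- s) tsum (f i) by have [] := H (index_enum I).
elim: s => [|i s [ih1 ih2]].
  split; first by under eq_fun do rewrite big_nil; exact: absum0.
  by under eq_fun do rewrite big_nil; rewrite tsum0 big_nil.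
split; first by under eq_fun do rewrite big_cons; exact: absumD.
by under eq_fun do rewrite big_cons; rewrite tsumD // big_cons ih2.
Qed.

Lemma tsum_single f x : (forall n, n != x -> f n = 0) ->
  absum f /\ tsum f = f x.
Proof.
move=> fx.
have H g : (forall n, n != x -> g n = 0) -> (forall n, 0 <= g n) ->
    absum g /\ tsum g = g x.
  move=> gx g0; suff E : (\esum_(n in [set: T]) (g n)%:E = (g x)%:E)%E.
    have ag : absum g.
      rewrite /absum; under eq_esum do rewrite ger0_norm //.
      by rewrite E ltry.
    by split => //; apply: EFin_inj; rewrite -esum_tsum.
  rewrite -(@esum_set1 _ _ x (fun n => (g n)%:E)) ?lee_fin // [RHS]esum_mkcond.
  apply: eq_esum => n _; case: ifPn => // /negP nx; rewrite gx //.
  by apply/eqP => nx'; apply: nx; rewrite inE.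
have [|//|a _] := H (fun n => `|f n|).
  by move=> n /fx ->; rewrite normr0.
have af : absum f by apply: absum_le a _.
split => //; have [f1 f2 f3 f4 f5] := posP af.
rewrite (tsum_diff f1 f2 f3 f4 f5) [RHS]f5.
have [||_ ->] := H (fun n => Num.max (f n) 0) => //.
  by move=> n /fx ->; rewrite maxxx.
have [||_ ->] := H (fun n => Num.max (- f n) 0) => //.
by move=> n /fx ->; rewrite oppr0 maxxx.
Qed.

Lemma tsum_fset_support f X : (forall n, n \notin X -> f n = 0) ->
  absum f /\ tsum f = \sum_(x <- X) f x.
Proof.
move=> fX.
have E : f = fun n => \sum_(x : X) (if n == val x then f n else 0).
  apply/funext => n; case: (boolP (n \in X)) => nX.
    rewrite (bigD1 [` nX]%fset) //= eqxx big1 ?addr0 // => x xn.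
    by rewrite ifF //; apply: contraNF xn => /eqP nx; apply/eqP/val_inj.
  by rewrite fX // big1 // => x _; rewrite if_same.
have H (x : X) : absum (fun n => if n == val x then f n else 0) /\
   tsum (fun n => if n == val x then f n else 0) = f (val x).
  have := @tsum_single (fun n => if n == val x then f n else 0) (val x).
  by rewrite eqxx; apply => n /negbTE ->.
split; first by rewrite E; apply: absum_sum => x; case: (H x).
rewrite [in LHS]E tsum_sum; last by move=> x; case: (H x).
by rewrite big_seq_fsetE /=; apply: eq_bigr => x _; case: (H x).
Qed.

(** Used for translations and for reflections of the lattice. *)
Lemma tsum_reindex f (t t' : T -> T) : cancel t t' -> cancel t' t ->
  tsum (f \o t) = tsum f.
Proof.
move=> tK tK'; have b : set_bij [set: T] [set: T] t.
  split => //; first by move=> x y _ _; exact: can_inj.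
  by move=> y _; exists (t' y).
by rewrite /tsum -!lock; congr (fine _ - fine _);
  rewrite [RHS](reindex_esum setT setT t).
Qed.

Lemma absum_reindex f (t t' : T -> T) : cancel t t' -> cancel t' t ->
  absum f -> absum (f \o t).
Proof.
move=> tK tK'; have b : set_bij [set: T] [set: T] t.
  split => //; first by move=> x y _ _; exact: can_inj.
  by move=> y _; exists (t' y).
by rewrite /absum (reindex_esum setT setT t).
Qed.

Lemma norm_tsum_le f g : absum g -> (forall n, `|f n| <= g n) ->
  `|tsum f| <= tsum g.
Proof.
move=> ag fg; have af := absum_le ag fg.
rewrite ler_norml -tsumN !tsum_le //; first by move=> n; move: (fg n); rewrite ler_norml => /andP[].
  exact: absumN.
by move=> n; move: (fg n); rewrite ler_norml => /andP[].
Qed.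

Lemma tsum_tail f e : (forall n, 0 <= f n) -> absum f -> 0 < e ->
  exists X, absum (fun n => if n \in X then 0 else f n) /\
            tsum (fun n => if n \in X then 0 else f n) < e.
Proof.
move=> f0 af e0; have [X hX] := tsum_approx f0 af e0; exists X.
have [a1 a2] := @tsum_fset_support (fun n => if n \in X then f n else 0) X
  (fun n nX => ifN _ _ nX).
have a3 : absum (fun n => if n \in X then 0 else f n).
  by apply: (absum_le af) => n; case: ifP => _; rewrite ?normr0 // ger0_norm.
split=> //.
have -> : tsum (fun n => if n \in X then 0 else f n) = tsum f - \sum_(x <- X) f x.
  have -> : \sum_(x <- X) f x = \sum_(x <- X) if x \in X then f x else 0.
    by rewrite big_seq [RHS]big_seq; apply: eq_bigr => x ->.
  rewrite -a2 -tsumB //; congr tsum; apply/funext => n.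
  by case: ifP => _; rewrite ?subrr ?subr0.
lra.
Qed.

End Tsum.

(** * Limits of sums along a filter *)

Section Limits.
Context {R : realType} {I : Type}.

(** In a compact interval an ultrafilter converges to any of its cluster
    points, since it contains each set or its complement. *)
Lemma bounded_ultralimit (U : set_system I) (x : I -> R) (M : R) :
  UltraFilter U -> (forall i, `|x i| <= M) -> exists l : R, x i @[i --> U] --> l.
Proof.
move=> UU xM; have xU : fmap x U [set` `[- M, M]].
  by apply: nearW => i /=; rewrite in_itv /= -ler_norml.
have [l [_ cl]] := @segment_compact R (- M) M _ _ xU; exists l => A lA.
have [//|nA] := in_ultra_setVsetC (x @^-1` A) UU.
by have [y []] := cl (~` A) A nA lA.
Qed.

Lemma cvg_sumr (F : set_system I) {FF : Filter F} (J : Type) (r : seq J)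
    (f : J -> I -> R) (l : J -> R) :
  (forall j, f j k @[k --> F] --> l j) ->
  \sum_(j <- r) f j k @[k --> F] --> \sum_(j <- r) l j.
Proof.
move=> fl; elim: r => [|j r ih].
  by rewrite big_nil; under eq_fun do rewrite big_nil; exact: cvg_cst.
by rewrite big_cons; under eq_fun do rewrite big_cons; exact: cvgD.
Qed.

Context {T : choiceType}.

(** Fatou's lemma: each finite partial sum of the limit is a limit of partial
    sums bounded by [M]. *)
Lemma fatou_tsum (F : set_system I) (f : I -> T -> R) (l : T -> R) (M : R) :
  ProperFilter F -> (forall k n, 0 <= f k n) -> (forall k, absum (f k)) ->
  (forall k, tsum (f k) <= M) -> (forall n, f k n @[k --> F] --> l n) ->
  absum l /\ tsum l <= M.
Proof.
move=> FF f0 af fM fl; apply: absum_bound => [n|X].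
  by apply: (cvgr_to_ge (fl n)); exact: nearW.
have cX : \sum_(x <- X) f k x @[k --> F] --> \sum_(x <- X) l x.
  by apply: cvg_sumr.
apply: (cvgr_to_le cX).
by apply: nearW => k; apply: le_trans (fM k); exact: tsum_ge_fset.
Qed.

(** A dominated convergence theorem in which the dominating family may depend
    on the parameter, as long as the dependent part [B k] has a bounded sum and
    enters with an arbitrarily small factor; the fixed part [C] has small tails.
    It serves for weak convergence (Young's inequality), for the Brezis-Lieb
    splitting and for weights that vanish at infinity. *)
Lemma tsum_cvg (F : set_system I) (h B : I -> T -> R) (l : T -> R) (M : R) :
  ProperFilter F ->
  (forall n, h k n @[k --> F] --> l n) ->
  (forall k, absum (h k)) -> absum l ->
  (forall k n, 0 <= B k n) -> (forall k, absum (B k)) ->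
  (forall k, tsum (B k) <= M) ->
  (forall e, 0 < e -> exists C : T -> R,
     absum C /\ forall k n, `|h k n - l n| <= e * B k n + C n) ->
  tsum (h k) @[k --> F] --> tsum l.
Proof.
move=> FF hl ah al B0 aB BM dom; apply/cvgrPdist_le => /= e e0.
have M0 : 0 <= M.
  have [k _] := filter_ex (@filterT _ F _).
  exact: le_trans (tsum_ge0 (B0 k)) (BM k).
(* The [B]-part then contributes at most [e / 4], the tail of [C] another [e / 4]. *)
pose e1 := e / 4 / (M + 1); have e1_gt0 : 0 < e1 by rewrite !divr_gt0 // ltr_wpDl.
have [C [aC hC]] := dom _ e1_gt0.
have [X [aX hX]] := tsum_tail (fun n => normr_ge0 (C n)) (absum_norm aC)
  (divr_gt0 e0 (ltr0n _ 4 : 0 < 4 :> R)).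
have cX : \sum_(x <- X) `|h k x - l x| @[k --> F] --> \sum_(x <- X) (0 : R).
  apply: cvg_sumr => x; rewrite -[X in _ --> X](normr0 R); apply: cvg_norm.
  by rewrite -[X in _ --> X](subrr (l x)); apply: cvgB => //; exact: cvg_cst.
move/cvgrPdist_le : cX => /(_ (e / 2)) /= /(_ ltac:(by rewrite divr_gt0)).
apply: filterS => k; rewrite big1 // sub0r normrN ger0_norm; last first.
  by apply: sumr_ge0 => x _.
move=> kX; rewrite distrC -tsumB //.
have ahl : absum (fun n => `|h k n - l n|) by apply/absum_norm/absumB.
apply: le_trans (norm_tsum_le ahl (fun n => lexx _)) _.
have [a1 t1] := @tsum_fset_support R T (fun n => if n \in X then `|h k n - l n| else 0) X
  (fun n nX => ifN _ _ nX).
have aeB : absum (fun n => e1 * B k n) by exact: absumZ.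
have s1 : tsum (fun n => if n \in X then `|h k n - l n| else 0) <= e / 2.
  by rewrite t1 (le_trans _ kX) // big_seq [leRHS]big_seq; apply: ler_sum => x ->.
have s2 : tsum (fun n => e1 * B k n) <= e / 4.
  rewrite tsumZ // (@le_trans _ _ (e1 * (M + 1))) //.
    by rewrite ler_wpM2l ?(ltW e1_gt0) // (le_trans (BM k)) // lerDl.
  by rewrite /e1 divfK // gt_eqF // ltr_wpDl.
have le : tsum (fun n => `|h k n - l n|) <=
    tsum (fun n => (if n \in X then `|h k n - l n| else 0) +
      (e1 * B k n + (if n \in X then 0 else `|C n|))).
  apply: (tsum_le ahl (absumD a1 (absumD aeB aX))) => n; case: ifP => nX.
    by rewrite addr0 lerDl mulr_ge0 // ltW.
  by rewrite add0r (le_trans (hC k n)) // lerD2l ler_norm.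
move: le; rewrite (tsumD a1 (absumD aeB aX)) (tsumD aeB aX); lra.
Qed.

End Limits.

(** * Inequalities for real powers *)

Section PowerInequalities.
Context {R : realType}.
Implicit Types (a b p q x y t e : R).

(** Young's inequality applied to [y `^ a * 1]. *)
Lemma powR_le_tangent a y : 0 < a <= 1 -> 0 <= y -> y `^ a <= 1 + a * (y - 1).
Proof.
move=> /andP[a0]; rewrite le_eqVlt => /predU1P[-> y0|a1 y0].
  by rewrite powRr1 // mul1r addrC subrK.
have b0 : 0 < 1 - a by rewrite subr_gt0.
have := @conjugate_powR R (y `^ a) 1 a^-1 (1 - a)^-1 (powR_ge0 _ _) ler01.
rewrite !invrK !invr_gt0 => /(_ a0 b0); rewrite addrC subrK => /(_ erefl).
by rewrite mulr1 -powRrM mulfV ?gt_eqF // powRr1 // powR1; lra.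
Qed.

(** Convexity is deduced from the concave case applied to [y `^ p] with the
    exponent [1 / p]. *)
Lemma powR_ge_tangent p y : 1 <= p -> 0 <= y -> 1 + p * (y - 1) <= y `^ p.
Proof.
move=> p1 y0; have p0 : 0 < p by lra.
have pi : 0 < p^-1 <= 1 by rewrite invr_gt0 p0 invf_le1.
have := powR_le_tangent pi (powR_ge0 y p).
rewrite -powRrM mulfV ?gt_eqF // powRr1 // => h.
have := ler_wpM2l (ltW p0) h; rewrite mulrDr mulr1 mulrA mulfV ?gt_eqF //; lra.
Qed.

Lemma powR_convex_tangent p a x : 1 < p -> 0 <= a ->
  a `^ p + p * a `^ (p - 1) * (x - a) <= `|x| `^ p.
Proof.
move=> p1; have p0 : 0 < p by lra.
rewrite le_eqVlt => /predU1P[<-|a0].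
  by rewrite !powR0 ?gt_eqF ?subr_gt0 // mulr0 mul0r addr0 powR_ge0.
have h := powR_ge_tangent (ltW p1) (divr_ge0 (normr_ge0 x) (ltW a0)).
have := ler_wpM2l (powR_ge0 a p) h.
rewrite -powRM ?(ltW a0) //; last by rewrite divr_ge0 // ltW.
rewrite mulrCA mulfV ?gt_eqF // mulr1; apply: le_trans.
have E : a `^ p = a * a `^ (p - 1) by rewrite mulr_powRB1 // ltW.
have -> : a `^ p * (1 + p * (`|x| / a - 1)) =
   a `^ p + p * a `^ (p - 1) * (`|x| - a).
  by rewrite E; field; rewrite gt_eqF.
by rewrite lerD2l ler_wpM2l ?mulr_ge0 ?powR_ge0 ?(ltW p0) // lerD2r ler_norm.
Qed.

(** From the tangent bound on [(1 + x) `^ (1 - t)], whose product with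
    [(1 + x) `^ t] is [1 + x].  With [t = 2 / p] it expands the right-hand
    power in [min_energy_homogeneous] with an explicit remainder. *)
Lemma powR_ge_quadratic t x : 0 < t <= 1 -> `|x| <= 2^-1 ->
  1 + t * x - x ^+ 2 <= (1 + x) `^ t.
Proof.
move=> /andP[t0 t1]; rewrite ler_norml => /andP[x1 x2].
have x0 : 0 < 1 + x by lra.
have D0 : 0 < 1 + (1 - t) * x by nra.
have E : (1 + x) `^ t * (1 + x) `^ (1 - t) = 1 + x.
  by rewrite -powRD ?subrKC ?powRr1 ?(ltW x0) // gt_eqF // implybT.
have h : (1 + x) `^ (1 - t) <= 1 + (1 - t) * x.
  have [->|t_neq1] := eqVneq t 1; first by rewrite subrr powRr0 mul0r addr0.
  have := @powR_le_tangent (1 - t) (1 + x); rewrite [1 + x - 1]addrAC subrr add0r.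
  by apply; [rewrite subr_gt0 lt_neqAle t_neq1 t1 /=; lra|exact: ltW].
have h2 := ler_wpM2l (powR_ge0 (1 + x) t) h.
rewrite E -ler_pdivrMr // in h2; apply: le_trans h2.
rewrite ler_pdivlMr //.
have : 0 <= x ^+ 2 * ((1 - t) * (1 - t) + (1 - t) * x + t).
  rewrite mulr_ge0 ?sqr_ge0 //; nra.
nra.
Qed.

(** Either [y] is a small multiple of [x], and the whole sum is close to [x],
    or [x] is at most a multiple of [y]. *)
Lemma powR_split p e : 0 < p -> 0 < e -> exists2 C : R, 0 <= C &
  forall x y, 0 <= x -> 0 <= y ->
    (x + y) `^ p <= (1 + e) * x `^ p + C * y `^ p.
Proof.
(* The ratio [d] for which [(1 + d) `^ p = 1 + e]. *)
move=> p0 e0; pose d := (1 + e) `^ p^-1 - 1.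
have d0 : 0 < d.
  have := @gt0_ltr_powR R p^-1; rewrite invr_gt0 => /(_ p0 1 (1 + e)).
  by rewrite powR1 /d subr_gt0; apply; rewrite ?nnegrE; lra.
have dE : (1 + d) `^ p = 1 + e.
  by rewrite /d subrKC -powRrM mulVf ?gt_eqF // powRr1 //; lra.
exists ((d^-1 + 1) `^ p); first exact: powR_ge0.
move=> x y x0 y0; have [yx|xy] := leP y (d * x).
  apply: (@le_trans _ _ ((1 + d) `^ p * x `^ p)); last first.
    by rewrite dE lerDl mulr_ge0 ?powR_ge0.
  rewrite -powRM //; last by lra.
  by apply: ge0_ler_powR; rewrite ?nnegrE ?(ltW p0) //; nra.
apply: (@le_trans _ _ ((d^-1 + 1) `^ p * y `^ p)); last first.
  by rewrite lerDr mulr_ge0 ?powR_ge0 //; lra.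
have d1 : 0 < d^-1 by rewrite invr_gt0.
rewrite -powRM //; last by lra.
apply: ge0_ler_powR; rewrite ?nnegrE ?(ltW p0) ?addr_ge0 ?mulr_ge0 //; first lra.
by rewrite mulrDl mul1r lerD2r mulrC ler_pdivlMr // mulrC ltW.
Qed.

(** The defect [x `^ p - (1 + p (x - 1) + c (x - 1)^2)] vanishes at 1, and by
    the tangent bounds its derivative has the sign of [x - 1] near 1; the mean
    value theorem concludes. *)
Lemma powR_taylor2_at1 p e : 2 <= p -> 0 < e -> exists2 d : R, 0 < d &
  forall z, `|z - 1| <= d ->
    1 + p * (z - 1) + (p * (p - 1) / 2 - e) * (z - 1) ^+ 2 <= z `^ p.
Proof.
move=> p2 e0; set c := p * (p - 1) / 2 - e.
have K0 : 0 < p * (p - 1) * (p - 2) + 1 by rewrite ltr_pwDr // !mulr_ge0; lra.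
(* Left of 1 the sign of the derivative needs [p (p - 1) (p - 2) d <= e]. *)
pose d := Num.min 2^-1 (e / (p * (p - 1) * (p - 2) + 1)).
have d0 : 0 < d by rewrite lt_min invr_gt0 ltr0n /= divr_gt0.
have d12 : d <= 2^-1 by rewrite ge_min lexx.
have dK : p * (p - 1) * (p - 2) * d <= e.
  apply: (@le_trans _ _ ((p * (p - 1) * (p - 2) + 1) * (e / (p * (p - 1) * (p - 2) + 1)))).
    apply: (@le_trans _ _ ((p * (p - 1) * (p - 2) + 1) * d)).
      by rewrite ler_wpM2r ?lerDl // ltW.
    by rewrite ler_wpM2l ?(ltW K0) // ge_min lexx orbT.
  by rewrite mulrC divfK // gt_eqF.
exists d => // z; rewrite ler_norml => /andP[z1 z2].
pose f x := x `^ p - (1 + p * (x - 1) + c * (x - 1) ^+ 2).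
pose df x := p * x `^ (p - 1) - (p + 2 * c * (x - 1)).
have fd x : 0 < x -> is_derive x 1 f (df x).
  move=> x0; pose u : R -> R := id - cst 1.
  have hu : is_derive x 1 u (1 - 0).
    exact: is_deriveB (is_derive_id _ _) (is_derive_cst _ _ _).
  have h1 : is_derive x 1 (p *: u : R -> R) (p *: (1 - 0)) by exact: is_deriveZ.
  have hX : is_derive x 1 (u ^+ 2 : R -> R) ((2%:R * u x ^+ 1) *: (1 - 0)).
    exact: is_deriveX.
  have h2 : is_derive x 1 (c *: (u ^+ 2) : R -> R)
      (c *: ((2%:R * u x ^+ 1) *: (1 - 0))) by exact: is_deriveZ.
  have hc : is_derive x (1 : R) (cst 1 : R -> R) 0 by exact: is_derive_cst.
  have h3 : is_derive x 1 (cst 1 + p *: u : R -> R) (0 + p *: (1 - 0)).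
    exact: is_deriveD hc h1.
  have hq : is_derive x 1 (cst 1 + p *: u + c *: (u ^+ 2) : R -> R)
      (0 + p *: (1 - 0) + c *: ((2%:R * u x ^+ 1) *: (1 - 0))).
    exact: is_deriveD h3 h2.
  have hf := is_deriveB (is_derive1_powR p x0) hq.
  have -> : f = (fun x => x `^ p) - (cst 1 + p *: u + c *: (u ^+ 2)) by [].
  by apply: is_derive_eq; rewrite /df /GRing.scale /= /u !fctE; ring.
have fc a b : 0 < a -> {within `[a, b], continuous f}.
  move=> a0; apply: derivable_within_continuous => x; rewrite in_itv /= => /andP[ax _].
  by case: (fd x (lt_le_trans a0 ax)).
have f1 : f 1 = 0 by rewrite /f powR1 subrr; ring.
suff : 0 <= f z - f 1 by rewrite f1 subr0 subr_ge0.
have c_le : 2 * c = p * (p - 1) - 2 * e by rewrite /c; field.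
have [z_ge1|z_lt1] := leP 1 z.
  have [|x xz ->] := @MVT_segment R f df 1 z z_ge1 _ (fc _ _ ltr01).
    by move=> x; rewrite in_itv /= => /andP[x1 _]; apply: fd; apply: lt_trans x1.
  rewrite mulr_ge0 ?subr_ge0 //.
  move: xz; rewrite in_itv /= => /andP[x1 xz]; rewrite /df c_le.
  have := @powR_ge_tangent (p - 1) x; rewrite lerBrDr => /(_ ltac:(lra) ltac:(lra)) h.
  have := ler_wpM2l (_ : 0 <= p) h => /(_ ltac:(lra)); nra.
have z0 : 0 < z by lra.
have [|x xz E] := @MVT_segment R f df z 1 (ltW z_lt1) _ (fc _ _ z0).
  by move=> x; rewrite in_itv /= => /andP[x1 _]; apply: fd; apply: lt_trans x1.
rewrite -opprB E oppr_ge0 mulr_le0_ge0 ?subr_ge0 ?(ltW z_lt1) //.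
move: xz; rewrite in_itv /= => /andP[zx x1]; rewrite /df c_le.
have x0 : 0 < x by lra.
have h : x `^ (p - 1) * (x + (p - 1) * (1 - x)) <= x.
  have := @powR_ge_tangent (p - 1) x^-1; rewrite invr_ge0.
  move=> /(_ ltac:(lra) (ltW x0)) /(ler_wpM2l (powR_ge0 x (p - 1))).
  rewrite -powRM ?invr_ge0 ?(ltW x0) // mulfV ?gt_eqF // powR1.
  move=> /(ler_wpM2r (ltW x0)); rewrite mul1r; apply: le_trans.
  by rewrite le_eqVlt; apply/orP; left; apply/eqP; field; rewrite gt_eqF.
set s := 1 - x; have s0 : 0 <= s by rewrite /s; lra.
have D0 : 0 < x + (p - 1) * (1 - x) by nra.
have h' : x `^ (p - 1) <= x / (x + (p - 1) * (1 - x)) by rewrite ler_pdivlMr.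
rewrite subr_le0 (@le_trans _ _ (p * (x / (x + (p - 1) * (1 - x))))) //.
  by rewrite ler_wpM2l //; lra.
rewrite mulrA ler_pdivrMr //.
have xs : x = 1 - s by rewrite /s; lra.
rewrite xs.
have k1 : 0 <= s * (e - p * (p - 1) * (p - 2) * s).
  rewrite mulr_ge0 // subr_ge0 (le_trans _ dK) // ler_wpM2l //; last by rewrite /s; lra.
  by rewrite !mulr_ge0 //; lra.
have k2 : 0 <= p * (p - 1) * (p - 2) * s ^+ 2 by rewrite !mulr_ge0 ?sqr_ge0 //; lra.
have k3 : 0 <= e * (p - 2) * s ^+ 2 by rewrite !mulr_ge0 ?sqr_ge0 //; lra.
have k4 : 0 <= e * s by rewrite mulr_ge0 // ltW.
nra.
Qed.

Lemma powR_taylor2 p a e : 2 <= p -> 0 < a -> 0 < e -> exists2 d : R, 0 < d &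
  forall y, `|y| <= d ->
    a `^ p + p * a `^ (p - 1) * y + (p * (p - 1) / 2 * a `^ (p - 2) - e) * y ^+ 2
    <= `|a + y| `^ p.
Proof.
move=> p2 a0 e0; pose e1 := e / a `^ (p - 2).
have e1_gt0 : 0 < e1 by rewrite divr_gt0 // powR_gt0.
have [d d0 hd] := powR_taylor2_at1 p2 e1_gt0.
exists (Num.min (d * a) a) => [|y]; first by rewrite lt_min mulr_gt0.
rewrite le_min => /andP[y1 y2].
have ay : 0 <= a + y by move: y2; rewrite ler_norml => /andP[]; lra.
have := hd ((a + y) / a).
have -> : (a + y) / a - 1 = y / a by field; rewrite gt_eqF.
rewrite normrM (gtr0_norm (_ : 0 < a^-1)) ?invr_gt0 // ler_pdivrMr // => /(_ y1).
move=> /(ler_wpM2l (powR_ge0 a p)); have -> : a `^ p * ((a + y) / a) `^ p = (a + y) `^ p.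
  by rewrite -powRM ?divr_ge0 // ?(ltW a0) // mulrCA mulfV ?mulr1 // gt_eqF.
rewrite (ger0_norm ay); apply: le_trans.
have E1 : a `^ p = a * a `^ (p - 1) by rewrite mulr_powRB1 // ?ltW //; lra.
have E2 : a `^ (p - 1) = a * a `^ (p - 2).
  have -> : p - 2 = p - 1 - 1 by lra.
  by rewrite mulr_powRB1 // ?ltW //; lra.
rewrite le_eqVlt; apply/orP; left; apply/eqP.
rewrite /e1 E1 E2; field.
by rewrite !gt_eqF // powR_gt0.
Qed.

(** A one-parameter variation is stationary at an interior minimum. *)
Lemma linear_coef_eq0 (a b d : R) : 0 < d ->
  (forall t, `|t| <= d -> 0 <= a * t + b * t ^+ 2) -> a = 0.
Proof.
move=> d0 h; apply/eqP; rewrite -normr_eq0 -[_ == 0]negbK; apply/negP => an0.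
have a0 : 0 < `|a| by rewrite lt_def an0 /=.
pose t := Num.min d (`|a| / (2 * (`|b| + 1))).
have b1 : 0 < 2 * (`|b| + 1) by rewrite mulr_gt0 // ltr_wpDl.
have t0 : 0 < t by rewrite lt_min d0 divr_gt0.
have td : t <= d by rewrite ge_min lexx.
have tb : t * (2 * (`|b| + 1)) <= `|a| by rewrite -ler_pdivlMr // ge_min lexx orbT.
have bb := ler_norm b.
have tt : `|b| * t * t <= `|a| / 2 * t by rewrite ler_pM2r //; nra.
have bt : b * t ^+ 2 <= `|a| / 2 * t.
  by apply: le_trans tt; rewrite expr2 mulrA !ler_pM2r.
have [a_ge0|a_lt0] := leP 0 a.
  have := h (- t); rewrite normrN gtr0_norm // => /(_ td).
  by rewrite ger0_norm // in a0 bt *; rewrite sqrrN; nra.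
have := h t; rewrite gtr0_norm // => /(_ td).
by rewrite ltr0_norm // in a0 bt *; nra.
Qed.

(** The strict concavity that forbids a minimizing sequence to split its mass. *)
Lemma powR_gt_self (x t : R) : 0 < x < 1 -> 0 < t < 1 -> x < x `^ t.
Proof.
move=> /andP[x0 x1] /andP[t0 t1].
have E : x = x `^ t * x `^ (1 - t).
  by rewrite -powRD ?subrKC ?powRr1 ?(ltW x0) // (gt_eqF x0) implybT.
rewrite {1}E gtr_pMr ?powR_gt0 //.
have := @gt0_ltr_powR R (1 - t) _ x 1; rewrite powR1 subr_gt0.
by apply; rewrite // nnegrE ?ler01 ?(ltW x0).
Qed.

(** Lets the parameter of a variation tend to 0 in an inequality. *)
Lemma le_of_small (a b c e : R) : 0 < e -> (forall t, 0 < t <= e -> a <= b + c * t) ->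
  a <= b.
Proof.
move=> e0 H; rewrite leNgt; apply/negP => ba.
have c0 : 0 < `|c| + 1 by rewrite ltr_wpDl.
pose t := Num.min e ((a - b) / 2 / (`|c| + 1)).
have t0 : 0 < t by rewrite lt_min e0 !divr_gt0 // subr_gt0.
have tc : t * (`|c| + 1) <= (a - b) / 2 by rewrite -ler_pdivlMr // ge_min lexx orbT.
have := H t; rewrite t0 ge_min lexx => /(_ isT).
have := ler_norm c; nra.
Qed.

End PowerInequalities.

(** * Square-summable families and their weak limits *)

Section SquareSummable.
Context {R : realType} {T : choiceType}.
Implicit Types (f g h : T -> R) (t e : R).

Definition sqsum f : Prop := absum (fun n => f n ^+ 2).
Definition ip f g : R := tsum (fun n => f n * g n).
(** Every perturbation below has the form [f + t h], so this single operation
    replaces addition, subtraction and scaling of functions. *)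
Definition axpy f t h : T -> R := fun n => f n + t * h n.

Lemma absum_ip f g : sqsum f -> sqsum g -> absum (fun n => f n * g n).
Proof.
move=> sf sg; apply: (absum_le (absumD sf sg)) => n.
rewrite ler_norml; apply/andP; split; nra.
Qed.

Lemma sqsum_axpy f t h : sqsum f -> sqsum h -> sqsum (axpy f t h).
Proof.
move=> sf sh; apply: (absum_le (absumD (absumZ 2 sf) (absumZ (2 * t ^+ 2) sh))) => n.
by rewrite /axpy ger0_norm ?sqr_ge0 //; have := sqr_ge0 (f n - t * h n); nra.
Qed.

Lemma sqsum0 : sqsum (fun=> 0).
Proof. by rewrite /sqsum expr0n; exact: absum0. Qed.

Lemma sqsum_sum (I : finType) (f : I -> T -> R) :
  (forall i, sqsum (f i)) -> sqsum (fun n => \sum_i f i n).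
Proof.
move=> sf; elim: (index_enum I) => [|i s ih].
  by under eq_fun do rewrite big_nil; exact: sqsum0.
rewrite (_ : (fun n => _) = axpy (f i) 1 (fun n => \sum_(j <- s) f j n)).
  exact: sqsum_axpy.
by apply/funext => n; rewrite /axpy big_cons mul1r.
Qed.

Lemma sqsum_le f g : sqsum g -> (forall n, `|f n| <= `|g n|) -> sqsum f.
Proof.
move=> sg fg; apply: (absum_le sg) => n.
by rewrite ger0_norm ?sqr_ge0 // -real_normK ?num_real // -[leRHS]real_normK
  ?num_real // lerXn2r ?nnegrE.
Qed.

Lemma ipC f g : ip f g = ip g f.
Proof. by rewrite /ip; under eq_fun do rewrite mulrC. Qed.

Lemma ip_axpyl f t h g : sqsum f -> sqsum h -> sqsum g ->
  ip (axpy f t h) g = ip f g + t * ip h g.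
Proof.
move=> sf sh sg; rewrite /ip -tsumZ; last exact: absum_ip.
rewrite -tsumD; [|exact: absum_ip|exact/absumZ/absum_ip].
by congr tsum; apply/funext => n; rewrite /axpy mulrDl mulrA.
Qed.

Lemma ip_axpyr f t h g : sqsum f -> sqsum h -> sqsum g ->
  ip g (axpy f t h) = ip g f + t * ip g h.
Proof. by move=> *; rewrite !(ipC g) ip_axpyl. Qed.

Lemma ipZl t f g : sqsum f -> sqsum g -> ip (fun n => t * f n) g = t * ip f g.
Proof.
move=> sf sg; rewrite /ip -tsumZ; last exact: absum_ip.
by congr tsum; apply/funext => n; rewrite mulrA.
Qed.

Lemma ip_ge0 f : 0 <= ip f f.
Proof. by apply: tsum_ge0 => n; rewrite -expr2 sqr_ge0. Qed.

Lemma ip_sq f : ip f f = tsum (fun n => f n ^+ 2).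
Proof. by []. Qed.

Lemma sqr_le_ip f n : sqsum f -> f n ^+ 2 <= ip f f.
Proof. by move=> sf; apply: (tsum_ge1 n) => // m; exact: sqr_ge0. Qed.

Lemma ip_eq0 f : sqsum f -> ip f f <= 0 -> forall n, f n = 0.
Proof.
move=> sf f0 n; have := sqr_le_ip n sf => h.
by apply/eqP; rewrite -sqrf_eq0 eq_le sqr_ge0 andbT (le_trans h).
Qed.

Lemma sqsum_single f x : (forall n, n != x -> f n = 0) -> sqsum f.
Proof.
move=> fx; have [|//] := @tsum_single R T (fun n => f n ^+ 2) x.
by move=> n /fx ->; rewrite expr0n.
Qed.

Definition dirac_at (x : T) : T -> R := fun n => (n == x)%:R.

Lemma sqsum_dirac x : sqsum (dirac_at x).
Proof. by apply: (@sqsum_single _ x) => n /negbTE nx; rewrite /dirac_at nx. Qed.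

Lemma ip_dirac f x : ip f (dirac_at x) = f x.
Proof.
have [|_] := @tsum_single R T (fun n => f n * dirac_at x n) x.
  by move=> n /negbTE nx; rewrite /dirac_at nx mulr0.
by rewrite /ip => ->; rewrite /dirac_at eqxx mulr1.
Qed.

(** The tail of the sum of squares dominates each of its terms. *)
Lemma sqsum_vanish f e : sqsum f -> 0 < e ->
  exists X : {fset T}, forall n, n \notin X -> `|f n| < e.
Proof.
move=> sf e0; have e20 : 0 < e ^+ 2 by rewrite exprn_gt0.
have [X [aX hX]] := tsum_tail (fun n => sqr_ge0 (f n)) sf e20.
exists X => n nX; rewrite -(@ltr_pXn2r _ 2) ?nnegrE ?(ltW e0) // real_normK ?num_real //.
apply: le_lt_trans hX; have := tsum_ge1 n _ aX; rewrite (negbTE nX); apply.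
by move=> m; case: ifP => // _; exact: sqr_ge0.
Qed.

End SquareSummable.

Section WeakLimits.
Context {R : realType} {T : choiceType} {I : Type}.

(** A bounded family that tends to 0 pointwise tends to 0 weakly: by Young's
    inequality [|g w| <= e w^2 + g^2 / (4 e)]. *)
Lemma ip_cvg0 (F : set_system I) (w : I -> T -> R) (g : T -> R) (M : R) :
  ProperFilter F -> sqsum g -> (forall k, sqsum (w k)) ->
  (forall k, ip (w k) (w k) <= M) -> (forall n, w k n @[k --> F] --> 0) ->
  ip g (w k) @[k --> F] --> 0.
Proof.
move=> FF sg sw wM w0; rewrite -(@tsum0 R T).
apply: (@tsum_cvg _ _ _ F (fun k n => g n * w k n) (fun k n => w k n ^+ 2) _ M) => //.
- by move=> n; rewrite -(mulr0 (g n)); apply: cvgM => //; exact: cvg_cst.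
- by move=> k; exact: absum_ip.
- exact: absum0.
- by move=> k n; exact: sqr_ge0.
move=> e e0; exists (fun n => (4 * e)^-1 * g n ^+ 2); split; first exact: absumZ.
move=> k n; rewrite subr0 normrM.
have e4 : 0 < 4 * e by rewrite mulr_gt0.
rewrite -(@ler_pM2l _ (4 * e)) // mulrDr (mulrA (4 * e) (4 * e)^-1) mulfV ?gt_eqF // mul1r.
rewrite -[w k n ^+ 2]real_normK ?num_real // -[g n ^+ 2]real_normK ?num_real //.
have := sqr_ge0 (`|g n| - 2 * e * `|w k n|); nra.
Qed.

Lemma ip_fatou (F : set_system I) (w : I -> T -> R) (v : T -> R) (M : R) :
  ProperFilter F -> (forall k, sqsum (w k)) ->
  (forall k, ip (w k) (w k) <= M) -> (forall n, w k n @[k --> F] --> v n) ->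
  sqsum v /\ ip v v <= M.
Proof.
move=> FF sw wM wv; apply: (@fatou_tsum _ _ _ F (fun k n => w k n ^+ 2)) => //.
- by move=> k n; exact: sqr_ge0.
- by move=> n; apply: cvgM.
Qed.

End WeakLimits.

Lemma absum_weighted {R : realType} {T : choiceType} (W f : T -> R) :
  (forall n, 0 <= W n <= 1) -> sqsum f -> absum (fun n => W n * f n ^+ 2).
Proof.
move=> W01 sf; apply: (absum_le sf) => n; have /andP[W0 W1] := W01 n.
have w0 : 0 <= W n * f n ^+ 2 by rewrite mulr_ge0 ?sqr_ge0.
by rewrite (ger0_norm w0) ler_piMl ?sqr_ge0.
Qed.

(** A weight that vanishes at infinity turns weak convergence into
    convergence of quadratic forms.  It applies to the potential of the linearized
    operator and to the functional that selects a bell-shaped minimizer. *)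
Lemma tsum_weighted_cvg {R : realType} {T : choiceType} {I : Type} (F : set_system I)
    (W : T -> R) (f : I -> T -> R) (g : T -> R) M :
  ProperFilter F -> (forall n, 0 <= W n <= 1) ->
  (forall e, 0 < e -> exists X : {fset T}, forall n, n \notin X -> W n <= e) ->
  (forall k, sqsum (f k)) -> (forall k, ip (f k) (f k) <= M) ->
  (forall n, f k n @[k --> F] --> g n) ->
  tsum (fun n => W n * f k n ^+ 2) @[k --> F] --> tsum (fun n => W n * g n ^+ 2).
Proof.
move=> FF W01 Wvan sf fM fg; have [sg gM] := ip_fatou FF sf fM fg.
have W0 n : 0 <= W n by case/andP: (W01 n).
have W1 n : W n <= 1 by case/andP: (W01 n).
have M0 : 0 <= M by apply: le_trans gM; exact: ip_ge0.
apply: (@tsum_cvg _ _ _ F (fun k n => W n * f k n ^+ 2)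
  (fun k n => f k n ^+ 2 + g n ^+ 2) _ (M + M)) => //.
- move=> n; apply: cvgM; [exact: cvg_cst|exact: cvgM].
- by move=> k; exact: absum_weighted.
- exact: absum_weighted.
- by move=> k n; rewrite addr_ge0 ?sqr_ge0.
- by move=> k; exact: absumD (sf k) sg.
- by move=> k; rewrite (tsumD (sf k) sg); apply: lerD; [exact: fM|exact: gM].
move=> e e0; have [X hX] := Wvan e e0.
exists (fun n => if n \in X then M + M else 0); split.
  have [|//] := @tsum_fset_support R _ (fun n => if n \in X then M + M else 0) X.
  by move=> n /negbTE ->.
move=> k n; rewrite -mulrBr normrM (ger0_norm (W0 n)).
have le : `|f k n ^+ 2 - g n ^+ 2| <= f k n ^+ 2 + g n ^+ 2.
  by rewrite ler_norml; have := sqr_ge0 (f k n); have := sqr_ge0 (g n); lra.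
have s0 : 0 <= f k n ^+ 2 + g n ^+ 2 by rewrite addr_ge0 ?sqr_ge0.
case: ifPn => nX.
  apply: (@le_trans _ _ (M + M)); last by rewrite lerDr mulr_ge0 // ltW.
  apply: (@le_trans _ _ (1 * (M + M))); last by rewrite mul1r.
  apply: ler_pM; rewrite ?W0 ?W1 //.
  apply: le_trans le _; apply: lerD.
    exact: le_trans (sqr_le_ip n (sf k)) (fM k).
  exact: le_trans (sqr_le_ip n sg) gM.
by rewrite addr0; apply: ler_pM; rewrite ?W0 // hX.
Qed.

(** * Nearest neighbours *)

Section Lattice.
Context {d : nat}.
Implicit Types (n j : lattice d).

(** The [2 d] steps to the nearest neighbours; the boolean is the sign. *)
Definition dir (a : 'I_d * bool) : lattice d := (-1) ^+ a.2 *: delta_mx 0 a.1.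

Lemma dirE a i : dir a 0 i = (-1) ^+ a.2 * (i == a.1)%:R.
Proof. by rewrite !mxE eqxx eq_sym. Qed.

Lemma dir_inj : injective dir.
Proof.
move=> [i s] [j t] /rowP E; have := E i; rewrite !dirE /= eqxx.
have [<-|ij] := eqVneq i j; first by case: s t E => [] [].
by case: s {E} => /=; rewrite mulr0.
Qed.

Lemma dirN i s : dir (i, ~~ s) = - dir (i, s).
Proof. by rewrite /dir /= signrN scaleNr. Qed.

(** A sum of squares of integers that equals 1 has exactly one nonzero term,
    and that term is the square of 1 or -1. *)
Lemma nearest_neighbourP n j :
  nearest_neighbour n j <-> exists a, j = n + dir a.
Proof.
split=> [h|[a ->]]; last first.
  rewrite /nearest_neighbour (bigD1 a.1) //= big1.
    by rewrite !mxE !eqxx addrAC subrr add0r mulr1 sqrr_sign addr0.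
  by move=> i ia; rewrite !mxE eqxx (negbTE ia) mulr0 addr0 subrr expr0n.
have [i di] : exists i, j 0 i - n 0 i != 0.
  apply: contrapT => /forallNP H; move: h; rewrite /nearest_neighbour big1 // => i _.
  by have := H i => /negP; rewrite negbK => /eqP ->; rewrite expr0n.
move: h; rewrite /nearest_neighbour (bigD1 i) //=; set m := j 0 i - n 0 i in di *.
set s := \sum_(_ | _) _ => h.
have s0 : 0 <= s by apply: sumr_ge0 => k _; exact: sqr_ge0.
have m1 : 1 <= m ^+ 2 by rewrite -gtz0_ge1 lt_def sqr_ge0 sqrf_eq0 di.
have s00 : s = 0 by apply/eqP; rewrite eq_le s0 andbT; lia.
have mm : m ^+ 2 = 1 by lia.
have sk k : k != i -> j 0 k = n 0 k.
  move=> ki; apply/eqP; rewrite -subr_eq0 -sqrf_eq0; apply/eqP.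
  move/eqP: s00; rewrite psumr_eq0 => [/allP /(_ k)|l _]; last exact: sqr_ge0.
  by rewrite mem_index_enum ki => /(_ isT) /eqP.
exists (i, m == -1); apply/rowP => k; rewrite mxE dirE /=.
have [->|ki] := eqVneq k i; last by rewrite mulr0 addr0 sk.
move/eqP: mm; rewrite sqrf_eq1 /m mulr1.
by case/orP => /eqP E; rewrite E /=; lia.
Qed.

Lemma neighbours_image n :
  [set j | nearest_neighbour n j] = (fun a => n + dir a) @` [set: 'I_d * bool].
Proof.
apply/seteqP; split => j /=.
  by move/nearest_neighbourP => [a ->]; exists a.
by move=> [a _ <-]; apply/nearest_neighbourP; exists a.
Qed.

Lemma setT_index_enum (I : finType) : [set: I] = [set` index_enum I].
Proof. by apply/seteqP; split => a //= _; rewrite mem_index_enum. Qed.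

Lemma sum_nearest_neighbour (V : zmodType) (F : lattice d -> V) n :
  \sum_(j \in [set j | nearest_neighbour n j]) F j = \sum_a F (n + dir a).
Proof.
rewrite neighbours_image fsbig_image; last by move=> a b _ _ /addrI /dir_inj.
by rewrite setT_index_enum -fsbig_seq // index_enum_uniq.
Qed.

Lemma disc_laplacianE (V : zmodType) (u : lattice d -> V) n :
  disc_laplacian u n = \sum_a u (n + dir a) - u n *+ (2 * d).
Proof. by rewrite /disc_laplacian sum_nearest_neighbour. Qed.

Lemma esum_edges (R : realType) (F : lattice d -> lattice d -> \bar R) :
  (forall n j, (0 <= F n j)%E) ->
  (\esum_(e in [set e : lattice d * lattice d | nearest_neighbour e.1 e.2])
     F e.1 e.2 = \sum_a \esum_(n in [set: lattice d]) F n (n + dir a)%R)%E.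
Proof.
move=> F0; rewrite -esum_sum //.
have -> : [set e : lattice d * lattice d | nearest_neighbour e.1 e.2] =
   [set: lattice d] `*`` (fun n => [set j | nearest_neighbour n j]).
  by apply/seteqP; split => [[n j] //|[n j] [//]].
rewrite -(@esum_esum _ _ _ _ _ F) //. apply: eq_esum => n _.
rewrite neighbours_image esum_image; last by move=> a b _ _ /addrI /dir_inj.
have ft : finite_set [set: 'I_d * bool] by exact: finite_finset.
rewrite (@esum_fset _ _ [set: 'I_d * bool]) //.
by rewrite setT_index_enum -fsbig_seq // index_enum_uniq.
Qed.

End Lattice.

Section Connectedness.
Context {d : nat}.

(** Any displacement is a combination of the coordinate vectors with integer
    coefficients, i.e. a succession of steps. *)
Lemma lattice_connected (Z : lattice d -> Prop) (n0 : lattice d) :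
  (forall n a, Z n -> Z (n + dir a)) -> Z n0 -> forall n, Z n.
Proof.
move=> step Z0 n.
have steps k a m : Z m -> Z (m + dir a *+ k).
  elim: k m => [|k ih] m Zm; first by rewrite mulr0n addr0.
  by rewrite mulrS addrA; apply/ih/step.
have move_i (c : int) i m : Z m -> Z (m + c *: delta_mx 0 i).
  case: c => k Zm.
    have := steps k (i, false) _ Zm; rewrite /dir /= expr0 scale1r.
    by rewrite -scaler_nat natz.
  have := steps k.+1 (i, true) _ Zm; rewrite /dir /= expr1 scaleN1r.
  by rewrite mulNrn -scaler_nat -scaleNr natz NegzE.
rewrite -(subrK n0 n) addrC (row_sum_delta (n - n0)).
move: (n - n0) => c.
elim: (index_enum _) n0 Z0 => [|i s ih] m Zm; first by rewrite big_nil addr0.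
by rewrite big_cons addrA; apply/ih/move_i.
Qed.
End Connectedness.

(** * The energy *)

Section Modulus.
Context {R : realType}.
Implicit Types (z w : R[i]) (x : R).

Lemma normc_modulus z : `|z| = (modulus z)%:C.
Proof. by rewrite /modulus RRe_real // ger0_real. Qed.

Lemma modulus_ge0 z : 0 <= modulus z.
Proof. by rewrite -lecR -normc_modulus; exact: normr_ge0. Qed.

(** Moves all estimates from complex numbers to real and imaginary parts. *)
Lemma modulus_sqr z : modulus z ^+ 2 = complex.Re z ^+ 2 + complex.Im z ^+ 2.
Proof.
case: z => a b; rewrite /modulus normc_def /= sqr_sqrtr //.
by rewrite addr_ge0 ?sqr_ge0.
Qed.

Lemma modulusD z w : modulus (z + w) <= modulus z + modulus w.
Proof. by rewrite -lecR rmorphD /= -!normc_modulus ler_normD. Qed.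

Lemma modulusM z w : modulus (z * w) = modulus z * modulus w.
Proof. by apply/(@complexI R); rewrite rmorphM /= -!normc_modulus normrM. Qed.

Lemma modulus_real x : modulus x%:C = `|x|.
Proof.
apply/eqP; rewrite -(@eqrXn2 _ 2) ?modulus_ge0 // modulus_sqr /= expr0n addr0.
by rewrite real_normK ?num_real.
Qed.

Lemma modulusN z : modulus (- z) = modulus z.
Proof. by apply/(@complexI R); rewrite -!normc_modulus normrN. Qed.

Lemma modulus_eq0 z : modulus z = 0 -> z = 0.
Proof. by move=> z0; apply/eqP; rewrite -normr_eq0 normc_modulus z0. Qed.
End Modulus.

Section RealEnergy.
Context {R : realType} {d : nat}.
Variable omega : R.
Implicit Types (f g h : lattice d -> R) (y : lattice d) (t : R).

Lemma tsum_translate f y : tsum (translate y f) = tsum f.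
Proof. by apply: (tsum_reindex _ (@addrK _ y) (@subrK _ y)). Qed.

Lemma absum_translate f y : absum f -> absum (translate y f).
Proof. exact: (absum_reindex (@addrK _ y) (@subrK _ y)). Qed.

Lemma sqsum_translate f y : sqsum f -> sqsum (translate y f).
Proof. exact: absum_translate. Qed.

Lemma ip_translate f g y : ip (translate y f) (translate y g) = ip f g.
Proof. exact: (tsum_translate (fun n => f n * g n)). Qed.

Lemma ip_translatel f g y : ip (translate y f) g = ip f (translate (- y) g).
Proof.
have -> : f = translate (- y) (translate y f).
  by apply/funext => n; rewrite /translate subrK.
rewrite [RHS]ip_translate; congr (ip (translate y _) g).
by apply/funext => n; rewrite /translate subrK.
Qed.

(** The adjacency operator of the lattice, so that
    [-Delta + omega = (omega + 2 d) - hop]. *)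
Definition hop f : lattice d -> R := fun n => \sum_a translate (dir a) f n.

Lemma sqsum_hop f : sqsum f -> sqsum (hop f).
Proof. by move=> sf; apply: sqsum_sum => a; exact: sqsum_translate. Qed.

Lemma ip_hop f g : sqsum f -> sqsum g ->
  ip (hop f) g = \sum_a ip (translate (dir a) f) g.
Proof.
move=> sf sg; rewrite /ip -tsum_sum; last first.
  by move=> a; apply: absum_ip => //; exact: sqsum_translate.
by congr tsum; apply/funext => n; rewrite /hop mulr_suml.
Qed.

(** The step [a] to the left of the product becomes the opposite step to its
    right, and the set of steps is symmetric. *)
Lemma ip_hop_sym f g : sqsum f -> sqsum g -> ip (hop f) g = ip f (hop g).
Proof.
move=> sf sg; rewrite (ipC f) !ip_hop //.
pose flip (a : 'I_d * bool) := (a.1, ~~ a.2).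
have flipK : involutive flip by case=> i s; rewrite /flip /= negbK.
rewrite (reindex_inj (inv_inj flipK)) /=; apply: eq_bigr => -[i s] _.
by rewrite ip_translatel dirN opprK ipC.
Qed.

Definition helmholtz f : lattice d -> R :=
  fun n => - disc_laplacian f n + omega * f n.

Lemma helmholtzE f :
  helmholtz f = axpy (fun n => (omega + (2 * d)%:R) * f n) (- 1) (hop f).
Proof.
apply/funext => n; rewrite /helmholtz disc_laplacianE /axpy /hop /translate.
by rewrite opprB mulN1r mulrDl -mulr_natl; ring.
Qed.

Lemma sqsumZ t f : sqsum f -> sqsum (fun n => t * f n).
Proof.
move=> sf; rewrite (_ : (fun n => _) = axpy (fun=> 0) t f).
  by apply: sqsum_axpy => //; exact: sqsum0.
by apply/funext => n; rewrite /axpy add0r.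
Qed.

Lemma sqsum_helmholtz f : sqsum f -> sqsum (helmholtz f).
Proof.
by move=> sf; rewrite helmholtzE; apply: sqsum_axpy; [exact: sqsumZ|exact: sqsum_hop].
Qed.

Lemma helmholtz_sym f g : sqsum f -> sqsum g ->
  ip (helmholtz f) g = ip f (helmholtz g).
Proof.
move=> sf sg; have ssf := sqsumZ (omega + (2 * d)%:R) sf.
have ssg := sqsumZ (omega + (2 * d)%:R) sg.
have hf := sqsum_hop sf; have hg := sqsum_hop sg.
rewrite !helmholtzE ip_axpyl // ip_axpyr // ip_hop_sym //.
by rewrite ipZl // [in RHS](ipC f) ipZl // (ipC g).
Qed.

Lemma helmholtz_axpy f t h :
  helmholtz (axpy f t h) = axpy (helmholtz f) t (helmholtz h).
Proof.
apply/funext => n; rewrite /helmholtz !disc_laplacianE /axpy big_split /=.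
by rewrite -mulr_sumr mulrnDl -mulrnAr (disc_laplacianE f) (disc_laplacianE h); ring.
Qed.

Definition renergy f : R := ip (helmholtz f) f.

(** The energy is quadratic, so its expansion along [f + t h] is exact. *)
Lemma renergy_axpy f t h : sqsum f -> sqsum h ->
  renergy (axpy f t h) =
  renergy f + 2 * t * ip (helmholtz f) h + t ^+ 2 * renergy h.
Proof.
move=> sf sh; have hf := sqsum_helmholtz sf; have hh := sqsum_helmholtz sh.
rewrite /renergy helmholtz_axpy ip_axpyl ?ip_axpyr //; last exact: sqsum_axpy.
by rewrite (helmholtz_sym sh sf) (ipC h); ring.
Qed.

Lemma absum_grad f y : sqsum f -> absum (fun n => (f (n + y) - f n) ^+ 2).
Proof.
move=> sf; have sfy := sqsum_translate y sf.
rewrite (_ : (fun n => _) = fun n => axpy (translate y f) (- 1) f n ^+ 2).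
  exact: sqsum_axpy.
by apply/funext => n; rewrite /axpy mulN1r.
Qed.

(** Summation by parts, in the form in which every edge is counted twice. *)
Lemma renergy_grad f : sqsum f ->
  renergy f = 2^-1 * (\sum_a tsum (fun n => (f (n + dir a) - f n) ^+ 2))
              + omega * ip f f.
Proof.
move=> sf; have E y : tsum (fun n => (f (n + y) - f n) ^+ 2) =
    2 * ip f f - 2 * ip (translate y f) f.
  have sy := sqsum_translate y sf.
  transitivity (ip (axpy (translate y f) (- 1) f) (axpy (translate y f) (- 1) f)).
    by congr tsum; apply/funext => n; rewrite /axpy mulN1r.
  rewrite ip_axpyl ?ip_axpyr //; do ?exact: sqsum_axpy.
  by rewrite ip_translate (ipC f); ring.
rewrite /renergy helmholtzE ip_axpyl //; [|exact: sqsumZ|exact: sqsum_hop].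
rewrite ipZl // ip_hop //; under [in RHS]eq_bigr do rewrite E.
rewrite big_split /= sumr_const sumrN -mulr_sumr card_prod card_ord card_bool.
by rewrite (mulnC d) -mulr_natl; field.
Qed.

Lemma renergy_ge f : sqsum f -> omega * ip f f <= renergy f.
Proof.
move=> sf; rewrite renergy_grad // lerDr mulr_ge0 ?invr_ge0 //.
by apply: sumr_ge0 => a _; apply: tsum_ge0 => n; exact: sqr_ge0.
Qed.

Lemma renergy0 : renergy (fun=> 0) = 0.
Proof. by rewrite /renergy /ip; under eq_fun do rewrite mulr0; exact: tsum0. Qed.

End RealEnergy.

Section ComplexEnergy.
Context {R : realType} {d : nat}.
Implicit Types (u v : lattice d -> R[i]) (omega : R).

Definition re u : lattice d -> R := fun n => complex.Re (u n).
Definition im u : lattice d -> R := fun n => complex.Im (u n).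

Lemma lp_sum2 u :
  lp_sum 2 u = (\esum_(n in [set: lattice d]) (modulus (u n) ^+ 2)%:E)%E.
Proof.
by apply: eq_esum => n _; rewrite (powR_mulrn 2) // modulus_ge0.
Qed.

Lemma ell2_lp_sum u : ell2 u <-> (lp_sum 2 u < +oo)%E.
Proof.
rewrite /ell2 /lp_norm; have : (0 <= lp_sum 2 u)%E.
  by apply: esum_ge0 => n _; rewrite lee_fin powR_ge0.
case: (lp_sum 2 u) => [r| |] //= _; first by rewrite !ltry.
by rewrite invr_eq0 pnatr_eq0.
Qed.

Lemma ell2P u : ell2 u <-> absum (fun n => modulus (u n) ^+ 2).
Proof.
rewrite ell2_lp_sum lp_sum2 /absum.
by under [X in (_ <-> X < _)%E]eq_esum do rewrite ger0_norm ?sqr_ge0 //.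
Qed.

Lemma ell2_ReIm u : ell2 u <-> sqsum (re u) /\ sqsum (im u).
Proof.
rewrite ell2P; split=> [au|[ar ai]].
  by split; apply: (absum_le au) => n; rewrite modulus_sqr ger0_norm ?sqr_ge0 //;
    rewrite ?lerDl ?lerDr sqr_ge0.
apply: (absum_le (absumD ar ai)) => n.
by rewrite ger0_norm ?sqr_ge0 // modulus_sqr.
Qed.

Definition norm2 u : R := ip (re u) (re u) + ip (im u) (im u).

Lemma norm2_tsum u : ell2 u -> norm2 u = tsum (fun n => modulus (u n) ^+ 2).
Proof.
move=> /ell2_ReIm[sr si]; rewrite /norm2 !ip_sq -tsumD //.
by congr tsum; apply/funext => n; rewrite modulus_sqr.
Qed.

Lemma lp_sum2_norm2 u : ell2 u -> lp_sum 2 u = (norm2 u)%:E.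
Proof.
move=> eu; rewrite norm2_tsum // lp_sum2 esum_tsum //; first by move=> n; exact: sqr_ge0.
exact/ell2P.
Qed.

Lemma kinetic_grad u : ell2 u -> kinetic u =
  (2^-1 * \sum_a (tsum (fun n => (re u (n + dir a) - re u n) ^+ 2)
                  + tsum (fun n => (im u (n + dir a) - im u n) ^+ 2)))%:E.
Proof.
move=> /ell2_ReIm[sr si]; rewrite /kinetic.
rewrite (@esum_edges _ _ (fun n j => (modulus (u j - u n) ^+ 2)%:E)); last first.
  by move=> n j; rewrite lee_fin sqr_ge0.
rewrite [RHS]EFinM -sumEFin; congr (_ * _)%E; apply: eq_bigr => a _.
have ar := absum_grad (dir a) sr; have ai := absum_grad (dir a) si.
rewrite -tsumD // -esum_tsum; last 2 first.
- by move=> n; rewrite addr_ge0 ?sqr_ge0.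
- exact: absumD.
apply: eq_esum => n _; congr EFin; rewrite modulus_sqr /re /im.
by case: (u (n + dir a)) (u n) => [? ?] [? ?].
Qed.

Lemma energyE omega u : ell2 u ->
  energy omega u = renergy omega (re u) + renergy omega (im u).
Proof.
move=> eu; have /ell2_ReIm[sr si] := eu.
rewrite /energy kinetic_grad // lp_sum2_norm2 //= !renergy_grad //.
by rewrite big_split /= /norm2; ring.
Qed.

Lemma re_real (f : lattice d -> R) : re (fun n => (f n)%:C) = f.
Proof. by []. Qed.

Lemma im_real (f : lattice d -> R) : im (fun n => (f n)%:C) = fun=> 0.
Proof. by []. Qed.

Lemma ell2_real (f : lattice d -> R) : ell2 (fun n => (f n)%:C) <-> sqsum f.
Proof.
rewrite ell2_ReIm re_real im_real.
by split=> [[]//|sf]; split => //; exact: sqsum0.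
Qed.

Lemma energy_real omega (f : lattice d -> R) : sqsum f ->
  energy omega (fun n => (f n)%:C) = renergy omega f.
Proof.
by move=> sf; rewrite energyE ?ell2_real // re_real im_real renergy0 addr0.
Qed.

End ComplexEnergy.

(** * The minimal energy *)

Section PowerSums.
Context {R : realType} {d : nat}.
Implicit Types (u v w : lattice d -> R[i]) (p c B : R).

Definition psum p u : R := tsum (fun n => modulus (u n) `^ p).

Lemma modulus_sqr_le u n : ell2 u -> modulus (u n) ^+ 2 <= norm2 u.
Proof.
move=> eu; rewrite norm2_tsum //; apply: (tsum_ge1 n) => [m|]; first exact: sqr_ge0.
exact/ell2P.
Qed.

Lemma modulus_le_norm u n : ell2 u -> modulus (u n) <= Num.sqrt (norm2 u).
Proof.
move=> eu; rewrite -(ger0_norm (modulus_ge0 _)) -sqrtr_sqr ler_wsqrtr //.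
exact: modulus_sqr_le.
Qed.

(** Compares the constraint with the l^2 norm; this is where [p >= 2] enters. *)
Lemma powR_le_sqr p B x : 2 <= p -> 0 <= x <= B -> x `^ p <= B `^ (p - 2) * x ^+ 2.
Proof.
move=> p2 /andP[x0 xB]; have -> : x `^ p = x `^ (p - 2) * x ^+ 2.
  by rewrite -(powR_mulrn 2) // -powRD ?subrK //; apply/implyP => /eqP; lra.
rewrite ler_wpM2r ?sqr_ge0 //; apply: ge0_ler_powR; rewrite ?nnegrE //; lra.
Qed.

(** The factor [B `^ (p - 2)] shows that small entries with a bounded l^2 norm
    cannot carry the constraint. *)
Lemma psum_bounded p B u : 2 <= p -> ell2 u -> (forall n, modulus (u n) <= B) ->
  absum (fun n => modulus (u n) `^ p) /\ psum p u <= B `^ (p - 2) * norm2 u.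
Proof.
move=> p2 eu uB; have au := (ell2P u).1 eu.
have le n : modulus (u n) `^ p <= B `^ (p - 2) * modulus (u n) ^+ 2.
  by rewrite powR_le_sqr // modulus_ge0 uB.
have ap : absum (fun n => modulus (u n) `^ p).
  by apply: (absum_le (absumZ (B `^ (p - 2)) au)) => n; rewrite ger0_norm ?powR_ge0.
split => //; rewrite norm2_tsum // -tsumZ //; apply: tsum_le => //; exact: absumZ.
Qed.

Lemma absum_psum p u : 2 <= p -> ell2 u -> absum (fun n => modulus (u n) `^ p).
Proof.
by move=> p2 eu; have [] := psum_bounded p2 eu (fun n => modulus_le_norm n eu).
Qed.

Lemma psum_le_norm2 p u : 2 <= p -> ell2 u ->
  psum p u <= Num.sqrt (norm2 u) `^ (p - 2) * norm2 u.
Proof.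
by move=> p2 eu; have [] := psum_bounded p2 eu (fun n => modulus_le_norm n eu).
Qed.

Lemma lp_sum_psum p u : 2 <= p -> ell2 u -> lp_sum p u = (psum p u)%:E.
Proof.
move=> p2 eu; rewrite /lp_sum esum_tsum //; first by move=> n; exact: powR_ge0.
exact: absum_psum.
Qed.

Lemma psum_ge0 p u : 0 <= psum p u.
Proof. by apply: tsum_ge0 => n; exact: powR_ge0. Qed.

Definition cscale c u : lattice d -> R[i] := fun n => c%:C * u n.

Lemma re_cscale c u : re (cscale c u) = fun n => c * re u n.
Proof. by apply/funext => n; rewrite /re /cscale; case: (u n) => a b /=; ring. Qed.

Lemma im_cscale c u : im (cscale c u) = fun n => c * im u n.
Proof. by apply/funext => n; rewrite /im /cscale; case: (u n) => a b /=; ring. Qed.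

Lemma ell2_cscale c u : ell2 u -> ell2 (cscale c u).
Proof.
move=> /ell2_ReIm[sr si]; apply/ell2_ReIm; rewrite re_cscale im_cscale.
by split; exact: sqsumZ.
Qed.

Lemma renergyZ omega c (f : lattice d -> R) : sqsum f ->
  renergy omega (fun n => c * f n) = c ^+ 2 * renergy omega f.
Proof.
move=> sf; have -> : (fun n => c * f n) = axpy (fun=> 0) c f.
  by apply/funext => n; rewrite /axpy add0r.
have s0 := @sqsum0 R (lattice d); rewrite renergy_axpy // renergy0 helmholtz_sym //.
by rewrite /ip; under eq_fun do rewrite mul0r; rewrite tsum0 mulr0 !add0r.
Qed.

Lemma energy_cscale omega c u : ell2 u ->
  energy omega (cscale c u) = c ^+ 2 * energy omega u.
Proof.
move=> eu; have [sr si] := (ell2_ReIm u).1 eu.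
rewrite !energyE //; last exact: ell2_cscale.
by rewrite re_cscale im_cscale !renergyZ // mulrDr.
Qed.

Lemma psum_cscale p c u : 2 <= p -> 0 <= c -> ell2 u ->
  psum p (cscale c u) = c `^ p * psum p u.
Proof.
move=> p2 c0 eu; rewrite /psum -tsumZ; last exact: absum_psum.
congr tsum; apply/funext => n; rewrite /cscale modulusM modulus_real ger0_norm //.
by rewrite powRM // modulus_ge0.
Qed.

End PowerSums.

Section MinEnergy.
Context {R : realType} {d : nat}.
Variables (sigma omega : R).
Hypotheses (sigma0 : 0 < sigma) (omega0 : 0 < omega).
Implicit Types (u v w : lattice d -> R[i]).
Local Notation p := (2 * sigma + 2).
Local Notation j := (min_energy d sigma omega).

Let p2 : 2 <= p. Proof. by rewrite lerDr mulr_ge0 // ltW. Qed.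
Let p0 : 0 < p. Proof. exact: lt_le_trans p2. Qed.

Lemma admissibleP u : admissible sigma u <-> ell2 u /\ psum p u = 1.
Proof.
rewrite /admissible; split=> -[eu].
  by rewrite lp_sum_psum // => -[].
by rewrite lp_sum_psum // => ->.
Qed.

Lemma energy_ge u : ell2 u -> omega * norm2 u <= energy omega u.
Proof.
move=> eu; have [sr si] := (ell2_ReIm u).1 eu.
by rewrite energyE // mulrDr lerD // renergy_ge.
Qed.

Lemma norm2_ge0 u : 0 <= norm2 u.
Proof. by rewrite addr_ge0 // ip_ge0. Qed.

Lemma energy_ge0 u : ell2 u -> 0 <= energy omega u.
Proof.
by move=> eu; apply: le_trans (energy_ge eu); rewrite mulr_ge0 ?norm2_ge0 // ltW.
Qed.

(** Entries of an admissible function have modulus at most 1, so that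
    [|u|^p <= |u|^2]. *)
Lemma admissible_norm2 u : admissible sigma u -> 1 <= norm2 u.
Proof.
move=> /admissibleP[eu u1].
have uB n : modulus (u n) <= 1.
  rewrite leNgt; apply/negP => un.
  have := tsum_ge1 n (fun n => powR_ge0 (modulus (u n)) p) (absum_psum p2 eu).
  rewrite -/(psum p u) u1 leNgt => /negP; apply.
  have := @gt0_ltr_powR R p p0 1 (modulus (u n)); rewrite powR1.
  by apply; rewrite // nnegrE ?ler01 ?modulus_ge0.
by have [_] := psum_bounded p2 eu uB; rewrite u1 powR1 mul1r.
Qed.

Lemma admissible_energy_ge u : admissible sigma u -> omega <= energy omega u.
Proof.
move=> au; have [eu _] := au; apply: le_trans (energy_ge eu).
by rewrite ler_pMr // admissible_norm2.
Qed.

Lemma admissible_dirac : admissible sigma (fun n : lattice d => (dirac_at 0 n : R)%:C).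
Proof.
apply/admissibleP; split; first exact/ell2_real/sqsum_dirac.
have [|_] := @tsum_single R _ (fun n : lattice d => modulus (dirac_at 0 n : R)%:C `^ p) 0.
  by move=> n /negbTE n0; rewrite /dirac_at n0 modulus_real normr0 powR0 // gt_eqF.
by rewrite /psum => ->; rewrite /dirac_at eqxx modulus_real normr1 powR1.
Qed.

Lemma energy_has_inf : has_inf [set energy omega u | u in @admissible R d sigma].
Proof.
split; first exact: ex_intro _ _ (ex_intro2 _ _ _ admissible_dirac erefl).
by exists omega => _ [u au <-]; exact: admissible_energy_ge.
Qed.

Lemma min_energy_ge : omega <= j.
Proof.
by apply: lb_le_inf; [case: energy_has_inf|move=> _ [u au <-]; exact: admissible_energy_ge].
Qed.

Lemma min_energy_gt0 : 0 < j.
Proof. exact: lt_le_trans min_energy_ge. Qed.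

Lemma min_energy_le u : admissible sigma u -> j <= energy omega u.
Proof.
by move=> au; apply: ge_inf; [case: energy_has_inf|exists u].
Qed.

Lemma is_minimizerP u :
  is_minimizer sigma omega u <-> admissible sigma u /\ energy omega u = j.
Proof.
split=> -[au hu]; split => //.
  apply/eqP; rewrite eq_le min_energy_le // andbT.
  apply: lb_le_inf; first by case: energy_has_inf.
  by move=> _ [v av <-]; exact: hu.
by move=> v av; rewrite hu min_energy_le.
Qed.

(** Normalize [u] to the constraint; both sides scale like the square of the
    factor. *)
Lemma min_energy_homogeneous u : ell2 u ->
  j * psum p u `^ (2 / p) <= energy omega u.
Proof.
move=> eu; have := psum_ge0 p u; rewrite le_eqVlt => /predU1P[<-|s0].
  rewrite powR0 ?mulr0 ?energy_ge0 //.
  by rewrite mulf_eq0 invr_eq0 pnatr_eq0 /= gt_eqF.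
pose c := psum p u `^ (- p^-1).
have c0 : 0 < c by exact: powR_gt0.
have ac : admissible sigma (cscale c u).
  apply/admissibleP; split; first exact: ell2_cscale.
  rewrite psum_cscale ?(ltW c0) // /c -powRrM mulNr mulVf ?gt_eqF //.
  by rewrite powR_inv1 ?(ltW s0) // mulVf // gt_eqF.
have := min_energy_le ac; rewrite energy_cscale //.
have cE : c ^+ 2 = (psum p u `^ (2 / p))^-1.
  by rewrite -(powR_mulrn 2) ?(ltW c0) // /c -powRrM -powRN mulNr (mulrC p^-1).
by rewrite cE mulrC ler_pdivlMr // powR_gt0.
Qed.

Lemma minimizing_exists : exists u : nat -> lattice d -> R[i],
  (forall k, admissible sigma (u k)) /\
  energy omega (u k) @[k --> \oo] --> j.
Proof.
have H k : exists u, admissible sigma u /\ energy omega u < j + k.+1%:R^-1.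
  have k0 : 0 < k.+1%:R^-1 :> R by rewrite invr_gt0.
  by have [_ [u au <-] lu] := inf_adherent k0 energy_has_inf; exists u.
have [u hu] := choice H; exists u; split; first by move=> k; case: (hu k).
apply: (@squeeze_cvgr _ _ _ _ (fun=> j) (fun k => j + k.+1%:R^-1)).
- by apply: nearW => k; have [a /ltW ->] := hu k; rewrite min_energy_le.
- exact: cvg_cst.
- rewrite -[X in _ --> X]addr0; apply: cvgD; first exact: cvg_cst.
  exact: cvg_harmonic.
Qed.

End MinEnergy.

(** * Splitting along weak limits *)

Section Differences.
Context {R : realType} {d : nat}.
Implicit Types (u v : lattice d -> R[i]).

Lemma ip_axpy_le (g h : lattice d -> R) t : sqsum g -> sqsum h ->
  ip (axpy g t h) (axpy g t h) <= 2 * ip g g + 2 * t ^+ 2 * ip h h.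
Proof.
move=> sg sh; have := ip_ge0 (axpy g (- t) h).
rewrite !ip_axpyl ?ip_axpyr //; do ?exact: sqsum_axpy.
by rewrite (ipC h g) => H; rewrite -subr_ge0; move: H; congr (_ <= _); ring.
Qed.

Lemma modulus_le_ReIm (z : R[i]) : modulus z <= `|complex.Re z| + `|complex.Im z|.
Proof.
rewrite -(@ler_pXn2r _ 2) ?nnegrE ?modulus_ge0 ?addr_ge0 // modulus_sqr.
rewrite -[complex.Re z ^+ 2]real_normK ?num_real // -[complex.Im z ^+ 2]real_normK ?num_real //.
have := mulr_ge0 (normr_ge0 (complex.Re z)) (normr_ge0 (complex.Im z)); nra.
Qed.

Definition cdiff (u v : lattice d -> R[i]) : lattice d -> R[i] := fun n => u n - v n.

Lemma re_cdiff u v : re (cdiff u v) = axpy (re u) (- 1) (re v).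
Proof.
apply/funext => n; rewrite /re /cdiff /axpy.
by case: (u n) (v n) => [a b] [a' b'] /=; ring.
Qed.

Lemma im_cdiff u v : im (cdiff u v) = axpy (im u) (- 1) (im v).
Proof.
apply/funext => n; rewrite /im /cdiff /axpy.
by case: (u n) (v n) => [a b] [a' b'] /=; ring.
Qed.

Lemma ell2_cdiff u v : ell2 u -> ell2 v -> ell2 (cdiff u v).
Proof.
move=> /ell2_ReIm[ru iu] /ell2_ReIm[rv iv]; apply/ell2_ReIm.
by rewrite re_cdiff im_cdiff; split; exact: sqsum_axpy.
Qed.

Lemma norm2_cdiff_le u v : ell2 u -> ell2 v ->
  norm2 (cdiff u v) <= 2 * norm2 u + 2 * norm2 v.
Proof.
move=> /ell2_ReIm[ru iu] /ell2_ReIm[rv iv]; rewrite /norm2 re_cdiff im_cdiff.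
have := ip_axpy_le (- 1) ru rv; have := ip_axpy_le (- 1) iu iv.
rewrite sqrrN expr1n mulr1; lra.
Qed.

End Differences.

Section BrezisLieb.
Context {R : realType} {d : nat} {I : Type}.
Variables (F : set_system I) (FF : ProperFilter F).
Implicit Types (f : I -> lattice d -> R) (u : I -> lattice d -> R[i]).

(** The cross term [<(-Delta + omega) a, f_k - a>] tends to 0 by weak
    convergence. *)
Lemma renergy_splitting omega f (a : lattice d -> R) (M : R) :
  (forall k, sqsum (f k)) -> (forall k, ip (f k) (f k) <= M) ->
  (forall n, f k n @[k --> F] --> a n) ->
  renergy omega (f k) - renergy omega (axpy (f k) (- 1) a) @[k --> F]
    --> renergy omega a.
Proof.
move=> sf fM fa; have [sa aM] := ip_fatou FF sf fM fa.
pose w k := axpy (f k) (- 1) a.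
have sw k : sqsum (w k) by exact: sqsum_axpy.
have fE k : f k = axpy (w k) 1 a by apply/funext => n; rewrite /w /axpy; ring.
have E k : renergy omega (f k) - renergy omega (w k) =
    2 * ip (helmholtz omega a) (w k) + renergy omega a.
  rewrite {1}fE renergy_axpy // mulr1 expr1n mul1r helmholtz_sym // ipC; ring.
rewrite (_ : (fun k => _) = fun k => 2 * ip (helmholtz omega a) (w k) + renergy omega a);
  last by apply/funext => k; rewrite -E.
suff H : 2 * ip (helmholtz omega a) (w k) + renergy omega a @[k --> F]
    --> 2 * 0 + renergy omega a by rewrite mulr0 add0r in H.
apply: cvgD; last exact: cvg_cst.
apply: cvgM; first exact: cvg_cst.
apply: (@ip_cvg0 _ _ _ _ _ _ (2 * M + 2 * M)) => //.
- exact: sqsum_helmholtz.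
- move=> k; apply: le_trans (ip_axpy_le _ (sf k) sa) _.
  by rewrite sqrrN expr1n mulr1 lerD // ler_pM2l.
- move=> n; rewrite -[X in _ --> X](subrr (a n)) /w /axpy.
  by under eq_fun do rewrite mulN1r; apply: cvgB => //; exact: cvg_cst.
Qed.

(** One half of the Brezis-Lieb lemma.  The positive part of
    [|u|^p - |u - v|^p - |v|^p] tends to 0 pointwise and, by [powR_split], is at
    most [e |u - v|^p + C |v|^p]. *)
Lemma psum_brezis_lieb p u (v : lattice d -> R[i]) (M : R) : 2 <= p ->
  (forall k, ell2 (u k)) -> ell2 v -> (forall k, norm2 (u k) <= M) ->
  (forall n, modulus (cdiff (u k) v n) @[k --> F] --> 0) ->
  exists2 r : I -> R, r k @[k --> F] --> 0 &
    forall k, psum p (u k) <= psum p (cdiff (u k) v) + psum p v + r k.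
Proof.
move=> p2 eu ev uM w0; have p0 : 0 < p by lra.
pose w k := cdiff (u k) v; have ew k : ell2 (w k) by exact: ell2_cdiff.
(* Only an upper bound on the defect is wanted, so its positive part suffices. *)
pose h k n := Num.max 0 (modulus (u k n) `^ p - modulus (w k n) `^ p - modulus (v n) `^ p).
have h0 k n : 0 <= h k n by rewrite le_max lexx.
have uvw k n : modulus (u k n) <= modulus (w k n) + modulus (v n).
  by rewrite (le_trans _ (modulusD _ _)) // /w /cdiff subrK.
have hw e : 0 < e -> exists2 C : R, 0 <= C & forall k n,
    h k n <= e * modulus (w k n) `^ p + C * modulus (v n) `^ p
    /\ h k n <= e * modulus (v n) `^ p + C * modulus (w k n) `^ p.
  move=> e0; have [C C0 hC] := powR_split p0 e0; exists C => // k n.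
  have le1 := hC _ _ (modulus_ge0 (w k n)) (modulus_ge0 (v n)).
  have le2 := hC _ _ (modulus_ge0 (v n)) (modulus_ge0 (w k n)).
  have le3 : modulus (u k n) `^ p <= (modulus (w k n) + modulus (v n)) `^ p.
    by apply: ge0_ler_powR; rewrite ?nnegrE ?addr_ge0 ?modulus_ge0 ?(ltW p0).
  have w_ge0 := powR_ge0 (modulus (w k n)) p.
  have v_ge0 := powR_ge0 (modulus (v n)) p.
  rewrite [X in X `^ _]addrC in le2.
  split; rewrite ge_max addr_ge0 ?mulr_ge0 ?(ltW e0) //=; first lra.
  lra.
have av := absum_psum p2 ev.
have aw k := absum_psum p2 (ew k).
have ah k : absum (h k).
  have [C C0 hC] := hw 1 ltr01.
  apply: (absum_le (absumD (absumZ 1 (aw k)) (absumZ C av))) => n.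
  by rewrite ger0_norm //; case: (hC k n).
exists (fun k => tsum (h k)); last first.
  move=> k; rewrite /psum -(tsumD (aw k) av) -(tsumD (absumD (aw k) av) (ah k)).
  apply: tsum_le; first exact: absum_psum.
    by apply: absumD => //; exact: absumD.
  move=> n; have : modulus (u k n) `^ p - modulus (w k n) `^ p - modulus (v n) `^ p <= h k n.
    by rewrite le_max lexx orbT.
  rewrite -/(w k); lra.
have M0 : 0 <= M.
  have [k _] := filter_ex (@filterT _ F _).
  exact: le_trans (addr_ge0 (ip_ge0 _) (ip_ge0 _)) (uM k).
pose N := 2 * M + 2 * norm2 v.
have wN k : norm2 (w k) <= N.
  apply: le_trans (norm2_cdiff_le (eu k) ev) _.
  by rewrite lerD2r ler_pM2l.
have N0 : 0 <= N.
  have [k _] := filter_ex (@filterT _ F _).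
  exact: le_trans (addr_ge0 (ip_ge0 _) (ip_ge0 _)) (wN k).
rewrite -(@tsum0 R (lattice d)).
apply: (@tsum_cvg _ _ _ F h (fun k n => modulus (w k n) `^ p) _
   (Num.sqrt N `^ (p - 2) * N)) => //.
- move=> n; apply/cvgrPdist_le => /= e e0.
  pose e1 := e / 2 / (modulus (v n) `^ p + 1).
  have v1 : 0 < modulus (v n) `^ p + 1 by rewrite ltr_wpDl ?powR_ge0.
  have e1_gt0 : 0 < e1 by rewrite !divr_gt0.
  have [C C0 hC] := hw e1 e1_gt0.
  have C1 : 0 < C + 1 by rewrite ltr_wpDl.
  have d0 : 0 < Num.min 1 (e / 2 / (C + 1)) by rewrite lt_min ltr01 !divr_gt0.
  have /cvgrPdist_le /(_ _ d0) := w0 n; apply: filterS => k.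
  rewrite !sub0r !normrN !ger0_norm ?modulus_ge0 // le_min => /andP[wk1 wk2].
  have [_ le] := hC k n; apply: le_trans le _.
  have wp : modulus (w k n) `^ p <= modulus (w k n).
    have := modulus_ge0 (w k n); rewrite le_eqVlt => /predU1P[<-|wpos].
      by rewrite powR0 // gt_eqF.
    by apply: ge1r_powR; [rewrite wpos|lra].
  have k1 : e1 * modulus (v n) `^ p <= e / 2.
    rewrite -[leRHS](divfK (lt0r_neq0 v1)) -/e1 ler_pM2l //; lra.
  have k2 : C * modulus (w k n) `^ p <= e / 2.
    apply: (@le_trans _ _ ((C + 1) * modulus (w k n))).
      by rewrite ler_pM ?powR_ge0 //; lra.
    by rewrite mulrC -ler_pdivlMr.
  lra.
- exact: absum0.
- by move=> k n; exact: powR_ge0.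
- move=> k; apply: le_trans (psum_le_norm2 p2 (ew k)) _.
  apply: ler_pM; rewrite ?powR_ge0 //; first exact: addr_ge0 (ip_ge0 _) (ip_ge0 _).
  by apply: ge0_ler_powR; rewrite ?nnegrE ?sqrtr_ge0 ?ler_wsqrtr //; lra.
- move=> e e0; have [C C0 hC] := hw e e0.
  exists (fun n => C * modulus (v n) `^ p); split; first exact: absumZ.
  by move=> k n; rewrite subr0 ger0_norm //; case: (hC k n).
Qed.

End BrezisLieb.

Section Compactness.
Context {R : realType} {d : nat}.
Variables (sigma omega : R).
Hypotheses (sigma0 : 0 < sigma) (omega0 : 0 < omega).
Local Notation p := (2 * sigma + 2).
Local Notation j := (min_energy d sigma omega).

Let p2 : 2 <= p. Proof. by rewrite lerDr mulr_ge0 // ltW. Qed.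
Let p0 : 0 < p. Proof. exact: lt_le_trans p2. Qed.

(** The concentration-compactness step: once vanishing is excluded by a nonzero
    pointwise limit, strict concavity of [x `^ (2 / p)] excludes dichotomy. *)
Lemma minimizing_limit {I : Type} (F : set_system I) (u : I -> lattice d -> R[i])
    (v : lattice d -> R[i]) (M : R) : ProperFilter F ->
  (forall k, admissible sigma (u k)) -> (forall k, norm2 (u k) <= M) ->
  energy omega (u k) @[k --> F] --> j ->
  (forall n, re (u k) n @[k --> F] --> re v n) ->
  (forall n, im (u k) n @[k --> F] --> im v n) ->
  (exists n, v n <> 0) ->
  is_minimizer sigma omega v /\ norm2 (cdiff (u k) v) @[k --> F] --> 0.
Proof.
move=> FF au uM uj cr ci [n0 vn0].
have eu k : ell2 (u k) by case: (au k).
have u1 k : psum p (u k) = 1 by have /(admissibleP sigma0)[] := au k.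
have sr k : sqsum (re (u k)) by have /ell2_ReIm[] := eu k.
have si k : sqsum (im (u k)) by have /ell2_ReIm[] := eu k.
have rM k : ip (re (u k)) (re (u k)) <= M.
  by apply: le_trans (uM k); rewrite lerDl ip_ge0.
have iM k : ip (im (u k)) (im (u k)) <= M.
  by apply: le_trans (uM k); rewrite lerDr ip_ge0.
have [srv _] := ip_fatou FF sr rM cr; have [siv _] := ip_fatou FF si iM ci.
have ev : ell2 v by apply/ell2_ReIm.
have ew k : ell2 (cdiff (u k) v) by exact: ell2_cdiff.
have w0 n : modulus (cdiff (u k) v n) @[k --> F] --> 0.
  apply: (@squeeze_cvgr _ _ _ _ (fun=> 0)
    (fun k => `|re (u k) n - re v n| + `|im (u k) n - im v n|)).
  - apply: nearW => k; rewrite modulus_ge0 /= (le_trans (modulus_le_ReIm _)) //.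
    by rewrite /cdiff /re /im; case: (u k n) (v n) => [? ?] [? ?].
  - exact: cvg_cst.
  - rewrite -[X in _ --> X]addr0 -(normr0 R); apply: cvgD.
      apply: cvg_norm; rewrite -[X in _ --> X](subrr (re v n)).
      by apply: cvgB => //; exact: cvg_cst.
    apply: cvg_norm; rewrite -[X in _ --> X](subrr (im v n)).
    by apply: cvgB => //; exact: cvg_cst.
have [r r0 ur] := psum_brezis_lieb FF p2 eu ev uM w0.
have cE : energy omega (cdiff (u k) v) @[k --> F] --> j - energy omega v.
  rewrite (_ : (fun k => _) = fun k => energy omega (u k) -
     ((renergy omega (re (u k)) - renergy omega (axpy (re (u k)) (- 1) (re v))) +
      (renergy omega (im (u k)) - renergy omega (axpy (im (u k)) (- 1) (im v))))).
    apply: cvgB => //; rewrite (energyE omega ev).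
    by apply: cvgD; [exact: renergy_splitting rM cr|exact: renergy_splitting iM ci].
  apply/funext => k; rewrite !energyE // re_cdiff im_cdiff; ring.
have j0 := @min_energy_gt0 R d _ _ sigma0 omega0.
have t01 : 0 < 2 / p < 1.
  by rewrite divr_gt0 //= ltr_pdivrMr // mul1r ltrDr mulr_gt0.
have Ev := min_energy_homogeneous sigma0 omega0 ev.
have a0 : 0 < psum p v.
  apply: lt_le_trans (tsum_ge1 n0 (fun n => powR_ge0 _ p) (absum_psum p2 ev)).
  apply: powR_gt0; rewrite lt_def modulus_ge0 andbT.
  by apply/eqP => /modulus_eq0.
have Evj : energy omega v <= j.
  rewrite -subr_ge0; apply: (cvgr_to_ge cE); apply: nearW => k.
  exact: energy_ge0.
(* A value above 1 contradicts [J v <= j]; for a value [a < 1] the remaining mass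
   [1 - a] would cost at least [j (1 - a)] and [v] itself more than [j a]. *)
have v1 : psum p v = 1.
  apply/eqP; rewrite eq_le; apply/andP; split.
    rewrite leNgt; apply/negP => v1.
    have : 1 < psum p v `^ (2 / p).
      have /andP[t0 _] := t01.
      have := @gt0_ltr_powR R _ t0 1 (psum p v); rewrite powR1; apply => //;
      by rewrite nnegrE ?ler01 ?psum_ge0.
    have := le_trans Ev Evj; rewrite ger_pMr // => le1 /lt_le_trans /(_ le1).
    by rewrite ltxx.
  rewrite leNgt; apply/negP => v1.
  have va : psum p v < psum p v `^ (2 / p) by rewrite powR_gt_self ?a0 ?v1.
  suff : energy omega v <= j * psum p v.
    by move=> /(le_trans Ev); rewrite ler_pM2l // leNgt va.
  have lim : j * (1 - psum p v - r k) @[k --> F] --> j * (1 - psum p v - 0).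
    apply: cvgM; first exact: cvg_cst.
    by apply: cvgB => //; exact: cvg_cst.
  suff : j * (1 - psum p v - 0) <= j - energy omega v by lra.
  rewrite -subr_ge0; apply: (cvgr_to_ge (cvgB cE lim)).
  have rn : \forall k \near F, `|0 - r k| < psum p v by move/cvgrPdist_lt: r0; apply.
  apply: filterS rn => k; rewrite sub0r normrN subr_ge0 => rk.
  have {}rk : - r k < psum p v by rewrite (le_lt_trans _ rk) // -normrN ler_norm.
  have [bk|bk] := leP (1 - psum p v - r k) 0.
    by apply: le_trans (energy_ge0 omega0 (ew k)); rewrite mulr_ge0_le0 // ltW.
  apply: le_trans (min_energy_homogeneous sigma0 omega0 (ew k)).
  apply: ler_wpM2l; first exact: ltW.
  have bk1 : 1 - psum p v - r k < 1 by lra.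
  apply: (@le_trans _ _ ((1 - psum p v - r k) `^ (2 / p))).
    by rewrite ltW // powR_gt_self ?bk ?bk1.
  have /andP[t_gt0 _] := t01.
  apply: ge0_ler_powR; [exact: ltW|by rewrite nnegrE ltW|by rewrite nnegrE psum_ge0|].
  have := ur k; rewrite u1; lra.
have av : admissible sigma v by apply/admissibleP.
have EvE : energy omega v = j.
  by apply/eqP; rewrite eq_le Evj min_energy_le.
split; first exact/is_minimizerP.
rewrite EvE subrr in cE.
apply: (@squeeze_cvgr _ _ _ _ (fun=> 0) (fun k => omega^-1 * energy omega (cdiff (u k) v))).
- apply: nearW => k; rewrite norm2_ge0 /= mulrC ler_pdivlMr // mulrC.
  exact: energy_ge.
- exact: cvg_cst.
- by rewrite -(mulr0 omega^-1); apply: cvgM => //; exact: cvg_cst.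
Qed.

End Compactness.

(** * Compactness of minimizing sequences *)

Section Translations.
Context {R : realType} {d : nat}.
Variables (sigma omega : R).
Hypotheses (sigma0 : 0 < sigma) (omega0 : 0 < omega).
Implicit Types (u v : lattice d -> R[i]) (y : lattice d).
Local Notation p := (2 * sigma + 2).
Local Notation j := (min_energy d sigma omega).

Let p2 : 2 <= p. Proof. by rewrite lerDr mulr_ge0 // ltW. Qed.

Lemma ell2_translate y u : ell2 u -> ell2 (translate y u).
Proof. by move=> /ell2P eu; apply/ell2P; exact: (absum_translate y eu). Qed.

Lemma norm2_translate y u : norm2 (translate y u) = norm2 u.
Proof.
by congr (_ + _); [exact: (ip_translate (re u) (re u))|exact: (ip_translate (im u) (im u))].
Qed.

Lemma psum_translate y u : psum p (translate y u) = psum p u.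
Proof. exact: (tsum_translate (fun n => modulus (u n) `^ p)). Qed.

Lemma renergy_translate y (f : lattice d -> R) :
  renergy omega (translate y f) = renergy omega f.
Proof.
have E : helmholtz omega (translate y f) = translate y (helmholtz omega f).
  apply/funext => n; rewrite [RHS]/translate /helmholtz !disc_laplacianE /translate.
  by congr (- (_ - _) + _); apply: eq_bigr => a _; rewrite addrAC.
by rewrite /renergy E; exact: ip_translate.
Qed.

Lemma energy_translate y u : ell2 u -> energy omega (translate y u) = energy omega u.
Proof.
move=> eu; rewrite (energyE _ eu) (energyE _ (ell2_translate y eu)).
by congr (_ + _); [exact: (renergy_translate y (re u))|exact: (renergy_translate y (im u))].
Qed.

Lemma admissible_translate y u : admissible sigma u -> admissible sigma (translate y u).
Proof.
move=> /(admissibleP sigma0)[eu u1]; apply/(admissibleP sigma0).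
by split; [exact: ell2_translate|rewrite psum_translate].
Qed.

(** Excludes vanishing. *)
Lemma admissible_large_entry (M : R) : exists2 c : R, 0 < c &
  forall u, admissible sigma u -> norm2 u <= M -> exists y, c <= modulus (u y).
Proof.
(* If all entries were below [c], the constraint would be at most
   [c `^ (p - 2) * M <= 1 / 2]. *)
pose c := (2 * (`|M| + 1))^-1 `^ (p - 2)^-1.
have M0 : 0 < 2 * (`|M| + 1) by rewrite mulr_gt0 // ltr_wpDl.
have c0 : 0 < c by rewrite powR_gt0 // invr_gt0.
exists c => // u au uM; apply: contrapT => /forallNP small.
have [eu u1] := (admissibleP sigma0 u).1 au.
have uc n : modulus (u n) <= c by rewrite leNgt; apply/negP => /ltW; exact: small.
have [_] := psum_bounded p2 eu uc; rewrite u1 /c -powRrM mulVf; last first.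
  by have := sigma0; rewrite addrK mulf_eq0 pnatr_eq0 /= => /gt_eqF ->.
rewrite powRr1 ?invr_ge0 ?(ltW M0) // mulrC ler_pdivlMr // mul1r.
have := ler_norm M; lra.
Qed.

Lemma ultralimit_field {I : Type} (U : set_system I) (u : I -> lattice d -> R[i])
    (M : R) : UltraFilter U -> (forall k, ell2 (u k)) ->
  (forall k, norm2 (u k) <= M) ->
  exists v : lattice d -> R[i], (forall n, re (u k) n @[k --> U] --> re v n) /\
    (forall n, im (u k) n @[k --> U] --> im v n).
Proof.
move=> UU eu uM.
have bnd k n : modulus (u k n) <= Num.sqrt M.
  by rewrite (le_trans (modulus_le_norm n (eu k))) // ler_wsqrtr.
have mre (z : R[i]) : `|complex.Re z| <= modulus z.
  rewrite -(@ler_pXn2r _ 2) ?nnegrE ?modulus_ge0 // modulus_sqr.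
  by rewrite real_normK ?num_real // lerDl sqr_ge0.
have mim (z : R[i]) : `|complex.Im z| <= modulus z.
  rewrite -(@ler_pXn2r _ 2) ?nnegrE ?modulus_ge0 // modulus_sqr.
  by rewrite real_normK ?num_real // lerDr sqr_ge0.
have Ha n : exists l : R, re (u k) n @[k --> U] --> l.
  by apply: (@bounded_ultralimit _ _ _ _ (Num.sqrt M)) => k; exact: le_trans (mre _) (bnd k n).
have Hb n : exists l : R, im (u k) n @[k --> U] --> l.
  by apply: (@bounded_ultralimit _ _ _ _ (Num.sqrt M)) => k; exact: le_trans (mim _) (bnd k n).
have [a ha] := choice Ha; have [b hb] := choice Hb.
by exists (fun n => Complex (a n) (b n)).
Qed.

(** The translations bring a large entry to the origin, so that the pointwise
    limit is not zero. *)
Lemma minimizing_converges {I : Type} (U : set_system I) (u : I -> lattice d -> R[i])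
    (M : R) : UltraFilter U ->
  (forall k, admissible sigma (u k)) -> (forall k, norm2 (u k) <= M) ->
  energy omega (u k) @[k --> U] --> j ->
  exists (y : I -> lattice d) (v : lattice d -> R[i]),
    is_minimizer sigma omega v /\
    norm2 (cdiff (translate (y k) (u k)) v) @[k --> U] --> 0.
Proof.
move=> UU au uM uj; have [c c0 hc] := admissible_large_entry M.
have [y hy] := choice (fun k => hc (u k) (au k) (uM k)).
pose w k := translate (y k) (u k).
have aw k : admissible sigma (w k) by exact: admissible_translate.
have ew k : ell2 (w k) by case: (aw k).
have wM k : norm2 (w k) <= M by rewrite norm2_translate.
have [v [vr vi]] := ultralimit_field UU ew wM.
have wE : (fun k => energy omega (w k)) = fun k => energy omega (u k).
  by apply/funext => k; apply: energy_translate; case: (au k).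
have wj : energy omega (w k) @[k --> U] --> j by rewrite wE.
suff nz : exists n, v n <> 0.
  by exists y, v; exact: (minimizing_limit sigma0 omega0 _ aw wM wj vr vi nz).
exists 0 => v0.
have : c <= `|re v 0| + `|im v 0|.
  have lim : `|re (w k) 0| + `|im (w k) 0| @[k --> U] --> `|re v 0| + `|im v 0|.
    by apply: cvgD; apply: cvg_norm.
  apply: (cvgr_to_ge lim); apply: nearW => k.
  apply: le_trans (modulus_le_ReIm _); rewrite /w /translate add0r; exact: hy.
by rewrite /re /im v0 /= normr0 addr0 leNgt c0.
Qed.

Lemma minimizing_norm2_bounded (u : nat -> lattice d -> R[i]) :
  (forall k, ell2 (u k)) -> energy omega (u k) @[k --> \oo] --> j ->
  exists M, forall k, norm2 (u k) <= M.
Proof.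
move=> eu uj; have [M [_ hM]] := cvg_seq_bounded (cvgP _ uj).
exists (omega^-1 * (M + 1)) => k; rewrite mulrC ler_pdivlMr // mulrC.
apply: le_trans (energy_ge _ (eu k)) _; rewrite (le_trans (ler_norm _)) //.
by apply: (hM (M + 1)) => //; rewrite ltrDl.
Qed.

Lemma minimizer_exists : exists v : lattice d -> R[i], is_minimizer sigma omega v.
Proof.
have [u [au uj]] := @minimizing_exists R d _ _ sigma0 omega0.
have eu k : ell2 (u k) by case: (au k).
have [M uM] := minimizing_norm2_bounded eu uj.
have [U [UU oU]] := @ultraFilterLemma _ (\oo : set_system nat) _.
have [y [v [mv _]]] := minimizing_converges UU au uM (cvg_trans (cvg_app _ oU) uj).
by exists v.
Qed.

(** Every set of the ultrafilter is infinite, so a subsequence can be picked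
    whose distance to the limit is below [1 / (m + 1)] at step [m]. *)
Lemma minimizing_sequence_compact (u : nat -> lattice d -> R[i]) :
  minimizing_sequence sigma omega u ->
  exists (phi : nat -> nat) (y : nat -> lattice d) (v : lattice d -> R[i]),
    [/\ {homo phi : m n / (m < n)%N >-> (m < n)%N},
        is_minimizer sigma omega v
      & lp_norm 2 (fun n => translate (y k) (u (phi k)) n - v n)
          @[k --> \oo] --> 0%E].
Proof.
move=> [u1 uj].
have eu k : ell2 (u k) by case: (u1 k).
have au k : admissible sigma (u k).
  apply/admissibleP => //; split => //.
  have [_] := u1 k; rewrite /lp_norm lp_sum_psum // poweR_EFin => -[/eqP].
  have pn : p^-1 != 0 by rewrite invr_eq0 gt_eqF // (lt_le_trans _ p2).
  by rewrite powR_eq1 (negbTE pn) orbF ltNge psum_ge0 orbF => /eqP.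
have [M uM] := minimizing_norm2_bounded eu uj.
have [U [UU oU]] := @ultraFilterLemma _ (\oo : set_system nat) _.
have [y [v [mv cv]]] := minimizing_converges UU au uM (cvg_trans (cvg_app _ oU) uj).
have ev : ell2 v by case: mv => -[].
have pick (mK : nat * nat) : exists k : nat, (mK.2 < k)%N /\
    norm2 (cdiff (translate (y k) (u k)) v) < (mK.1.+1%:R^-1) ^+ 2.
  have e0 : 0 < (mK.1.+1%:R^-1) ^+ 2 :> R by rewrite exprn_gt0 // invr_gt0.
  have sm : \forall k \near U, norm2 (cdiff (translate (y k) (u k)) v) < (mK.1.+1%:R^-1) ^+ 2.
    move/cvgrPdist_lt: cv => /(_ _ e0); apply: filterS => k.
    by rewrite sub0r normrN ger0_norm // norm2_ge0.
  have lg : \forall k \near U, (mK.2 < k)%N by apply: oU; exact: nbhs_infty_gt.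
  by have [k [? ?]] := filter_ex (filterI lg sm); exists k.
have [g hg] := choice pick.
pose fix phi m := if m is m'.+1 then g (m, phi m') else g (0%N, 0%N).
exists phi, (fun k => y (phi k)), v; split => //.
  by apply: homo_ltn => [? ? ?|m]; [exact: ltn_trans|case: (hg (m.+1, phi m))].
have small m : norm2 (cdiff (translate (y (phi m)) (u (phi m))) v) < m.+1%:R^-1 ^+ 2.
  by case: m => [|m]; [case: (hg (0%N, 0%N))|case: (hg (m.+1, phi m))].
have E m : lp_norm 2 (fun n => translate (y (phi m)) (u (phi m)) n - v n) =
    (Num.sqrt (norm2 (cdiff (translate (y (phi m)) (u (phi m))) v)))%:E.
  rewrite /lp_norm lp_sum2_norm2; last first.
    by apply: (@ell2_cdiff _ _ (translate (y (phi m)) (u (phi m))) v) => //; exact: ell2_translate.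
  by rewrite poweR_EFin powR12_sqrt // norm2_ge0.
under eq_fun do rewrite E.
apply: cvg_EFin; first exact: nearW.
apply: (@squeeze_cvgr _ _ _ _ (fun=> 0) (fun m => m.+1%:R^-1)).
- apply: nearW => m; rewrite sqrtr_ge0 /=.
  rewrite -[leRHS]ger0_norm ?invr_ge0 // -sqrtr_sqr ler_wsqrtr // ltW //.
- exact: cvg_cst.
- exact: cvg_harmonic.
Qed.

End Translations.

(** * First and second variation at a minimizer *)

Section Variations.
Context {R : realType} {d : nat}.
Variables (sigma omega : R).
Hypotheses (sigma0 : 0 < sigma) (omega0 : 0 < omega).
Implicit Types (f h u : lattice d -> R).
Local Notation p := (2 * sigma + 2).
Local Notation j := (min_energy d sigma omega).

Let p2 : 2 <= p. Proof. by rewrite lerDr mulr_ge0 // ltW. Qed.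
Let p0 : 0 < p. Proof. exact: lt_le_trans p2. Qed.
Let p1 : 1 < p. Proof. by apply: lt_le_trans p2; rewrite ltr1n. Qed.

Definition rpsum f : R := tsum (fun n => `|f n| `^ p).

Lemma psum_real f : psum p (fun n => (f n)%:C) = rpsum f.
Proof. by rewrite /psum /rpsum; under eq_fun do rewrite modulus_real. Qed.

Lemma absum_rpsum f : sqsum f -> absum (fun n => `|f n| `^ p).
Proof.
move=> sf; have := absum_psum p2 ((ell2_real f).2 sf).
by under eq_fun do rewrite modulus_real.
Qed.

Lemma renergy_homogeneous f : sqsum f ->
  j * rpsum f `^ (2 / p) <= renergy omega f.
Proof.
move=> sf; rewrite -psum_real -energy_real //.
exact/min_energy_homogeneous/ell2_real.
Qed.

Definition ground_state u : Prop :=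
  [/\ sqsum u, rpsum u = 1, renergy omega u = j & forall n, 0 <= u n].

Lemma ground_stateP u : ground_state u <->
  is_minimizer sigma omega (fun n => (u n)%:C) /\ forall n, 0 <= u n.
Proof.
split=> [[su u1 uj u0]|[/(is_minimizerP sigma0 omega0)[/(admissibleP sigma0)[/ell2_real su u1] uj] u0]].
  split => //; apply/(is_minimizerP sigma0 omega0); rewrite energy_real //; split => //.
  by apply/(admissibleP sigma0); rewrite psum_real; split => //; apply/ell2_real.
by split => //; [rewrite -psum_real|rewrite -energy_real].
Qed.

Variable u : lattice d -> R.
Hypothesis gu : ground_state u.

Let su : sqsum u. Proof. by case: gu. Qed.
Let u1 : rpsum u = 1. Proof. by case: gu. Qed.
Let uj : renergy omega u = j. Proof. by case: gu. Qed.
Let u0 n : 0 <= u n. Proof. by case: gu. Qed.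
Let j0 : 0 < j. Proof. exact: min_energy_gt0. Qed.

(** [u^(p - 1)], the gradient of the constraint up to the factor [p]. *)
Definition nonlinearity : lattice d -> R := fun n => u n `^ (2 * sigma + 1).

Lemma ground_state_le1 n : u n <= 1.
Proof.
rewrite leNgt; apply/negP => un.
have := tsum_ge1 n (fun n => powR_ge0 `|u n| p) (absum_rpsum su).
rewrite -/(rpsum u) u1 leNgt ger0_norm // => /negP; apply.
have := @gt0_ltr_powR R p p0 1 (u n); rewrite powR1.
by apply; rewrite // nnegrE ?ler01.
Qed.

Lemma sqsum_nonlinearity : sqsum nonlinearity.
Proof.
apply: (sqsum_le su) => n; rewrite !ger0_norm ?powR_ge0 // /nonlinearity.
have := u0 n; rewrite le_eqVlt => /predU1P[<-|un].
  by rewrite powR0 // gt_eqF // ltr_wpDl // mulr_ge0 // ltW.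
by apply: ge1r_powR; rewrite ?un ?ground_state_le1 // lerDr mulr_ge0 // ltW.
Qed.

Lemma ip_nonlinearity : ip nonlinearity u = 1.
Proof.
apply: etrans u1; congr tsum; apply/funext => n; rewrite /nonlinearity ger0_norm // mulrC.
have -> : 2 * sigma + 1 = p - 1 by ring.
exact: mulr_powRB1.
Qed.

(** Collects pointwise lower bounds of [|u + t h|^p] that are tangential
    everywhere and have an extra term [c] on a finite set only; the finiteness of
    that set makes the second-order remainders uniform. *)
Lemma rpsum_axpy_ge h t D (X : {fset lattice d}) (c : lattice d -> R) :
  sqsum h -> D = \sum_(x <- X) c x ->
  (forall n, u n `^ p + p * nonlinearity n * (t * h n) + (if n \in X then c n else 0)
     <= `|u n + t * h n| `^ p) ->
  1 + p * t * ip nonlinearity h + D <= rpsum (axpy u t h).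
Proof.
move=> sh -> le; have [a3 s3] := @tsum_fset_support R _ (fun n => if n \in X then c n else 0) X
  (fun n nX => ifN _ _ nX).
have a1 : absum (fun n => u n `^ p).
  apply: (absum_le (absum_rpsum su)) => n.
  by rewrite ger0_norm ?powR_ge0 // (ger0_norm (u0 n)) lexx.
have a2 : absum (fun n => p * t * (nonlinearity n * h n)).
  exact/absumZ/absum_ip/sh/sqsum_nonlinearity.
have E1 : tsum (fun n => u n `^ p) = 1.
  by apply: etrans u1; congr tsum; apply/funext => n; rewrite ger0_norm.
have -> : \sum_(x <- X) c x = \sum_(x <- X) if x \in X then c x else 0.
  by rewrite big_seq [RHS]big_seq; apply: eq_bigr => x ->.
rewrite -s3 /ip -(tsumZ (p * t) (absum_ip sqsum_nonlinearity sh)) -[X in X + _ + _]E1 -(tsumD a1 a2).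
rewrite -(tsumD (absumD a1 a2) a3); apply: tsum_le.
- exact: absumD (absumD a1 a2) a3.
- exact/absum_rpsum/sqsum_axpy.
- move=> n; have -> : p * t * (nonlinearity n * h n) = p * nonlinearity n * (t * h n) by ring.
  exact: le.
Qed.

Lemma rpsum_tangent h t : sqsum h -> 1 + p * t * ip nonlinearity h <= rpsum (axpy u t h).
Proof.
move=> sh; rewrite -[leLHS]addr0.
apply: (@rpsum_axpy_ge h t 0 fset0 (fun=> 0)) => // [|n].
  by rewrite big_seq_fset0.
rewrite in_fset0 addr0; have := powR_convex_tangent (u n + t * h n) p1 (u0 n).
have -> : u n + t * h n - u n = t * h n by ring.
by have -> : p - 1 = 2 * sigma + 1 by ring.
Qed.

(** Compares coefficients of [t] in the homogeneous inequality for [u + t h],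
    an equality at [t = 0]. *)
Lemma first_variation h : sqsum h -> ip (helmholtz omega u) h = j * ip nonlinearity h.
Proof.
move=> sh; set s := ip nonlinearity h; set b := ip _ h.
have ps : 0 < 2 * (p * `|s| + 1) by rewrite mulr_gt0 // ltr_wpDl // mulr_ge0 // ltW.
suff : 2 * (b - j * s) = 0 by move=> /eqP; rewrite mulf_eq0 pnatr_eq0 /= subr_eq0 => /eqP.
apply: (@linear_coef_eq0 _ _ (renergy omega h + j * (p * s) ^+ 2) (2 * (p * `|s| + 1))^-1).
  by rewrite invr_gt0.
move=> t tps; set x := p * t * s.
have xle : `|x| <= 2^-1.
  rewrite /x !normrM (ger0_norm (ltW p0)).
  move: tps; rewrite -(@ler_pM2r _ (2 * (p * `|s| + 1))) // mulVf ?gt_eqF //.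
  have := normr_ge0 t; lra.
have G1 : 1 + x <= rpsum (axpy u t h) by exact: rpsum_tangent.
have x1 : 0 <= 1 + x by move: xle; rewrite ler_norml => /andP[]; lra.
have t01 : 0 < 2 / p <= 1 by rewrite divr_gt0 //= ler_pdivrMr // mul1r.
have := renergy_homogeneous (sqsum_axpy t su sh).
rewrite renergy_axpy // uj -/b => le.
have le2 : j * (1 + 2 / p * x - x ^+ 2) <= j * rpsum (axpy u t h) `^ (2 / p).
  apply: ler_wpM2l; first exact: ltW.
  apply: le_trans (powR_ge_quadratic t01 xle) _.
  apply: ge0_ler_powR; rewrite ?nnegrE //; first by case/andP: t01 => /ltW.
  exact: le_trans G1.
have := le_trans le2 le.
have -> : 2 / p * x = 2 * t * s by rewrite /x; field; rewrite gt_eqF.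
rewrite /x; nra.
Qed.

Lemma ground_state_euler_lagrange : euler_lagrange sigma omega u.
Proof.
move=> n; have := first_variation (sqsum_dirac n).
by rewrite !ip_dirac => /eqP; rewrite -subr_eq0 => /eqP.
Qed.

(** At a zero of [u] the Euler-Lagrange equation says that the sum of the
    neighbouring values is 0, so [u] vanishes at the neighbours as well. *)
Lemma ground_state_gt0 n : 0 < u n.
Proof.
rewrite lt_def u0 andbT; apply/eqP => un.
have all0 : forall m, u m = 0.
  apply: (@lattice_connected _ (fun m => u m = 0) n) => // m a um.
  have := ground_state_euler_lagrange m; rewrite disc_laplacianE um mul0rn subr0.
  rewrite mulr0 addr0 powR0; last by rewrite gt_eqF // ltr_wpDl // mulr_ge0 // ltW.
  rewrite mulr0 subr0 => /eqP; rewrite oppr_eq0 psumr_eq0 // => /allP /(_ a).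
  by rewrite mem_index_enum => /(_ isT) /eqP.
have := u1; rewrite /rpsum (_ : (fun n => _) = fun=> 0) ?tsum0 => [/eqP|].
  by rewrite eq_sym oner_eq0.
by apply/funext => m; rewrite all0 normr0 powR0 // gt_eqF.
Qed.

(** [u^(p - 2)], the potential of the linearized operator up to a constant. *)
Definition potential : lattice d -> R := fun n => u n `^ (2 * sigma).

(** The second-order expansion is used on [X], where [e] absorbs the remainder, and
    the tangent elsewhere. *)
Let second_variation_fset h (X : {fset lattice d}) (e : R) :
  sqsum h -> ip nonlinearity h = 0 -> 0 < e ->
  j * (2 / p) * (\sum_(x <- X) (p * (p - 1) / 2 * potential x - e) * h x ^+ 2) <= renergy omega h.
Proof.
move=> sh h0 e0.
have [dl dl0 hdl] : exists2 dl : R, 0 < dl & forall x t, x \in X -> `|t| <= dl ->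
    u x `^ p + p * nonlinearity x * (t * h x)
      + (p * (p - 1) / 2 * potential x - e) * (t * h x) ^+ 2 <= `|u x + t * h x| `^ p.
  have loc x : exists2 dl : R, 0 < dl & forall t, `|t| <= dl ->
    u x `^ p + p * nonlinearity x * (t * h x)
      + (p * (p - 1) / 2 * potential x - e) * (t * h x) ^+ 2 <= `|u x + t * h x| `^ p.
    have [dl dl0 H] := powR_taylor2 p2 (ground_state_gt0 x) e0.
    have hx : 0 < `|h x| + 1 by rewrite ltr_wpDl.
    exists (dl / (`|h x| + 1)) => [|t tle]; first by rewrite divr_gt0.
    have := H (t * h x); have -> : p - 1 = 2 * sigma + 1 by ring.
    have -> : p - 2 = 2 * sigma by ring.
    apply; rewrite normrM; move: tle; rewrite ler_pdivlMr //.
    by apply: le_trans; rewrite ler_wpM2l // lerDl.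
  have [D hD] := choice (fun x => let: ex_intro2 a b c := loc x in ex_intro (fun a => 0 < a /\
     forall t, `|t| <= a -> u x `^ p + p * nonlinearity x * (t * h x)
      + (p * (p - 1) / 2 * potential x - e) * (t * h x) ^+ 2 <= `|u x + t * h x| `^ p) a (conj b c)).
  exists (\big[Num.min/1]_(x <- X) D x).
    elim: (enum_fset X) => [|x r ih]; first by rewrite big_nil.
    by rewrite big_cons lt_min ih andbT; case: (hD x).
  move=> x t xX tle; have [_] := hD x; apply; apply: le_trans tle _.
  have : x \in enum_fset X by [].
  elim: (enum_fset X) => [//|y r ih]; rewrite inE big_cons => /predU1P[->|/ih le].
    by rewrite ge_min lexx.
  by rewrite ge_min le orbT.
set D := \sum_(x <- X) _.
have D1 : 0 < `|D| + 1 by rewrite ltr_wpDl.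
pose e1 := Num.min 1 (Num.min dl (2 * (`|D| + 1))^-1).
have e10 : 0 < e1 by rewrite !lt_min ltr01 dl0 invr_gt0 mulr_gt0.
apply: (le_of_small (c := j * D ^+ 2) e10) => t /andP[t0].
rewrite !le_min => /andP[t1 /andP[tdl tD]].
have tD2 : t * `|D| <= 2^-1.
  have K0 : 0 < 2 * (`|D| + 1) by rewrite mulr_gt0.
  have tK : t * (2 * (`|D| + 1)) <= 1 by rewrite -ler_pdivlMr // mul1r.
  have := normr_ge0 D; nra.
set x := t ^+ 2 * D.
have xle : `|x| <= 2^-1.
  rewrite /x normrM ger0_norm ?sqr_ge0 //; apply: le_trans tD2.
  by rewrite ler_wpM2r // expr2 ler_piMl // ltW.
have G1 : 1 + x <= rpsum (axpy u t h).
  have := @rpsum_axpy_ge h t x X (fun x => (p * (p - 1) / 2 * potential x - e) * (t * h x) ^+ 2) sh.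
  rewrite h0 mulr0 addr0; apply.
    by rewrite /x /D mulr_sumr; apply: eq_bigr => y _; rewrite exprMn; ring.
  move=> n; case: ifPn => nX; first by apply: hdl => //; rewrite gtr0_norm.
  rewrite addr0; have := powR_convex_tangent (u n + t * h n) p1 (u0 n).
  have -> : u n + t * h n - u n = t * h n by ring.
  by have -> : p - 1 = 2 * sigma + 1 by ring.
have x1 : 0 <= 1 + x by move: xle; rewrite ler_norml => /andP[]; lra.
have t01 : 0 < 2 / p <= 1 by rewrite divr_gt0 //= ler_pdivrMr // mul1r.
have := renergy_homogeneous (sqsum_axpy t su sh).
rewrite renergy_axpy // uj first_variation // h0 !mulr0 addr0 => le.
have le2 : j * (1 + 2 / p * x - x ^+ 2) <= j * rpsum (axpy u t h) `^ (2 / p).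
  apply: ler_wpM2l; first exact: ltW.
  apply: le_trans (powR_ge_quadratic t01 xle) _.
  apply: ge0_ler_powR; rewrite ?nnegrE //; first by case/andP: t01 => /ltW.
  exact: le_trans G1.
have t2 : 0 < t ^+ 2 by rewrite exprn_gt0.
rewrite -(ler_pM2l t2).
have tt : t ^+ 2 * (j * D ^+ 2 * t ^+ 2) <= t ^+ 2 * (j * D ^+ 2 * t).
  apply: ler_wpM2l; first exact: ltW.
  apply: ler_wpM2l; first by rewrite mulr_ge0 ?sqr_ge0 // ltW.
  by rewrite expr2 ler_piMl // ltW.
have := le_trans le2 le; rewrite /x; lra.
Qed.

(** On the tangent space of the constraint the first-order terms drop out; the
    estimate on finite sets passes to the whole sum because its terms are
    nonnegative. *)
Lemma second_variation h : sqsum h -> ip nonlinearity h = 0 ->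
  (2 * sigma + 1) * j * tsum (fun n => potential n * h n ^+ 2) <= renergy omega h.
Proof.
move=> sh h0; have s1 : 0 < 2 * sigma + 1 by rewrite ltr_wpDl // mulr_ge0 // ltW.
have K0 : 0 < (2 * sigma + 1) * j by rewrite mulr_gt0.
rewrite mulrC -ler_pdivlMr //.
have [n|X|//] := @absum_bound R _ (fun n => potential n * h n ^+ 2)
  (renergy omega h / ((2 * sigma + 1) * j)).
  by rewrite mulr_ge0 ?powR_ge0 ?sqr_ge0.
rewrite ler_pdivlMr // mulrC.
apply: (@le_of_small _ _ _ (j * (2 / p) * \sum_(x <- X) h x ^+ 2) 1 ltr01) => e /andP[e0 _].
have := second_variation_fset X sh h0 e0.
have -> : \sum_(x <- X) (p * (p - 1) / 2 * potential x - e) * h x ^+ 2 =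
   p * (p - 1) / 2 * \sum_(x <- X) potential x * h x ^+ 2 - e * \sum_(x <- X) h x ^+ 2.
  by rewrite !mulr_sumr -sumrB; apply: eq_bigr => x _; ring.
rewrite -lerBlDr; apply: le_trans; rewrite le_eqVlt; apply/orP; left; apply/eqP.
by field; rewrite gt_eqF.
Qed.

End Variations.

(** * Unimodal sequences and reflections of the lattice *)

Section BellShape.
Context {R : realType}.

(** The plateau is the interval between the last points, to the right and to the
    left of 0, where the maximal value [w 0] is taken. *)
Lemma bell_shaped_of_unimodal (w : int -> R) (K : nat) :
  (forall k : nat, w k.+1%:Z <= w k%:Z) ->
  (forall k : nat, w (- k.+1%:Z) <= w (- k%:Z)) ->
  (forall k : nat, (K <= k)%N -> w k%:Z < w 0 /\ w (- k%:Z) < w 0) ->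
  bell_shaped w.
Proof.
have half (v : nat -> R) : (forall k, v k.+1 <= v k) ->
    (forall k, (K <= k)%N -> v k < v 0%N) ->
    exists r, (forall k, (k <= r)%N -> v k = v 0%N) /\ v r.+1 < v 0%N.
  move=> dec vK; pose P := [pred k | v k == v 0%N].
  have P0 : exists k, P k by exists 0%N; rewrite /= eqxx.
  have PK k : P k -> (k <= K)%N.
    by move=> /eqP vk; rewrite leqNgt; apply/negP => /ltnW /vK; rewrite vk ltxx.
  have vmono a b : (a <= b)%N -> v b <= v a.
    by move=> /subnK <-; elim: (b - a)%N => [|c ih] //; rewrite addSn (le_trans (dec _)).
  have [r /eqP vr rmax] := ex_maxnP P0 PK; exists r; split.
    by move=> k kr; apply/eqP; rewrite eq_le vmono //= -[leLHS]vr vmono.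
  rewrite lt_neqAle vmono // andbT; apply/negP => vr1.
  by have := rmax r.+1 vr1; rewrite ltnn.
move=> decr decl van.
have [r [r1 r2]] := half (fun k => w k%:Z) decr (fun k kK => (van k kK).1).
have [s [s1 s2]] := half (fun k => w (- k%:Z)) decl (fun k kK => (van k kK).2).
have eqr k : (k <= r)%N -> w k%:Z = w 0 by exact: r1.
have eqs k : (k <= s)%N -> w (- k%:Z) = w 0.
  by move=> /s1 ->; rewrite oppr0.
have s2' : w (- s.+1%:Z) < w 0 by move: s2; rewrite oppr0.
exists (- s%:Z), (r + s)%N; split.
- move=> i ile; rewrite (eqs s) //; have [si|si] := leqP i s.
    by rewrite (_ : - s%:Z + i%:Z = - (s - i)%N%:Z) ?eqs ?leq_subr //; lia.
  by rewrite (_ : - s%:Z + i%:Z = (i - s)%N%:Z) ?eqr //; lia.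
- rewrite (_ : - s%:Z + (r + s).+1%:Z = r.+1%:Z); last by lia.
  rewrite (_ : - s%:Z + (r + s)%N%:Z = r%:Z); last by lia.
  by rewrite (eqr r) //; exact: r2.
- move=> i ir; rewrite (_ : - s%:Z + i.+1%:Z = (i - s)%N.+1%:Z); last by lia.
  rewrite (_ : - s%:Z + i%:Z = (i - s)%N%:Z); last by lia.
  exact: decr.
- by rewrite (eqs s) // (_ : - s%:Z - 1 = - s.+1%:Z) //; lia.
- move=> i i0; rewrite (_ : - s%:Z - i.+1%:Z = - (s + i)%N.+1%:Z); last by lia.
  rewrite (_ : - s%:Z - i%:Z = - (s + i)%N%:Z); last by lia.
  exact: decl.
Qed.

End BellShape.

Section Reflections.
Context {d : nat}.
Implicit Types (n m : lattice d) (i : 'I_d) (c : bool).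

(** The reflection [l -> c - l] of the coordinate [i]; a boolean [c] suffices,
    because the reflections about 0 and about 1/2 generate the order
    0, 1, -1, 2, -2, ... *)
Definition reflect_at i c n : lattice d :=
  \row_k (if k == i then (c : nat)%:Z - n 0 k else n 0 k).

(** The points that come no later than their mirror image in the order
    0, 1, -1, 2, -2, ... of the coordinate [i]. *)
Definition preferred i c n : bool := if c then n 0 i <= 0 else 0 <= n 0 i.

Definition reflect_dir i (a : 'I_d * bool) : 'I_d * bool :=
  (a.1, if a.1 == i then ~~ a.2 else a.2).

Lemma reflect_dirK i : involutive (reflect_dir i).
Proof.
by case=> k s; rewrite /reflect_dir /=; case: eqP => // _; rewrite negbK.
Qed.

Lemma reflect_atK i c : involutive (reflect_at i c).
Proof.
move=> n; apply/rowP => k; rewrite !mxE; case: eqP => // _.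
by rewrite opprB addrC subrK.
Qed.

Lemma reflect_atE i c n k :
  reflect_at i c n 0 k = if k == i then (c : nat)%:Z - n 0 i else n 0 k.
Proof. by rewrite mxE; case: eqP => // ->. Qed.

Lemma add_dirE n a k : (n + dir a) 0 k = n 0 k + (-1) ^+ a.2 * (k == a.1)%:R.
Proof. by rewrite mxE dirE. Qed.

Lemma reflect_at_dir i c n a :
  reflect_at i c (n + dir a) = reflect_at i c n + dir (reflect_dir i a).
Proof.
apply/rowP => k; rewrite !(reflect_atE, add_dirE) /reflect_dir /=.
case: (eqVneq k i) => [->|ki].
  case: (eqVneq i a.1) => [_|ia]; last by rewrite !mulr0 !addr0.
  by rewrite signrN !mulr1 opprD addrA.
case: (eqVneq k a.1) => [ka|ka]; last by rewrite !mulr0.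
by rewrite -ka (negbTE ki).
Qed.

Lemma preferred_total i c n : preferred i c n || preferred i c (reflect_at i c n).
Proof. by rewrite /preferred !mxE eqxx; case: c; lia. Qed.

Lemma preferred_both i c n : preferred i c n -> preferred i c (reflect_at i c n) ->
  reflect_at i c n = n.
Proof.
rewrite /preferred !mxE eqxx; case: c => h1 h2; first by lia.
by apply/rowP => k; rewrite !mxE; case: eqP => // ->; lia.
Qed.

(** An edge that joins the two sides of the reflection [l -> 1 - l] joins a
    point to its own mirror image; for [l -> -l] no edge joins the two open sides,
    because the points with [l = 0] lie on both. *)
Lemma preferred_edge i c n a :
  [\/ preferred i c n /\ preferred i c (n + dir a),
      preferred i c (reflect_at i c n) /\ preferred i c (reflect_at i c (n + dir a))
    | n + dir a = reflect_at i c n].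
Proof.
case: (eqVneq i a.1) => [ia|ia]; last first.
  have E : (n + dir a) 0 i = n 0 i by rewrite add_dirE (negbTE ia) mulr0 addr0.
  have := preferred_total i c n; rewrite /preferred !reflect_atE eqxx E.
  by case/orP => ->; [apply: Or31|apply: Or32].
have E : (n + dir a) 0 i = n 0 i + (-1) ^+ a.2 by rewrite add_dirE -ia eqxx mulr1.
have E' k : k != i -> (n + dir a) 0 k = n 0 k.
  by move=> ki; rewrite add_dirE -ia (negbTE ki) mulr0 addr0.
have rE m : reflect_at i c m 0 i = (c : nat)%:Z - m 0 i by rewrite reflect_atE eqxx.
rewrite /preferred !rE E; case: c rE => rE.
  have [h1|h1] := boolP ((n 0 i <= 0) && (n 0 i + (-1) ^+ a.2 <= 0)).
    by apply: Or31; apply/andP.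
  have [h2|h2] := boolP ((1%N%:Z - n 0 i <= 0) && (1%N%:Z - (n 0 i + (-1) ^+ a.2) <= 0)).
    by apply: Or32; apply/andP.
  apply: Or33; apply/rowP => k; have [->|ki] := eqVneq k i.
    by rewrite E rE; move: h1 h2; case: (a.2); rewrite /= ?expr0 ?expr1; lia.
  by rewrite E' // reflect_atE (negbTE ki).
have [h1|h1] := boolP ((0 <= n 0 i) && (0 <= n 0 i + (-1) ^+ a.2)).
  by apply: Or31; apply/andP.
apply: Or32; apply/andP; move: h1.
by case: (a.2); rewrite /= ?expr0 ?expr1; lia.
Qed.

(** The position of [l] in the enumeration 0, 1, -1, 2, -2, ... *)
Definition spiral_rank (l : int) : nat := if 0 < l then (absz l).*2.-1 else (absz l).*2.

Definition rank n : nat := \sum_i spiral_rank (n 0%R i).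

Lemma rank_reflect i c n : preferred i c n -> reflect_at i c n != n ->
  (rank n < rank (reflect_at i c n))%N.
Proof.
move=> hn nn; rewrite /rank (bigD1 i) //= [X in (_ < X)%N](bigD1 i) //=.
rewrite [X in (_ < _ + X)%N](eq_bigr (fun k => spiral_rank (n 0%R k))); last first.
  by move=> k ki; rewrite reflect_atE (negbTE ki).
rewrite ltn_add2r reflect_atE eqxx.
have ni : (c : nat)%:Z - n 0 i != n 0 i.
  apply: contraNneq nn => E; apply/eqP/rowP => k; rewrite reflect_atE.
  by case: eqP => // ->.
move: hn ni; rewrite /preferred /spiral_rank; case: c {nn}; case: ifP; case: ifP; lia.
Qed.

Lemma spiral_rank_ge l : (absz l <= spiral_rank l)%N.
Proof. rewrite /spiral_rank; case: ifP; lia. Qed.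

Lemma rank_finite (M : nat) : exists X : {fset lattice d},
  forall n, (rank n <= M)%N -> n \in X.
Proof.
pose f (F : {ffun 'I_d -> 'I_(M + M).+1}) : lattice d := \row_i ((F i : nat)%:Z - M%:Z).
exists [fset f F | F in {: {ffun 'I_d -> 'I_(M + M).+1}}]%fset.
move=> n nM; have le i : (absz (n 0%R i) <= M)%N.
  rewrite (leq_trans (spiral_rank_ge _)) // (leq_trans _ nM) //.
  by rewrite /rank (bigD1 i) //= leq_addr.
apply/imfsetP; exists [ffun i => inord (absz (n 0 i + M%:Z))] => //.
apply/rowP => i; rewrite mxE ffunE; have := le i; move: (n 0 i) => z zM.
rewrite inordK; last by lia.
lia.
Qed.

End Reflections.

(** * Polarization *)

Section Polarization.
Context {R : realType} {d : nat}.
Variables (sigma omega : R).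
Hypotheses (sigma0 : 0 < sigma) (omega0 : 0 < omega).
Implicit Types (f g : lattice d -> R).
Local Notation p := (2 * sigma + 2).
Local Notation j := (min_energy d sigma omega).

(** The homogeneous inequality already bounds the energy of such an [f] below
    by [j]. *)
Lemma ground_state_of_le f : sqsum f -> (forall n, 0 <= f n) -> rpsum sigma f = 1 ->
  renergy omega f <= j -> ground_state sigma omega f.
Proof.
move=> sf f0 f1 fj; split => //; apply/eqP; rewrite eq_le fj /=.
have := renergy_homogeneous sigma0 omega0 sf.
by rewrite f1 powR1 mulr1.
Qed.

Lemma modulus_grad_le (z w : R[i]) :
  (modulus z - modulus w) ^+ 2 <=
  (complex.Re z - complex.Re w) ^+ 2 + (complex.Im z - complex.Im w) ^+ 2.
Proof.
have -> : (complex.Re z - complex.Re w) ^+ 2 + (complex.Im z - complex.Im w) ^+ 2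
    = modulus (z - w) ^+ 2.
  by rewrite modulus_sqr; case: z w => [? ?] [? ?].
rewrite -real_normK ?num_real // lerXn2r ?nnegrE ?modulus_ge0 //.
have h1 := modulusD (z - w) w; have h2 := modulusD (w - z) z.
rewrite subrK in h1; rewrite subrK -opprB modulusN in h2.
by rewrite ler_norml; apply/andP; split; lra.
Qed.

(** The modulus is 1-Lipschitz, so it does not increase the differences along
    edges. *)
Lemma ground_state_modulus (v : lattice d -> R[i]) :
  is_minimizer sigma omega v -> ground_state sigma omega (fun n => modulus (v n)).
Proof.
move=> /(is_minimizerP sigma0 omega0)[/(admissibleP sigma0)[ev v1] vj].
have [sr si] := (ell2_ReIm v).1 ev.
have sm : sqsum (fun n => modulus (v n)) by exact: (ell2P v).1 ev.
apply: (ground_state_of_le sm) => [n||]; first exact: modulus_ge0.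
  rewrite -v1 /rpsum /psum; congr tsum; apply/funext => n.
  by rewrite ger0_norm // modulus_ge0.
rewrite -vj energyE // !renergy_grad //.
have -> : ip (fun n => modulus (v n)) (fun n => modulus (v n)) = norm2 v.
  by rewrite norm2_tsum.
have le a : tsum (fun n => (modulus (v (n + dir a)) - modulus (v n)) ^+ 2) <=
    tsum (fun n => (re v (n + dir a) - re v n) ^+ 2) +
    tsum (fun n => (im v (n + dir a) - im v n) ^+ 2).
  rewrite -(tsumD (absum_grad _ sr) (absum_grad _ si)); apply: tsum_le.
  - exact: (absum_grad (dir a) sm).
  - exact: absumD (absum_grad _ sr) (absum_grad _ si).
  - by move=> n; exact: modulus_grad_le.
have := ler_sum (index_enum _) (P := xpredT) (fun a _ => le a).
rewrite big_split /= /norm2; lra.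
Qed.

Variables (i : 'I_d) (c : bool).
Local Notation tau := (reflect_at i c).
Local Notation half := (preferred i c).

(** The two-point rearrangement with respect to the reflection [tau]. *)
Definition polarize f : lattice d -> R :=
  fun n => if half n then Num.max (f n) (f (tau n)) else Num.min (f n) (f (tau n)).

Lemma polarize_pair f n : half n ->
  polarize f n = Num.max (f n) (f (tau n)) /\
  polarize f (tau n) = Num.min (f n) (f (tau n)).
Proof.
move=> hn; rewrite /polarize hn reflect_atK; split => //.
case: ifPn => [h|_]; last by rewrite minC.
by rewrite (preferred_both hn h) maxxx minxx.
Qed.

(** Polarization permutes the two values at mirror points, hence preserves every
    sum of functions of the values. *)
Lemma polarize_symm (F : R -> R) f n :
  F (polarize f n) + F (polarize f (tau n)) = F (f n) + F (f (tau n)).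
Proof.
wlog hn : n / half n => [H|].
  case/orP: (preferred_total i c n); first exact: H.
  by move=> /H; rewrite reflect_atK addrC => ->; rewrite addrC.
have [-> ->] := polarize_pair f hn.
by rewrite maxEle minEle; case: ifP => // _; rewrite addrC.
Qed.

Lemma tsum_tau g : tsum (fun n => g (tau n)) = tsum g.
Proof. by apply: tsum_reindex; exact: (@reflect_atK d i c). Qed.

Lemma absum_tau g : absum g -> absum (fun n => g (tau n)).
Proof. by apply: absum_reindex; exact: (@reflect_atK d i c). Qed.

Lemma tsum_le_symm g g' : absum g -> absum g' ->
  (forall n, g n + g (tau n) <= g' n + g' (tau n)) -> tsum g <= tsum g'.
Proof.
move=> ag ag' le; have atg := absum_tau ag; have atg' := absum_tau ag'.
have := tsum_le (absumD ag atg) (absumD ag' atg') le.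
rewrite (tsumD ag atg) (tsumD ag' atg') !tsum_tau; lra.
Qed.

Lemma polarize_bound f n : `|polarize f n| <= `|f n| + `|f (tau n)|.
Proof.
rewrite /polarize maxEle minEle; case: ifP => _; case: ifP => _;
  by rewrite ?lerDl ?lerDr normr_ge0.
Qed.

Lemma sqsum_polarize f : sqsum f -> sqsum (polarize f).
Proof.
move=> sf; have sft : sqsum (fun n => f (tau n)) by exact: (absum_tau sf).
have sn (h : lattice d -> R) : sqsum h -> sqsum (fun n => `|h n|).
  by move=> sh; apply: (sqsum_le sh) => n; rewrite normr_id.
have sg : sqsum (axpy (fun n => `|f n|) 1 (fun n => `|f (tau n)|)).
  by apply: sqsum_axpy; [exact: sn|exact: (sn (fun n => f (tau n)))].
apply: (sqsum_le sg) => n; rewrite /axpy mul1r [leRHS]ger0_norm ?addr_ge0 //; exact: polarize_bound.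
Qed.

Lemma polarize_ge0 f : (forall n, 0 <= f n) -> forall n, 0 <= polarize f n.
Proof.
by move=> f0 n; rewrite /polarize maxEle minEle; case: ifP => _; case: ifP.
Qed.

Lemma tsum_polarize (F : R -> R) f : absum (fun n => F (f n)) ->
  absum (fun n => F (polarize f n)) ->
  tsum (fun n => F (polarize f n)) = tsum (fun n => F (f n)).
Proof.
move=> a1 a2; apply/eqP; rewrite eq_le; apply/andP; split; apply: tsum_le_symm => // n;
  by rewrite polarize_symm.
Qed.

(** For an edge and its mirror image on the two sides this is the inequality
    [x y + x' y' <= max x x' max y y' + min x x' min y y'], where [x, x'] and
    [y, y'] are the values at the end points and at their mirror images; an edge
    between mirror points keeps its difference up to sign. *)
Lemma polarize_edge f n a :
  (polarize f (n + dir a) - polarize f n) ^+ 2 +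
  (polarize f (tau (n + dir a)) - polarize f (tau n)) ^+ 2 <=
  (f (n + dir a) - f n) ^+ 2 + (f (tau (n + dir a)) - f (tau n)) ^+ 2.
Proof.
have two (x x' y y' : R) :
  (Num.max y y' - Num.max x x') ^+ 2 + (Num.min y y' - Num.min x x') ^+ 2 <=
  (y - x) ^+ 2 + (y' - x') ^+ 2.
  rewrite !maxEle !minEle; case: (leP y y') => ?; case: (leP x x') => ? //; nra.
case: (preferred_edge i c n a) => [[h1 h2]|[h1 h2]|->].
- have [-> ->] := polarize_pair f h1; have [-> ->] := polarize_pair f h2.
  exact: two.
- have := polarize_pair f h1; have := polarize_pair f h2; rewrite !reflect_atK.
  move=> [-> ->] [-> ->]; rewrite addrC [leRHS]addrC; exact: two.
- rewrite reflect_atK; case/orP: (preferred_total i c n) => h.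
    have [-> ->] := polarize_pair f h.
    by rewrite maxEle minEle; case: ifP => _; nra.
  have := polarize_pair f h; rewrite reflect_atK => -[-> ->].
  by rewrite maxEle minEle; case: ifP => _; nra.
Qed.

(** The reflection permutes the edges of the lattice. *)
Lemma sum_grad_tau f : sqsum f ->
  \sum_a tsum (fun n => (f (tau (n + dir a)) - f (tau n)) ^+ 2) =
  \sum_a tsum (fun n => (f (n + dir a) - f n) ^+ 2).
Proof.
move=> sf; rewrite [RHS](reindex_inj (inv_inj (reflect_dirK i))) /=.
apply: eq_bigr => a _; rewrite -[RHS]tsum_tau; congr tsum; apply/funext => n.
by rewrite reflect_at_dir.
Qed.

Lemma renergy_polarize f : sqsum f -> renergy omega (polarize f) <= renergy omega f.
Proof.
move=> sf; have sp := sqsum_polarize sf; rewrite !renergy_grad //.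
have -> : ip (polarize f) (polarize f) = ip f f.
  exact: (@tsum_polarize (fun x => x ^+ 2)).
rewrite lerD2r ler_wpM2l ?invr_ge0 //.
have ag (h : lattice d -> R) a : sqsum h ->
    absum (fun n => (h (tau (n + dir a)) - h (tau n)) ^+ 2).
  move=> sh; under eq_fun do rewrite reflect_at_dir.
  exact: (absum_tau (absum_grad (dir (reflect_dir i a)) sh)).
have le a : tsum (fun n => (polarize f (n + dir a) - polarize f n) ^+ 2) +
    tsum (fun n => (polarize f (tau (n + dir a)) - polarize f (tau n)) ^+ 2) <=
    tsum (fun n => (f (n + dir a) - f n) ^+ 2) +
    tsum (fun n => (f (tau (n + dir a)) - f (tau n)) ^+ 2).
  rewrite -(tsumD (absum_grad _ sp) (ag _ a sp)) -(tsumD (absum_grad _ sf) (ag _ a sf)).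
  apply: tsum_le.
  - exact: absumD (absum_grad _ sp) (ag _ a sp).
  - exact: absumD (absum_grad _ sf) (ag _ a sf).
  - by move=> n; exact: polarize_edge.
have := ler_sum (index_enum _) (P := xpredT) (fun a _ => le a).
rewrite !big_split /= (sum_grad_tau sp) (sum_grad_tau sf); lra.
Qed.

Lemma ground_state_polarize f : ground_state sigma omega f -> ground_state sigma omega (polarize f).
Proof.
move=> [sf f1 fj f0]; have sp := sqsum_polarize sf.
apply: (ground_state_of_le sp).
- exact: polarize_ge0.
- rewrite -f1; apply: (@tsum_polarize (fun x => `|x| `^ p)); exact: absum_rpsum.
- by rewrite -fj; exact: renergy_polarize.
Qed.

Definition weight (n : lattice d) : R := (rank n).+1%:R^-1.

Lemma weight_ge0 n : 0 <= weight n.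
Proof. by rewrite invr_ge0. Qed.

Lemma weight_le1 n : weight n <= 1.
Proof. by rewrite invf_le1 ?ler1n // ltr0n. Qed.

Lemma weight01 n : 0 <= weight n <= 1.
Proof. by rewrite weight_ge0 weight_le1. Qed.

Lemma absum_weight f : sqsum f -> absum (fun n => weight n * f n ^+ 2).
Proof. exact/absum_weighted/weight01. Qed.

(** The functional whose maximizers, among minimizers of the energy, are fixed
    by all polarizations. *)
Definition central_mass f : R := tsum (fun n => weight n * f n ^+ 2).

(** A pair of mirror points with the larger value on the wrong side contributes
    [(weight n - weight (tau n)) (f (tau n)^2 - f n^2) > 0] to the increase, and no
    pair contributes a negative amount. *)
Lemma central_mass_polarize f : sqsum f -> (forall n, 0 <= f n) ->
  central_mass (polarize f) <= central_mass f -> forall n, half n -> f (tau n) <= f n.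
Proof.
move=> sf f0 le n hn; have [//|lt] := leP (f (tau n)) (f n).
have sp := sqsum_polarize sf; have aw := absum_weight sf; have awp := absum_weight sp.
(* The increase of the functional, grouped by pairs of mirror points. *)
pose E m := (weight m * polarize f m ^+ 2 + weight (tau m) * polarize f (tau m) ^+ 2)
  - (weight m * f m ^+ 2 + weight (tau m) * f (tau m) ^+ 2).
have aE : absum E.
  by apply: absumB; apply: absumD => //; [exact: (absum_tau awp)|exact: (absum_tau aw)].
have sE : tsum E = 2 * (central_mass (polarize f) - central_mass f).
  rewrite /E tsumB; [|exact: absumD awp (absum_tau awp)|exact: absumD aw (absum_tau aw)].
  rewrite (tsumD awp (absum_tau awp)) (tsumD aw (absum_tau aw)).
  rewrite (tsum_tau (fun n => weight n * polarize f n ^+ 2)).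
  rewrite (tsum_tau (fun n => weight n * f n ^+ 2)) /central_mass; ring.
have wle m : half m -> weight (tau m) <= weight m.
  move=> hm; have [->//|nm] := eqVneq (tau m) m.
  rewrite lef_pV2 ?posrE ?ltr0n // ler_nat ltnS ltnW //; exact: rank_reflect.
have E0 m : 0 <= E m.
  suff H k : half k -> 0 <= E k.
    case/orP: (preferred_total i c m); first exact: H.
    move=> /H; rewrite /E reflect_atK addrC (addrC (weight m * f m ^+ 2)).
    by rewrite (addrC (weight (tau m) * polarize f (tau m) ^+ 2)) addrC.
  move=> hk; have [pk1 pk2] := polarize_pair f hk; rewrite /E pk1 pk2.
  have [le_k|gt_k] := leP (f k) (f (tau k)); last by rewrite subrr.
  have : 0 <= (weight k - weight (tau k)) * (f (tau k) ^+ 2 - f k ^+ 2).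
    by rewrite mulr_ge0 ?subr_ge0 ?wle // lerXn2r ?nnegrE ?f0.
  by congr (_ <= _); ring.
have En : E n = 0.
  by apply: (tsum_eq0 E0 aE); rewrite sE pmulr_rle0 // subr_le0.
have nn : tau n != n by apply: contraTneq lt => ->; rewrite ltxx.
have wlt : weight (tau n) < weight n.
  by rewrite ltf_pV2 ?posrE ?ltr0n // ltr_nat ltnS rank_reflect.
have [pk1 pk2] := polarize_pair f hn; move: En; rewrite /E pk1 pk2.
rewrite (max_r (ltW lt)) (min_l (ltW lt)) => En.
have : 0 < (weight n - weight (tau n)) * (f (tau n) ^+ 2 - f n ^+ 2).
  rewrite mulr_gt0 ?subr_gt0 //.
  by rewrite ltrXn2r ?nnegrE ?f0.
by rewrite (_ : _ * _ = 0) ?ltxx // -En; ring.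
Qed.

End Polarization.

Section BellShapedGround.
Context {R : realType} {d : nat}.
Variables (sigma omega : R).
Hypotheses (sigma0 : 0 < sigma) (omega0 : 0 < omega).
Implicit Types (f g : lattice d -> R).
Local Notation p := (2 * sigma + 2).
Local Notation j := (min_energy d sigma omega).

Lemma ground_state_norm_le f : ground_state sigma omega f -> ip f f <= j / omega.
Proof.
move=> [sf _ fj _]; rewrite ler_pdivlMr // mulrC -fj; exact: renergy_ge.
Qed.

Lemma weight_vanish (e : R) : 0 < e ->
  exists X : {fset lattice d}, forall n, n \notin X -> weight n <= e.
Proof.
move=> e0; have [X hX] := @rank_finite d (Num.trunc e^-1); exists X => n nX.
have rn : (Num.trunc e^-1 < rank n)%N by rewrite ltnNge; apply: contra nX => /hX.
rewrite /weight invf_ple ?posrE ?ltr0n //; apply: le_trans (ltW (truncnS_gt _)) _.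
by rewrite ler_nat ltnW.
Qed.

(** A maximizing sequence consists of minimizers, hence is a minimizing
    sequence.  Its pointwise limit has central mass equal to the positive supremum,
    since the weight vanishes at infinity; thus it is not zero and no translation
    is needed. *)
Lemma central_mass_max : (exists f : lattice d -> R, ground_state sigma omega f) ->
  exists2 f : lattice d -> R, ground_state sigma omega f &
    forall g : lattice d -> R, ground_state sigma omega g -> central_mass g <= central_mass f.
Proof.
move=> [f0 gf0]; pose A := [set @central_mass R d f | f in @ground_state R d sigma omega].
have j0 := @min_energy_gt0 R d _ _ sigma0 omega0.
have cb (f : lattice d -> R) : ground_state sigma omega f -> central_mass f <= j / omega.
  move=> gf; apply: le_trans (ground_state_norm_le gf); have [sf _ _ _] := gf.
  apply: (tsum_le (absum_weight sf) sf) => n.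
  by rewrite ler_piMl ?sqr_ge0 // weight_le1.
have supA : has_sup A.
  by split; [exists (central_mass f0), f0|exists (j / omega) => _ [f gf <-]; exact: cb].
have H k : exists f : lattice d -> R, ground_state sigma omega f /\ sup A - k.+1%:R^-1 < central_mass f.
  have k0 : 0 < k.+1%:R^-1 :> R by rewrite invr_gt0.
  by have [_ [f gf <-] lt] := sup_adherent k0 supA; exists f.
have [f hf] := choice H.
have gf k : ground_state sigma omega (f k) by case: (hf k).
have sf k : sqsum (f k) by case: (gf k).
have fM k : ip (f k) (f k) <= j / omega by exact: ground_state_norm_le.
have [U [UU oU]] := @ultraFilterLemma _ (\oo : set_system nat) _.
have HU n : exists l : R, f k n @[k --> U] --> l.
  apply: (@bounded_ultralimit _ _ _ _ 1) => k.
  by rewrite ger0_norm ?(ground_state_le1 sigma0 (gf k)) //; case: (gf k).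
have [g hg] := choice HU.
have PU : ProperFilter U by exact: ultra_proper.
have cg : central_mass (f k) @[k --> U] --> central_mass g.
  exact: (tsum_weighted_cvg PU (@weight01 R d) weight_vanish sf fM hg).
have gsup : sup A <= central_mass g.
  have lim : sup A - k.+1%:R^-1 @[k --> U] --> sup A - 0.
    apply: cvgB; first exact: cvg_cst.
    exact: cvg_trans (cvg_app _ oU) (@cvg_harmonic R).
  suff L : 0 <= central_mass g - (sup A - 0) by rewrite subr0 subr_ge0 in L.
  apply: (cvgr_to_ge (cvgB cg lim)).
  by apply: nearW => k; rewrite subr_ge0 ltW //; case: (hf k).
have c0 : 0 < central_mass f0.
  have [sf0 _ _ _] := gf0; have := ground_state_gt0 sigma0 omega0 gf0 0 => f00.
  apply: lt_le_trans (tsum_ge1 0 _ (absum_weight sf0)).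
    by rewrite mulr_gt0 ?exprn_gt0 // invr_gt0.
  by move=> n; rewrite mulr_ge0 ?weight_ge0 ?sqr_ge0.
have cg0 : 0 < central_mass g.
  by apply: lt_le_trans gsup; apply: lt_le_trans c0 _; apply: ub_le_sup => //; [case: supA|exists f0].
have gg : ground_state sigma omega g.
  apply/(ground_stateP sigma0 omega0); split; last first.
    by move=> n; apply: (cvgr_to_ge (hg n)); apply: nearW => k; case: (gf k).
  have mf k := ((ground_stateP sigma0 omega0 (f k)).1 (gf k)).1.
  have mj k : energy omega (fun n => (f k n)%:C) = j.
    by have [_ ->] := (is_minimizerP sigma0 omega0 _).1 (mf k).
  have [] // := @minimizing_limit R d _ _ sigma0 omega0 _ U
     (fun k n => (f k n)%:C) (fun n => (g n)%:C) (j / omega) _.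
  - by move=> k; case: (mf k).
  - move=> k; rewrite /norm2 re_real im_real [X in _ + X](_ : _ = 0) ?addr0 //.
    by rewrite /ip; under eq_fun do rewrite mul0r; rewrite tsum0.
  - by under eq_fun do rewrite mj; exact: cvg_cst.
  - by move=> n; exact: cvg_cst.
  - apply: contrapT => /forallNP g0; move: cg0; rewrite /central_mass.
    rewrite (_ : (fun n => _) = fun=> 0) ?tsum0 ?ltxx // => //.
    apply/funext => n; have /contrapT := g0 n.
    by move=> /(congr1 (@complex.Re R)) /= ->; rewrite expr0n mulr0.
exists g => // h gh; apply: le_trans gsup; apply: ub_le_sup; first by case: supA.
by exists h.
Qed.

Lemma bell_shaped_ground_state_exists : (exists f : lattice d -> R, ground_state sigma omega f) ->
  exists2 f : lattice d -> R, ground_state sigma omega f & forall (i : 'I_d) k, bell_shaped (line f i k).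
Proof.
move=> /central_mass_max[f gf fmax]; exists f => // i k.
have [sf _ _ f0] := gf.
have tle c n : preferred i c n -> f (reflect_at i c n) <= f n.
  apply: (central_mass_polarize sf f0); apply: fmax; exact: ground_state_polarize.
pose w := line f i k.
(* The two families of inequalities, [w (- l) <= w l] for [0 <= l] and
   [w (1 - l) <= w l] for [l <= 0], interleave into the chain in spiral order. *)
have wE (l : int) c : (if c then l <= 0 else 0 <= l) -> w ((c : nat)%:Z - l) <= w l.
  move=> hl; have := tle c (\row_m (if m == i then l else k 0 m)).
  rewrite /preferred mxE eqxx => /(_ hl); rewrite /w /line; congr (f _ <= _).
  by apply/rowP => m; rewrite reflect_atE !mxE eqxx; case: eqP.
have fpos : 0 < w 0 by rewrite /w /line; exact: (ground_state_gt0 sigma0 omega0 gf).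
have [X hX] := sqsum_vanish sf fpos.
pose K := (\max_(n <- enum_fset X) absz (n 0%R i)).+1.
have far (l : int) : (K <= absz l)%N -> w l < w 0.
  move=> Kl; apply: le_lt_trans (ler_norm _) _; apply: hX; apply/negP => lX.
  move: Kl; rewrite ltnNge => /negP; apply.
  have -> : absz l = absz ((\row_m (if m == i then l else k 0 m) : lattice d) 0%R i).
    by rewrite mxE eqxx.
  exact: (@leq_bigmax_seq _ _ xpredT (fun n : lattice d => absz (n 0%R i)) _ lX).
apply: (@bell_shaped_of_unimodal _ _ K) => m.
- apply: (@le_trans _ _ (w (- m%:Z))).
    have := @wE (- m%:Z) true; rewrite (_ : (true : nat)%:Z - - m%:Z = m.+1%:Z); last by lia.
    by apply; lia.
  by have := @wE m%:Z false; rewrite (_ : (false : nat)%:Z - m%:Z = - m%:Z); [apply|lia].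
- apply: (@le_trans _ _ (w m.+1%:Z)).
    have := @wE m.+1%:Z false; rewrite (_ : (false : nat)%:Z - m.+1%:Z = - m.+1%:Z); last by lia.
    by apply.
  have := @wE (- m%:Z) true; rewrite (_ : (true : nat)%:Z - - m%:Z = m.+1%:Z); last by lia.
  by apply; lia.
- by move=> Km; split; apply: far; rewrite ?abszN.
Qed.

End BellShapedGround.

(** * The linearized operator *)

Section Linearization.
Context {R : realType} {d : nat}.
Variables (sigma omega : R).
Hypotheses (sigma0 : 0 < sigma) (omega0 : 0 < omega).
Implicit Types (f g h : lattice d -> R).
Local Notation p := (2 * sigma + 2).
Local Notation j := (min_energy d sigma omega).

Variable u : lattice d -> R.
Hypothesis gu : ground_state sigma omega u.

Let su : sqsum u. Proof. by case: gu. Qed.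
Let uj : renergy omega u = j. Proof. by case: gu. Qed.
Let u0 n : 0 < u n. Proof. exact: (ground_state_gt0 sigma0 omega0 gu). Qed.
Let j0 : 0 < j. Proof. exact: min_energy_gt0. Qed.
Let K : R := (2 * sigma + 1) * j.
Let s2 : 0 < 2 * sigma. Proof. by rewrite mulr_gt0. Qed.
Let K0 : 0 < K. Proof. by rewrite mulr_gt0 // addr_gt0. Qed.

Lemma potential01 n : 0 <= potential sigma u n <= 1.
Proof.
rewrite powR_ge0 /=.
have := @ge0_ler_powR R (2 * sigma) (ltW s2) (u n) 1; rewrite powR1; apply.
- by rewrite nnegrE ltW.
- by rewrite nnegrE.
- exact: (ground_state_le1 sigma0 gu).
Qed.

Lemma potential_vanish e : 0 < e ->
  exists X : {fset lattice d}, forall n, n \notin X -> potential sigma u n <= e.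
Proof.
move=> e0; have e1 : 0 < e `^ (2 * sigma)^-1 by rewrite powR_gt0.
have [X hX] := sqsum_vanish su e1; exists X => n /hX un.
(* The threshold for [u] that corresponds to [e] for its power [2 sigma]. *)
have -> : e = (e `^ (2 * sigma)^-1) `^ (2 * sigma).
  by rewrite -powRrM mulVf ?(gt_eqF s2) // powRr1 // ltW.
apply: ge0_ler_powR; rewrite ?nnegrE ?(ltW s2) ?(ltW (u0 n)) ?powR_ge0 //.
by apply: le_trans (ltW un); rewrite ler_norm.
Qed.

Definition potential_mul f : lattice d -> R := fun n => potential sigma u n * f n.

Lemma sqsum_potential_mul f : sqsum f -> sqsum (potential_mul f).
Proof.
move=> sf; apply: (sqsum_le sf) => n; have /andP[a b] := potential01 n.
by rewrite /potential_mul normrM (ger0_norm a) ler_piMl.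
Qed.

Lemma ip_potential_mul f : ip (potential_mul f) f = tsum (fun n => potential sigma u n * f n ^+ 2).
Proof. by congr tsum; apply/funext => n; rewrite /potential_mul -mulrA -expr2. Qed.

Lemma potential_mul_sym f g : ip (potential_mul f) g = ip f (potential_mul g).
Proof. by congr tsum; apply/funext => n; rewrite /potential_mul; ring. Qed.

(** [L_+] on real functions, where its form can be compared with the energy. *)
Definition rLplus f : lattice d -> R := axpy (helmholtz omega f) (- K) (potential_mul f).

Lemma sqsum_rLplus f : sqsum f -> sqsum (rLplus f).
Proof. by move=> sf; apply: sqsum_axpy; [exact: sqsum_helmholtz|exact: sqsum_potential_mul]. Qed.

Lemma rLplus_sym f g : sqsum f -> sqsum g -> ip (rLplus f) g = ip f (rLplus g).
Proof.
move=> sf sg; rewrite /rLplus.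
rewrite (ip_axpyl _ (sqsum_helmholtz omega sf) (sqsum_potential_mul sf) sg).
rewrite (ip_axpyr _ (sqsum_helmholtz omega sg) (sqsum_potential_mul sg) sf).
by rewrite helmholtz_sym // potential_mul_sym.
Qed.

Definition qform f : R := ip (rLplus f) f.

Lemma qformE f : sqsum f -> qform f = renergy omega f - K * ip (potential_mul f) f.
Proof.
move=> sf; rewrite /qform (ip_axpyl _ (sqsum_helmholtz omega sf) (sqsum_potential_mul sf) sf).
by rewrite mulNr.
Qed.

Lemma rLplus_axpy f t h : rLplus (axpy f t h) = axpy (rLplus f) t (rLplus h).
Proof.
by apply/funext => n; rewrite /rLplus helmholtz_axpy /axpy /potential_mul; ring.
Qed.

Lemma qform_axpy f t h : sqsum f -> sqsum h ->
  qform (axpy f t h) = qform f + 2 * t * ip (rLplus f) h + t ^+ 2 * qform h.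
Proof.
move=> sf sh; have lf := sqsum_rLplus sf; have lh := sqsum_rLplus sh.
rewrite /qform rLplus_axpy (ip_axpyl _ lf lh (sqsum_axpy t sf sh)).
rewrite (ip_axpyr _ sf sh lf) (ip_axpyr _ sf sh lh).
by rewrite (rLplus_sym sh sf) (ipC h); ring.
Qed.

Lemma ip_axpy_sq f t h : sqsum f -> sqsum h ->
  ip (axpy f t h) (axpy f t h) = ip f f + 2 * t * ip f h + t ^+ 2 * ip h h.
Proof.
move=> sf sh; rewrite (ip_axpyl _ sf sh (sqsum_axpy t sf sh)).
by rewrite (ip_axpyr _ sf sh sf) (ip_axpyr _ sf sh sh) (ipC h f); ring.
Qed.

Lemma qform_ge0 h : sqsum h -> ip (nonlinearity sigma u) h = 0 -> 0 <= qform h.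
Proof.
move=> sh h0; rewrite qformE // subr_ge0 ip_potential_mul.
exact: (second_variation sigma0 omega0 gu sh h0).
Qed.

(** [u^(p - 2) u = u^(p - 1)] and [sum u^p = 1], so the form at [u] is
    [j - (2 sigma + 1) j]. *)
Lemma qform_ground_state_lt0 : qform u < 0.
Proof.
have E : potential_mul u = nonlinearity sigma u.
  apply/funext => n; rewrite /potential_mul /potential /nonlinearity powRD ?powRr1 ?(ltW (u0 n)) //.
  by rewrite (gt_eqF (u0 n)) implybT.
rewrite qformE // E (ip_nonlinearity sigma0 gu) uj mulr1 /K subr_lt0.
by rewrite mulrDl mul1r ltrDr mulr_gt0.
Qed.

Lemma qformZ t f : sqsum f -> qform (fun n => t * f n) = t ^+ 2 * qform f.
Proof.
move=> sf; have E : (fun n => t * f n) = axpy (fun=> 0) t f.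
  by apply/funext => n; rewrite /axpy add0r.
have s0 := @sqsum0 R (lattice d).
have q0 : qform (fun=> 0) = 0.
  by rewrite /qform /ip; under eq_fun do rewrite mulr0; exact: tsum0.
rewrite E qform_axpy // q0 rLplus_sym // /ip.
by under eq_fun do rewrite mul0r; rewrite tsum0 mulr0 !add0r.
Qed.

Lemma qform_ge f : sqsum f -> - K * ip f f <= qform f.
Proof.
move=> sf; rewrite qformE // mulNr.
have h1 : 0 <= renergy omega f.
  by apply: le_trans (renergy_ge omega sf); rewrite mulr_ge0 ?ip_ge0 // ltW.
have h2 : ip (potential_mul f) f <= ip f f.
  rewrite ip_potential_mul; apply: (tsum_le (absum_weighted potential01 sf) sf) => n.
  by have /andP[_ b] := potential01 n; rewrite ler_piMl ?sqr_ge0.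
have := ler_wpM2l (ltW K0) h2; lra.
Qed.

(** The direct method: along a minimizing sequence of the Rayleigh quotient the
    energy is lower semicontinuous and the potential term converges.  As the infimum
    is negative, the weak limit cannot lose norm, and it is an eigenfunction by a
    variation at each site. *)
Lemma lowest_eigenfunction : exists (mu : R) f,
  [/\ mu < 0, sqsum f, 0 < ip f f & forall n, rLplus f n = mu * f n].
Proof.
(* The values of the form on the unit sphere, i.e. of the Rayleigh quotient. *)
pose A := [set qform f | f in [set f : lattice d -> R | sqsum f /\ ip f f = 1]].
have norml f : sqsum f -> 0 < ip f f -> A (qform f / ip f f).
  move=> sf f0; exists (fun n => (Num.sqrt (ip f f))^-1 * f n); last first.
    by rewrite qformZ // exprVn sqr_sqrtr ?ip_ge0 // mulrC.
  have sg := sqsumZ (Num.sqrt (ip f f))^-1 sf; split => //.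
  rewrite ipZl // ipC ipZl // mulrA -expr2 exprVn sqr_sqrtr ?ip_ge0 //.
  by rewrite mulVf // gt_eqF.
have ipu : 0 < ip u u.
  by apply: lt_le_trans (sqr_le_ip 0 su); rewrite exprn_gt0.
have infA : has_inf A.
  split; first by exists (qform u / ip u u); exact: norml.
  by exists (- K) => _ [f [sf f1] <-]; have := qform_ge sf; rewrite f1 mulr1.
pose mu := inf A.
have mu0 : mu < 0.
  apply: (@le_lt_trans _ _ (qform u / ip u u)).
    by apply: ge_inf; [case: infA|exact: norml].
  by rewrite pmulr_llt0 ?invr_gt0 // qform_ground_state_lt0.
have rayleigh f : sqsum f -> mu * ip f f <= qform f.
  move=> sf; have := ip_ge0 f; rewrite le_eqVlt => /predU1P[f0|f0].
    by have := qform_ge sf; rewrite -f0 !mulr0.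
  by rewrite -ler_pdivlMr //; apply: ge_inf; [case: infA|exact: norml].
have H k : exists f : lattice d -> R, [/\ sqsum f, ip f f = 1 & qform f < mu + k.+1%:R^-1].
  have k0 : 0 < k.+1%:R^-1 :> R by rewrite invr_gt0.
  by have [_ [f [sf f1] <-] lt] := inf_adherent k0 infA; exists f.
have [f hf] := choice H.
have sf k : sqsum (f k) by case: (hf k).
have f1 k : ip (f k) (f k) <= 1 by case: (hf k) => _ ->.
have [U [UU oU]] := @ultraFilterLemma _ (\oo : set_system nat) _.
have PU : ProperFilter U by exact: ultra_proper.
have HU n : exists l : R, f k n @[k --> U] --> l.
  apply: (@bounded_ultralimit _ _ _ _ 1) => k.
  rewrite -(@ler_pXn2r _ 2) ?nnegrE // expr1n real_normK ?num_real //.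
  exact: le_trans (sqr_le_ip n (sf k)) (f1 k).
have [g hg] := choice HU.
have [sg g1] := ip_fatou PU sf f1 hg.
have qg : qform g <= mu.
  have c1 : renergy omega (f k) - renergy omega (axpy (f k) (- 1) g) @[k --> U]
      --> renergy omega g by exact: renergy_splitting sf f1 hg.
  have c2 := tsum_weighted_cvg PU potential01 potential_vanish sf f1 hg.
  have c3 : mu + k.+1%:R^-1 @[k --> U] --> mu + 0.
    apply: cvgD; first exact: cvg_cst.
    exact: cvg_trans (cvg_app _ oU) (@cvg_harmonic R).
  have c4 : mu + k.+1%:R^-1 -
      (renergy omega (f k) - renergy omega (axpy (f k) (- 1) g)
       - K * tsum (fun n => potential sigma u n * f k n ^+ 2)) @[k --> U] -->
      mu + 0 - (renergy omega g - K * tsum (fun n => potential sigma u n * g n ^+ 2)).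
    apply: cvgB => //; apply: cvgB => //; apply: cvgM => //; exact: cvg_cst.
  suff : 0 <= mu + 0 - (renergy omega g - K * tsum (fun n => potential sigma u n * g n ^+ 2)).
    by rewrite -ip_potential_mul -qformE // addr0 subr_ge0.
  apply: (cvgr_to_ge c4); apply: nearW => k.
  have [_ _ lt] := hf k; rewrite qformE // ip_potential_mul in lt.
  have sw := sqsum_axpy (- 1) (sf k) sg.
  have w0 : 0 <= renergy omega (axpy (f k) (- 1) g).
    by apply: le_trans (renergy_ge omega sw); rewrite mulr_ge0 ?ip_ge0 // ltW.
  by rewrite subr_ge0 (le_trans _ (ltW lt)) // lerD2r gerBl.
have qgE : qform g = mu * ip g g.
  apply/eqP; rewrite eq_le rayleigh // andbT (le_trans qg) //.
  have := ip_ge0 g; nra.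
have g0 : 0 < ip g g.
  rewrite lt_def ip_ge0 andbT; apply/eqP => g0.
  by move: qg; rewrite qgE g0 mulr0 leNgt mu0.
exists mu, g; split => // n.
have sd := @sqsum_dirac R (lattice d) n.
suff : 2 * (ip (rLplus g) (dirac_at n) - mu * ip g (dirac_at n)) = 0.
  by rewrite !ip_dirac => /eqP; rewrite mulf_eq0 pnatr_eq0 /= subr_eq0 => /eqP.
apply: (@linear_coef_eq0 R _ (qform (dirac_at n) - mu * ip (dirac_at n) (dirac_at n)) 1) => // t _.
have := rayleigh _ (sqsum_axpy t sg sd).
by rewrite ip_axpy_sq // qform_axpy // qgE; lra.
Qed.

(** Subtract from [b] the multiple of [f] that makes [sum u^(p-1) g = 0]; then
    [<L_+ g, g> >= 0].  If the eigenvalues agree, [g] is an eigenfunction and must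
    vanish; otherwise [b] and [f] are orthogonal and the form at [g] is a sum of
    two nonpositive terms. *)
Lemma negative_eigenfunction_unique mu lambda f b :
  mu < 0 -> sqsum f -> 0 < ip f f -> (forall n, rLplus f n = mu * f n) ->
  lambda < 0 -> sqsum b -> (forall n, rLplus b n = lambda * b n) ->
  exists r, forall n, b n = r * f n.
Proof.
move=> mu0 sf f0 ef l0 sb eb.
have Ef : rLplus f = fun n => mu * f n by exact/funext.
have Eb : rLplus b = fun n => lambda * b n by exact/funext.
have qf : qform f = mu * ip f f by rewrite /qform Ef ipZl.
have qb : qform b = lambda * ip b b by rewrite /qform Eb ipZl.
have sup := sqsum_nonlinearity sigma0 gu.
have sfn : ip (nonlinearity sigma u) f != 0.
  apply/eqP => sf0; have := qform_ge0 sf sf0.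
  by rewrite qf leNgt pmulr_llt0 // mu0.
pose r := ip (nonlinearity sigma u) b / ip (nonlinearity sigma u) f.
have sg := sqsum_axpy (- r) sb sf.
have qg : 0 <= qform (axpy b (- r) f).
  apply: qform_ge0 => //; rewrite ip_axpyr // /r mulNr divfK // subrr //.
have orth : (lambda - mu) * ip b f = 0.
  have : ip (rLplus b) f = ip b (rLplus f) by exact: rLplus_sym.
  have e1 : ip b (fun n => mu * f n) = mu * ip b f.
    by rewrite ipC (ipZl _ sf sb) ipC.
  by rewrite Eb Ef (ipZl _ sb sf) e1 mulrBl => ->; exact: subrr.
move: qg; rewrite qform_axpy // qf qb Eb ipZl // => qg.
have [lm|lm] := eqVneq lambda mu.
  exists r => n; apply/eqP; rewrite -subr_eq0 -mulNr.
  apply/eqP; apply: (ip_eq0 sg _ n); rewrite -(nmulr_rge0 _ l0) ip_axpy_sq //.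
  by move: qg; rewrite lm; congr (_ <= _); ring.
have bf : ip b f = 0.
  by move/eqP: orth; rewrite mulf_eq0 subr_eq0 (negbTE lm) => /eqP.
exists 0 => n; rewrite mul0r; apply: (ip_eq0 sb).
rewrite -(nmulr_rge0 _ l0).
have : r ^+ 2 * (mu * ip f f) <= 0.
  by rewrite mulr_ge0_le0 ?sqr_ge0 // mulr_le0_ge0 ?(ltW mu0) ?(ltW f0).
move: qg; rewrite bf; lra.
Qed.

End Linearization.

(** * Morse index *)

Section MorseIndex.
Context {R : realType} {d : nat}.
Variables (sigma omega : R).
Hypotheses (sigma0 : 0 < sigma) (omega0 : 0 < omega).
Local Notation j := (min_energy d sigma omega).
Implicit Types (F : lattice d -> R[i]).

Lemma Re_sum (I : finType) (z : I -> R[i]) :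
  complex.Re (\sum_a z a) = \sum_a complex.Re (z a).
Proof. by apply: (big_morph _ _ erefl) => -[? ?] [? ?]. Qed.

Lemma Im_sum (I : finType) (z : I -> R[i]) :
  complex.Im (\sum_a z a) = \sum_a complex.Im (z a).
Proof. by apply: (big_morph _ _ erefl) => -[? ?] [? ?]. Qed.

Lemma disc_laplacian_ReIm F n :
  complex.Re (disc_laplacian F n) = disc_laplacian (re F) n /\
  complex.Im (disc_laplacian F n) = disc_laplacian (im F) n.
Proof.
rewrite !disc_laplacianE /re /im -Re_sum -Im_sum.
have Re_mulrn (z : R[i]) k : complex.Re (z *+ k) = complex.Re z *+ k.
  by elim: k => // k ih; rewrite !mulrS -ih; case: z {ih} => a b; case: (_ *+ k).
have Im_mulrn (z : R[i]) k : complex.Im (z *+ k) = complex.Im z *+ k.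
  by elim: k => // k ih; rewrite !mulrS -ih; case: z {ih} => a b; case: (_ *+ k).
by rewrite -Re_mulrn -Im_mulrn; case: (\sum_a _) => a b; case: (_ *+ _).
Qed.

Variable u : lattice d -> R.
Hypothesis gu : ground_state sigma omega u.
Local Notation Lr := (rLplus sigma omega u).

Lemma re_Lplus F n : complex.Re (Lplus sigma omega u F n) = Lr (re F) n.
Proof.
have [+ _] := disc_laplacian_ReIm F n.
rewrite /Lplus /rLplus /axpy /helmholtz /potential_mul /potential => <-; rewrite /re.
by case: (disc_laplacian F n) (F n) => [a b] [a' b'] /=; ring.
Qed.

Lemma im_Lplus F n : complex.Im (Lplus sigma omega u F n) = Lr (im F) n.
Proof.
have [_ +] := disc_laplacian_ReIm F n.
rewrite /Lplus /rLplus /axpy /helmholtz /potential_mul /potential => <-; rewrite /im.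
by case: (disc_laplacian F n) (F n) => [a b] [a' b'] /=; ring.
Qed.

Lemma eigenvectorsP lambda F : eigenvectors (Lplus sigma omega u) lambda F <->
  [/\ sqsum (re F), sqsum (im F), forall n, Lr (re F) n = lambda * re F n
    & forall n, Lr (im F) n = lambda * im F n].
Proof.
have E n : lambda%:C * F n = Complex (lambda * re F n) (lambda * im F n).
  rewrite /re /im; case: (F n) => a b /=.
  by apply/eqP; rewrite eq_complex /=; apply/andP; split; apply/eqP; ring.
split=> [[/ell2_ReIm[sr si] eF]|[sr si er ei]].
  by split => // n; rewrite -?re_Lplus -?im_Lplus eF E.
split=> [|n]; first exact/ell2_ReIm.
by rewrite E -er -ei -re_Lplus -im_Lplus; case: (Lplus _ _ _ _ _).
Qed.

(** [L_+] is a real operator, so real and imaginary parts of an eigenfunction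
    with negative eigenvalue are multiples of the lowest eigenfunction. *)
Lemma morse_index_ground_state : morse_index (Lplus sigma omega u) = 1%E.
Proof.
have [mu [f [mu0 sf f0 ef]]] := lowest_eigenfunction sigma0 omega0 gu.
have [n0 fn0] : exists n, f n != 0.
  apply: contrapT => /forallNP H; move: f0; rewrite /ip (_ : (fun n => _) = fun=> 0) ?tsum0 ?ltxx //.
  by apply/funext => n; have /negP := H n; rewrite negbK => /eqP ->; rewrite mulr0.
have span lambda F : lambda < 0 -> eigenvectors (Lplus sigma omega u) lambda F ->
    exists z : R[i], forall n, F n = z * (f n)%:C.
  move=> l0 /eigenvectorsP[sr si er ei].
  have [a ha] := negative_eigenfunction_unique sigma0 omega0 gu mu0 sf f0 ef l0 sr er.
  have [b hb] := negative_eigenfunction_unique sigma0 omega0 gu mu0 sf f0 ef l0 si ei.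
  exists (Complex a b) => n; have := ha n; have := hb n; rewrite /re /im.
  case: (F n) => x y /= -> ->.
  by apply/eqP; rewrite eq_complex /=; apply/andP; split; apply/eqP; ring.
have other lambda F : lambda < 0 -> lambda != mu ->
    eigenvectors (Lplus sigma omega u) lambda F -> forall n, F n = 0.
  move=> l0 lm eF; have [sr si er ei] := (eigenvectorsP lambda F).1 eF.
  have zero h : sqsum h -> (forall n, Lr h n = lambda * h n) -> forall n, h n = 0.
    move=> sh eh; have [r hr] :=
      negative_eigenfunction_unique sigma0 omega0 gu mu0 sf f0 ef l0 sh eh.
    have E : ip (Lr h) f = ip h (Lr f) by exact: rLplus_sym.
    move: E; rewrite (_ : Lr h = fun n => lambda * h n); last exact/funext.
    rewrite (_ : Lr f = fun n => mu * f n); last exact/funext.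
    rewrite (ipZl _ sh sf) [in RHS]ipC (ipZl _ sf sh) (ipC f h) => /eqP.
    rewrite -subr_eq0 -mulrBl mulf_eq0 subr_eq0 (negbTE lm) /=.
    rewrite (_ : h = fun n => r * f n) ?(ipZl _ sf sf); last exact/funext.
    by rewrite mulf_eq0 (gt_eqF f0) orbF => /eqP -> n; rewrite mul0r.
  move=> n; have := zero _ sr er n; have := zero _ si ei n; rewrite /re /im.
  by case: (F n) => a b /= -> ->.
have single m (G : 'I_m -> lattice d -> R[i]) (i : 'I_m) :
    linearly_independent G -> ~ (forall n, G i n = 0).
  move=> li G0; have := li (fun k => (k == i)%:R) _ i; rewrite eqxx.
  move=> H; suff /eqP : (1 : R[i]) = 0 by rewrite oner_eq0.
  apply: H => n; rewrite (bigD1 i) //= G0 mulr0 add0r big1 // => k /negbTE ->.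
  by rewrite mul0r.
have mult_ge0 lambda : (0 <= multiplicity (Lplus sigma omega u) lambda)%E.
  apply: ereal_sup_ubound; exists 0%N => //=; exists (fun _ _ => 0).
  by split => [c _|] [].
have mult_mu : multiplicity (Lplus sigma omega u) mu = 1%E.
  apply/eqP; rewrite eq_le; apply/andP; split.
    apply: ge_ereal_sup => _ [m [G [li eG]] <-]; rewrite lee_fin (ler_nat R m 1).
    rewrite leqNgt; apply/negP => m2.
    pose i0 := Ordinal (ltnW m2); pose i1 := Ordinal m2.
    have [z0 hz0] := span _ _ mu0 (eG i0); have [z1 hz1] := span _ _ mu0 (eG i1).
    have i10 : i1 == i0 = false by [].
    (* [z1 G i0 - z0 G i1 = 0], as both are multiples of the same function. *)
    have := li (fun k => if k == i0 then z1 else if k == i1 then - z0 else 0) _ i1.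
    rewrite i10 eqxx => H; have z00 : z0 = 0.
      apply/eqP; rewrite -oppr_eq0; apply/eqP; apply: H => n.
      rewrite (bigD1 i0) //= ?eqxx (bigD1 i1) //= ?i10 ?eqxx hz0 hz1 big1 ?addr0.
        by ring.
      by move=> k /andP[/negbTE -> /negbTE ->]; rewrite mul0r.
    by apply: (single _ _ i0 li) => n; rewrite hz0 z00 mul0r.
  apply: ereal_sup_ubound; exists 1%N => //=; exists (fun _ n => (f n)%:C); split.
    move=> c /(_ n0); rewrite big_ord1 => /eqP; rewrite mulf_eq0.
    rewrite (_ : ((f n0)%:C == 0) = false) ?orbF => [/eqP c0 i|]; first by rewrite (ord1 i).
    by apply/negbTE; rewrite eq_complex /= negb_and fn0.
  move=> _; apply/eigenvectorsP; rewrite re_real im_real; split => //.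
    exact: sqsum0.
  move=> n; rewrite mulr0 /rLplus /axpy /helmholtz /potential_mul disc_laplacianE big1 //.
  by rewrite mul0rn; ring.
rewrite /morse_index -mult_mu -(@esum_set1 R R mu (multiplicity (Lplus sigma omega u))) //.
rewrite esum_mkcond [RHS]esum_mkcond; apply: eq_esum => l _.
case: ifPn => [|/negP] hl; case: ifPn => [|/negP] hm //.
  have lm : l != mu by apply/eqP => lm; apply: hm; rewrite inE.
  rewrite inE /= in hl; apply/eqP; rewrite eq_le mult_ge0 andbT.
  apply: ge_ereal_sup => _ [m [G [li eG]] <-]; rewrite lee_fin.
  case: m G li eG => [//|m] G li eG.
  by case: (single _ _ ord0 li); exact: (other _ _ hl lm (eG ord0)).
by case: hl; move: hm; rewrite !inE /= => ->.
Qed.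

End MorseIndex.

(* MathComp-Analysis.  The problem is invariant under the translations of the
   lattice, so the compactness of minimizing sequences is up to translation. *)
Theorem theorem3 (R : realType) (d : nat) (sigma omega : R)
    (hd : (1 <= d)%N) (hsigma : 0 < sigma) (homega : 0 < omega) :
  (exists u : lattice d -> R,
     [/\ is_minimizer sigma omega (fun n => (u n)%:C),
         forall n, 0 <= u n,
         forall (j0 : 'I_d) (k : lattice d), bell_shaped (line u j0 k),
         euler_lagrange sigma omega u
       & morse_index (Lplus sigma omega u) = 1%E]) /\
  0 < min_energy d sigma omega /\
  (forall u : nat -> lattice d -> R[i],
     minimizing_sequence sigma omega u ->
     exists (phi : nat -> nat) (y : nat -> lattice d) (v : lattice d -> R[i]),
       [/\ {homo phi : m n / (m < n)%N >-> (m < n)%N},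
           is_minimizer sigma omega v
         & lp_norm 2 (fun n => translate (y k) (u (phi k)) n - v n)
             @[k --> \oo] --> 0%E]).
Proof.
split; last by split; [exact: min_energy_gt0|move=> u; exact: minimizing_sequence_compact].
have [v mv] := @minimizer_exists R d _ _ hsigma homega.
have [u gu bell] := bell_shaped_ground_state_exists hsigma homega
  (ex_intro _ _ (ground_state_modulus hsigma homega mv)).
have [mu u0] := (ground_stateP hsigma homega u).1 gu.
exists u; split => //; first exact: ground_state_euler_lagrange.
exact: morse_index_ground_state.
Qed.
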